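(* Let $l\in\mathbb{N}$, $1<p<\infty$, $f\in L^p(\mathbb{T})$, and let the Fourier series of $f$ be $$f(x)\sim\sum_{n=1}^\infty(a_n\cos nx+b_n\sin nx),$$ where $\{a_n\}_{n\in\mathbb{N}}$ and $\{b_n\}_{n\in\mathbb{N}}$ are nonnegative general monotone sequences. Then for all $t>0$ $$\omega_l(f,t)_p\asymp\left(\sum_{\nu=1}^\infty\min(1,\nu t)^{lp}\,\nu^{p-2}\left(a_\nu^p+b_\nu^p\right)\right)^{1/p}.$$
   Context: Functions on $\mathbb{T}$ are $2\pi$-periodic. Modulus of smoothness: $\omega_l(f,t)_p=\sup_{|h|\le t}\|\Delta_h^lf\|_{L^p(\mathbb{T})}$, where $\Delta_hf(x)=f(x+h)-f(x)$ and $\Delta_h^l=\Delta_h^{l-1}\Delta_h$. General monotone sequence: a null-sequence (tending to zero) $a=\{a_n\}_{n\in\mathbb{N}}$ of complex numbers is general monotone ($a\in GM$) if there exist constants $c>1$ and $C>0$ such that, with $\Delta a_k=a_k-a_{k+1}$, $$\sum_{k=n}^\infty|\Delta a_k|\le C\sum_{k=[n/c]}^\infty\frac{|a_k|}{k},\qquad n\in\mathbb{N},$$ where $[x]$ is the integer part of $x$ and the right-hand sum runs over $k\ge\max(1,[n/c])$. $A\asymp B$ means $K^{-1}B\le A\le KB$ with a constant $K>0$ depending only on $l,p$ and on the constants $c,C$ in the $GM$ conditions for $\{a_n\}$ and $\{b_n\}$ (in particular not on $t$). *)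

(* Defs.v *)
From HB Require Import structures.
From mathcomp Require Import all_boot all_order all_algebra.
From mathcomp Require Import all_classical all_reals all_analysis.

Set Implicit Arguments.
Unset Strict Implicit.
Unset Printing Implicit Defensive.
Import Order.TTheory GRing.Theory Num.Theory.
Import numFieldNormedType.Exports.
Local Open Scope classical_set_scope.
Local Open Scope ring_scope.

(* Functions on the circle are 2pi-periodic functions R -> R. Integrals over
   the circle are taken with respect to dx on the period ]-pi, pi], without
   the normalisation 1/(2pi). *)
Definition circle_measure (R : realType) :
    {measure set (measurableTypeR R) -> \bar R} :=
  mrestr lebesgue_measure (measurable_itv `]- (@pi R), @pi R]).

(* f must be (Borel) measurable with finite L^p norm over a period. *)
Definition in_Lp_circle (R : realType) (p : R) (f : R -> R) : Prop :=
  periodic f (pi *+ 2) /\ f \in Lfun (circle_measure R) p%:E.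

Definition fwd_diff (R : realType) (h : R) (f : R -> R) : R -> R :=
  fun x => f (x + h) - f x.

Definition modulus_of_smoothness (R : realType) (l : nat) (p : R) (f : R -> R)
    (t : R) : \bar R :=
  ereal_sup [set Lnorm (circle_measure R) p%:E (EFin \o iter l (fwd_diff h) f)
            | h in [set h : R | `|h| <= t]].

(* Sequences are indexed from 1: the value at 0 is never used. *)
Definition has_fourier_series (R : realType) (f : R -> R) (a b : nat -> R)
    : Prop :=
  [/\ \int[circle_measure R]_x f x = 0,
      forall n, (0 < n)%N ->
        a n = pi^-1 * \int[circle_measure R]_x (f x * cos (n%:R * x)) &
      forall n, (0 < n)%N ->
        b n = pi^-1 * \int[circle_measure R]_x (f x * sin (n%:R * x)) ].

(* The general monotone condition with given constants c and C; a is general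
   monotone when this holds for some c and C. The values may be real or complex.
   Both sides are sums of nonnegative terms, hence extended reals. *)
Definition general_monotone (R : realType) (V : normedModType R) (c C : R)
    (a : nat -> V) : Prop :=
  [/\ 1 < c, 0 < C, a n @[n --> \oo] --> (0 : V) &
      forall n, (0 < n)%N ->
        (\sum_(n <= k <oo) (`|a k - a k.+1|)%:E <=
         C%:E * \sum_(maxn 1 (Num.truncn (n%:R / c)) <= k <oo)
                  (`|a k| / k%:R)%:E)%E ].

Definition smoothness_sum (R : realType) (l : nat) (p : R) (a b : nat -> R)
    (t : R) : \bar R :=
  ((\sum_(1 <= v <oo)
      (Num.min 1 (v%:R * t) `^ (l%:R * p) * v%:R `^ (p - 2) *
       (a v `^ p + b v `^ p))%:E) `^ p^-1)%E.

(* Main.v *)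
(* Everything is measured on dyadic scales: the frequencies are cut into blocks
   2^j <= k < 2^(j+1) and the circle into annuli pi/2^(i+1) < |x| <= pi/2^i. Let
   alpha_j be the mean of a_k + b_k over block j, w_j = min(1, 2^j t)^l and
   E(x) = sum_j 2^(j(p-1)) x_j^p. A kernel min(1, 2^(i-j)) is bounded for E by a
   discrete Hardy inequality; with general monotonicity this makes the sum of the
   theorem comparable with E(w alpha) and with E(w v), where v_j is the variation
   of the coefficients beyond 2^j.
   Lower bound: testing against a de la Vallee Poussin type polynomial, whose size
   on the annuli is explicit, bounds alpha_j by the L^1 norms of f over the
   annuli, hence E(alpha) by the p-th power of the L^p norm of f. Applied to
   l-th differences of f, the multipliers 2 sin(kh/2) produce the weights w_j.
   Upper bound: summation by parts bounds a trigonometric polynomial on annulus i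
   by 2^i sum_m min(1, 2^(m-i)) v_m, and Hardy's inequality gives an L^p bound by
   E. Fejer's kernel at Lebesgue points transfers it from the partial sums to f. *)

Require Import Defs.
From mathcomp Require Import all_boot all_order all_algebra.
From mathcomp Require Import all_classical all_reals all_analysis.
From mathcomp Require Import measurable_realfun zify ring lra.
Import Order.TTheory GRing.Theory Num.Theory.
Import numFieldNormedType.Exports.
Local Open Scope classical_set_scope.
Local Open Scope ring_scope.

(** The range 1 < p < oo enters through one number: E has the weights kap^(jp) with kap = 2^(1 -
    1/p), and 1 < kap < 2 makes the Hardy kernel decay in both directions. The kernel arises in
    three ways: from a test polynomial at scale j seen on annulus i, from a frequency block seen on
    an annulus, and from the tails that general monotonicity produces. The obstacle in the lower
    bound is that 2 sin(kh/2) vanishes when kh is a multiple of 2 pi, so once 2^j t is large a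
    difference of step t may lose frequencies of block j. There the order is doubled: (2
    sin(kh/2))^(2l) >= 1 - 2l cos(kh), and the cosine oscillates fast enough to be summed by parts
    against the variation of the coefficients. The loss has relative size 1/(2^j t); it is small
    only beyond 2^M/t, and below that threshold the smaller step t/2^M keeps all sines positive. In
    the upper bound the multipliers are small only up to frequency 1/t. *)

Lemma nneseries_le_ub {R : realType} (u : nat -> \bar R) (m : nat) (c : \bar R) :
  (forall i, (0 <= u i)%E) ->
  (forall n, (\sum_(m <= i < n) u i <= c)%E) -> (\sum_(m <= i <oo) u i <= c)%E.
Proof.
move=> u0 uc; apply: lime_le.
  by apply: is_cvg_nneseries => n _ _; exact: u0.
by apply: nearW.
Qed.

Lemma nneseries_ge_term {R : realType} (u : nat -> \bar R) (i : nat) :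
  (forall i, (0 <= u i)%E) -> (u i <= \sum_(j <oo) u j)%E.
Proof.
move=> u0; apply: (@le_trans _ _ (\sum_(0 <= j < i.+1) u j)%E).
  by rewrite big_nat_recr//= leeDr// sume_ge0.
by apply: nneseries_lim_ge => n _ _; exact: u0.
Qed.

Lemma le_powR_inv {R : realType} (p a b : R) : 0 < p -> 0 <= a ->
  a `^ p <= b -> a <= b `^ p^-1.
Proof.
move=> p0 a0 ab; rewrite (_ : a = (a `^ p) `^ p^-1); last first.
  by rewrite -powRrM mulfV ?gt_eqF// powRr1.
apply: ge0_ler_powR; rewrite ?nnegrE ?invr_ge0 ?powR_ge0 ?(ltW p0)//.
exact: le_trans (powR_ge0 _ _) ab.
Qed.

(** * Dyadic norms and the discrete Hardy inequality *)

Definition natdist (i j : nat) : nat := ((i - j) + (j - i))%N.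

Lemma natdistC i j : natdist i j = natdist j i.
Proof. by rewrite /natdist addnC. Qed.

Definition dyadic_ratio {R : realType} (p : R) : R := 2 `^ (1 - p^-1).

(* Since [dyadic_ratio p `^ p = 2 `^ (p - 1)], this is the sum of
   [2 `^ (j (p - 1)) * x j `^ p]: the weight [k `^ (p - 2)] summed over the
   dyadic block [2 ^ j <= k < 2 ^ j.+1]. *)
Definition dyadic_norm {R : realType} (p : R) (x : nat -> R) : \bar R :=
  (\sum_(j <oo) ((dyadic_ratio p ^+ j * x j) `^ p)%:E)%E.

(** Kernel of a two-sided Hardy operator: summed against x over i it gives the tail sum of [x i] for
    i >= j plus 2^-j times the sum of 2^i [x i] for i < j. *)
Definition dyadic_kernel {R : realType} (i j : nat) : R :=
  Num.min 1 (2 ^+ i / 2 ^+ j).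

Section dyadic_norm.
Context {R : realType}.
Implicit Types (x y : nat -> R).

Lemma sum_expr_natdist (q : R) (n j : nat) : 0 < q < 1 ->
  \sum_(0 <= i < n) q ^+ natdist i j <= 2 / (1 - q).
Proof.
move=> /andP[q0 q1].
have q1' : 0 < 1 - q by rewrite subr_gt0.
(* The subtracted [q ^+ j] makes the bound inductive: removing the term i = 0 lowers both indices by
   one, and its cost [q ^+ k.+1] is covered, with q^k (1 - q)^2 to spare after multiplying by 1 -
   q. *)
have H : forall j n, \sum_(0 <= i < n) q ^+ natdist i j <= (2 - q ^+ j) / (1 - q).
  elim=> [m|k IH [|m]].
  - rewrite expr0 (_ : 2 - 1 = 1 :> R); last by lra.
    rewrite ler_pdivlMr//.
    under eq_bigr => i _ do rewrite /natdist subn0 sub0n addn0.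
    rewrite mulrC big_mkord -opprB mulNr -subrX1 opprB.
    by rewrite gerBl exprn_ge0// ltW.
  - rewrite big_geq// divr_ge0 ?(ltW q1')// subr_ge0.
    by rewrite (@le_trans _ _ 1) ?exprn_ile1 ?ltW//; lra.
  - rewrite big_nat_recl//.
    under eq_bigr => i _ do rewrite /natdist !subSS -/(natdist i k).
    rewrite /natdist subn0 sub0n add0n.
    apply: (@le_trans _ _ (q ^+ k.+1 + (2 - q ^+ k) / (1 - q))).
      by rewrite lerD2l.
    rewrite ler_pdivlMr// mulrDl divfK ?gt_eqF// exprS.
    have u0 : 0 <= q ^+ k by rewrite exprn_ge0 ?ltW.
    have := mulr_ge0 u0 (sqr_ge0 (1 - q)); rewrite expr2; nra.
apply: (le_trans (H j n)); rewrite ler_pM2r ?invr_gt0//.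
by rewrite gerBl exprn_ge0// ltW.
Qed.

Variable p : R.
Hypothesis p1 : 1 < p.
Let p0 : 0 < p. Proof. exact: lt_trans p1. Qed.
Local Notation kap := (dyadic_ratio p).

Let gt1_powR2 (r : R) : 0 < r -> 1 < 2 `^ r.
Proof.
move=> r0; have := @gt0_ltr_powR _ r r0 1 2.
by rewrite !nnegrE powR1; apply; rewrite ?ltr1n.
Qed.

Lemma dyadic_ratio_gt1 : 1 < kap.
Proof. by rewrite gt1_powR2// subr_gt0 invf_lt1. Qed.

Lemma dyadic_ratio_lt2 : kap < 2.
Proof.
rewrite /dyadic_ratio powRB ?pnatr_eq0 ?implybT// powRr1//.
by rewrite gtr_pMr// invf_lt1 ?powR_gt0// gt1_powR2// invr_gt0.
Qed.

Let kap0 : 0 < kap. Proof. exact: lt_trans dyadic_ratio_gt1. Qed.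

Lemma dyadic_ratio_powR j : (kap ^+ j) `^ p = (2 ^+ j) `^ (p - 1).
Proof.
have -> : p - 1 = (1 - p^-1) * p by rewrite mulrBl mulVf ?gt_eqF// mul1r.
rewrite powRrM; congr (_ `^ p).
elim: j => [|j IH]; first by rewrite !expr0 powR1.
by rewrite !exprS IH powRM// exprn_ge0.
Qed.

Lemma dyadic_norm_ge0 x : (0 <= dyadic_norm p x)%E.
Proof. by apply: nneseries_ge0 => i _ _; rewrite lee_fin powR_ge0. Qed.

Lemma dyadic_kernel_ge0 i j : 0 <= dyadic_kernel i j :> R.
Proof. by rewrite /dyadic_kernel le_min ler01/= divr_ge0 ?exprn_ge0. Qed.

Lemma dyadic_kernel_le1 i j : dyadic_kernel i j <= 1 :> R.
Proof. by rewrite /dyadic_kernel minEle; case: (leP 1 (_ / _)) => // /ltW. Qed.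

Lemma dyadic_kernel_leX i j : dyadic_kernel i j <= 2 ^+ i / 2 ^+ j :> R.
Proof. by rewrite /dyadic_kernel minElt; case: (ltP 1 (_ / _)) => // /ltW. Qed.

(** For j <= i the kernel is only bounded by 1, and the decay comes from the weights, which need kap
    > 1. For i < j the weights grow like kap^(j - i), and the kernel 2^-(j - i) beats them because
    kap < 2. *)
Lemma dyadic_kernel_le (i j : nat) :
  kap ^+ j * dyadic_kernel i j <=
  Num.max (kap^-1) (kap / 2) ^+ natdist i j * kap ^+ i.
Proof.
have k0 := kap0; set k := kap in k0 *.
have kn n : 0 <= k ^+ n by exact: exprn_ge0 (ltW k0).
have [ij|ij] := leqP j i.
- apply: (@le_trans _ _ (k ^+ j)).
    by rewrite ler_piMr// dyadic_kernel_le1.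
  have -> : k ^+ i = k ^+ (i - j) * k ^+ j by rewrite -exprD subnK.
  rewrite /natdist (eqP ij) addn0 mulrA -exprMn.
  rewrite ler_peMl// exprn_ege1//.
  by rewrite -ler_pdivrMr// mul1r le_max lexx.
- have {}ij := ltnW ij.
  apply: (@le_trans _ _ (k ^+ j * (2 ^+ i / 2 ^+ j))).
    by rewrite ler_pM2l ?exprn_gt0// dyadic_kernel_leX.
  have E (a : R) : a ^+ j = a ^+ (j - i) * a ^+ i by rewrite -exprD subnK.
  rewrite /natdist (eqP ij) add0n !E.
  rewrite [leLHS](_ : _ = (k / 2) ^+ (j - i) * k ^+ i); last first.
    by rewrite expr_div_n; field; rewrite !expf_neq0// pnatr_eq0.
  rewrite ler_pM2r ?exprn_gt0// lerXn2r ?nnegrE ?divr_ge0 ?(ltW k0)//.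
    by rewrite le_max invr_ge0 (ltW k0).
  by rewrite le_max lexx orbT.
Qed.

(* Schur-type estimate: after rescaling by powers of the ratio the kernel is
   dominated by a geometric convolution kernel [th ^+ natdist i j]. Writing
   [th = q * q] and bounding one factor [q ^+ natdist i j * z i] by the l^p norm
   of the sequence of these products avoids Hoelder's inequality. *)
Lemma hardy_dyadic : exists2 C : R, 0 < C & forall x y,
  (forall i, 0 <= x i) -> (forall j, 0 <= y j) ->
  (forall j, ((y j)%:E <= \sum_(i <oo) (dyadic_kernel i j * x i)%:E)%E) ->
  (dyadic_norm p y <= C%:E * dyadic_norm p x)%E.
Proof.
pose th := Num.max (kap^-1) (kap / 2).
have k1 := dyadic_ratio_gt1; have k2 := dyadic_ratio_lt2; have k0 := kap0.
have th0 : 0 < th by rewrite lt_max invr_gt0 k0.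
have th1 : th < 1 by rewrite gt_max invf_lt1// k1 ltr_pdivrMr// mul1r.
pose q := Num.sqrt th.
have q0 : 0 < q by rewrite sqrtr_gt0.
have qq : q * q = th by rewrite -expr2 sqr_sqrtr// ltW.
have q1 : q < 1 by nra.
pose c := 2 / (1 - q).
have c0 : 0 < c by rewrite divr_gt0// subr_gt0.
exists (c `^ p * c); first by rewrite mulr_gt0// powR_gt0.
move=> x y x0 y0 yx.
pose z i := kap ^+ i * x i.
have z0 i : 0 <= z i by rewrite mulr_ge0// exprn_ge0// ltW.
have qn i j : 0 <= q ^+ natdist i j by rewrite exprn_ge0// ltW.
pose M j := (\sum_(i <oo) ((q ^+ natdist i j * z i) `^ p)%:E)%E.
have M0 j : (0 <= M j)%E by apply: nneseries_ge0 => i _ _; rewrite lee_fin powR_ge0.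
have step j : (((kap ^+ j * y j) `^ p)%:E <= (c `^ p)%:E * M j)%E.
  case E : (M j) => [m||]; last by move: (M0 j); rewrite E.
    2: by rewrite gt0_muley ?leey// lte_fin powR_gt0.
  have m0 : 0 <= m by rewrite -lee_fin -E.
  rewrite -EFinM lee_fin.
  have qz i : q ^+ natdist i j * z i <= m `^ p^-1.
    apply: le_powR_inv => //; first by rewrite mulr_ge0.
    rewrite -lee_fin -E; apply: (@nneseries_ge_term _ (fun i => ((q ^+ natdist i j * z i) `^ p)%:E)).
    by move=> k; rewrite lee_fin powR_ge0.
  have : ((kap ^+ j * y j)%:E <= (c * m `^ p^-1)%:E)%E.
    rewrite EFinM; apply: (@le_trans _ _ ((kap ^+ j)%:E * (\sum_(i <oo) (dyadic_kernel i j * x i)%:E))%E).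
      by apply: lee_wpmul2l => //; rewrite lee_fin exprn_ge0// ltW.
    rewrite -nneseriesZl; last first.
      by move=> i _; rewrite lee_fin mulr_ge0 ?dyadic_kernel_ge0.
    apply: nneseries_le_ub => [i|n].
      by rewrite -EFinM lee_fin !mulr_ge0 ?dyadic_kernel_ge0 ?exprn_ge0// ltW.
    under eq_bigr => i _ do rewrite -EFinM.
    rewrite sumEFin lee_fin.
    apply: (@le_trans _ _ (\sum_(0 <= i < n) q ^+ natdist i j * m `^ p^-1)).
      apply: ler_sum => i _; rewrite mulrA.
      apply: (@le_trans _ _ (q ^+ natdist i j * (q ^+ natdist i j * z i))).
        rewrite !mulrA -exprMn qq.
        by apply: ler_wpM2r => //; exact: dyadic_kernel_le.
      by apply: ler_wpM2l.
    rewrite -mulr_suml ler_wpM2r ?powR_ge0// /c sum_expr_natdist// q0 q1//.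
  rewrite lee_fin => H.
  have -> : c `^ p * m = (c * m `^ p^-1) `^ p.
    by rewrite [RHS]powRM ?powR_ge0 ?(ltW c0)// -(powRrM m) mulVf ?gt_eqF// powRr1.
  apply: ge0_ler_powR; rewrite ?nnegrE ?(ltW p0)//.
    by rewrite mulr_ge0// exprn_ge0// ltW.
  by rewrite mulr_ge0 ?powR_ge0// ltW.
apply: (@le_trans _ _ (\sum_(j <oo) ((c `^ p)%:E * M j))%E).
  apply: lee_nneseries => // j _ _; by rewrite lee_fin powR_ge0.
rewrite nneseriesZl// EFinM -muleA.
apply: lee_wpmul2l => //; first by rewrite lee_fin powR_ge0.
rewrite /M nneseries_interchange; last by move=> *; rewrite lee_fin powR_ge0.
rewrite -nneseriesZl; last by move=> *; rewrite lee_fin powR_ge0.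
apply: lee_nneseries => [i _ _|i _].
  by apply: nneseries_ge0 => *; rewrite lee_fin powR_ge0.
apply: nneseries_le_ub => [j|n]; first by rewrite lee_fin powR_ge0.
rewrite sumEFin -EFinM lee_fin.
apply: (@le_trans _ _ (\sum_(0 <= j < n) q ^+ natdist j i * z i `^ p)).
  apply: ler_sum => j _; rewrite powRM// natdistC ler_wpM2r ?powR_ge0//.
  by rewrite ge1r_powR ?(ltW p1)// exprn_gt0//= exprn_ile1// ltW.
rewrite -mulr_suml ler_wpM2r ?powR_ge0// /c sum_expr_natdist// q0 q1//.
Qed.

(** Obtained by testing [hardy_dyadic] on sequences that vanish except at j, where they equal a
    partial sum of the series; the resulting bound does not depend on the length of that partial
    sum. *)
Lemma dyadic_norm_fin x (j : nat) : (forall i, 0 <= x i) ->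
  (dyadic_norm p x < +oo)%E -> (\sum_(i <oo) (dyadic_kernel i j * x i)%:E < +oo)%E.
Proof.
move=> x0 xoo; have [C C0 H] := hardy_dyadic.
pose u i := (dyadic_kernel i j * x i)%:E.
have u0 i : (0 <= u i)%E by rewrite lee_fin mulr_ge0// dyadic_kernel_ge0.
have D0 := dyadic_norm_ge0 x.
pose B := fine (C%:E * dyadic_norm p x)%E.
have Bfin : (C%:E * dyadic_norm p x)%E = B%:E.
  by rewrite fineK// ge0_fin_numE ?mule_ge0 ?lee_fin ?(ltW C0)// lte_mul_pinfty ?lee_fin ?(ltW C0).
apply: (@le_lt_trans _ _ (B `^ p^-1)%:E); last exact: ltry.
apply: nneseries_le_ub => // n.
pose s := \sum_(0 <= i < n) (dyadic_kernel i j * x i).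
have s0 : 0 <= s by apply: sumr_ge0 => i _; rewrite mulr_ge0// dyadic_kernel_ge0.
have -> : (\sum_(0 <= i < n) u i)%E = s%:E by rewrite sumEFin.
pose y k := if k == j then s else 0.
have y0 k : 0 <= y k by rewrite /y; case: ifP.
have yx k : ((y k)%:E <= \sum_(i <oo) (dyadic_kernel i k * x i)%:E)%E.
  rewrite /y; case: eqP => [->|_].
    by rewrite /s -sumEFin; apply: nneseries_lim_ge => i _ _; exact: u0.
  by apply: nneseries_ge0 => i _ _; rewrite lee_fin mulr_ge0 ?dyadic_kernel_ge0.
have k0 := kap0.
have : (((kap ^+ j * s) `^ p)%:E <= B%:E)%E.
  rewrite -Bfin; apply: le_trans (H x y x0 y0 yx).
  apply: le_trans (@nneseries_ge_term _ (fun k => ((kap ^+ k * y k) `^ p)%:E) j _).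
    by rewrite /y eqxx.
  by move=> i; rewrite lee_fin powR_ge0.
rewrite !lee_fin => H2.
apply: (@le_trans _ _ (kap ^+ j * s)).
  by rewrite ler_peMl// exprn_ege1// ltW// dyadic_ratio_gt1.
have ks0 : 0 <= kap ^+ j * s by rewrite mulr_ge0// exprn_ge0// ltW.
exact: le_powR_inv.
Qed.

End dyadic_norm.

(** * Translations and dyadic annuli of the circle *)

Section circle.
Context {R : realType}.
Local Notation mu := (circle_measure R).
Local Notation leb := (@lebesgue_measure R).
Local Notation circ := (`]- (@pi R), @pi R]%classic).
Implicit Types (f : R -> \bar R) (u : R -> R).

Lemma integral_circle f : measurable_fun setT f ->
  (\int[mu]_x f x = \int[leb]_(x in circ) f x)%E.
Proof.
move=> mf; have mC : measurable (circ : set (measurableTypeR R)) by [].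
rewrite -(setUv circ) integral_setU//; last 3 first.
- exact: measurableC.
- by rewrite setUv.
- by rewrite disj_set2E setICr.
rewrite (@null_set_integral _ (measurableTypeR R) _ mu (~` circ) f) ?adde0; last 3 first.
- exact: measurableC.
- exact: measurable_funTS.
- by rewrite /circle_measure /= /mrestr setICl measure0.
apply: eq_measure_integral => A mA AC.
by rewrite /circle_measure /= /mrestr setIidl.
Qed.

Lemma measurable_shift (h : R) : measurable_fun setT (fun x : R => x + h).
Proof. by apply: measurable_funD. Qed.

Lemma ge0_integral_shift f (A : set R) (h : R) : measurable A ->
  measurable_fun setT f -> (forall x, 0 <= f x)%E ->
  (\int[leb]_(x in (fun x : R => (x + h)%R) @^-1` A) f (x + h)%R = \int[leb]_(x in A) f x)%E.
Proof.
move=> mA mf f0.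
have ms := measurable_shift h.
have := @ge0_integral_pushforward _ _ (measurableTypeR R) (measurableTypeR R) R _ ms leb A f mA.
move=> <-//; last exact: measurable_funTS.
apply: eq_measure_integral => B mB _; apply/esym.
apply: lebesgue_measure_unique => // X [[a b] _ <-].
rewrite /= /pushforward.
rewrite (_ : _ @^-1` _ = [set` `]a - h, b - h]]); last first.
  by apply/seteqP; split => x /=; rewrite !in_itv/= ltrBlDr lerBrDr.
rewrite !lebesgue_measure_itv/= !lte_fin ltrD2r; case: ifP => // _.
by rewrite -!EFinD; congr EFin; ring.
Qed.

(** For a shift k in [0, 2 pi[ the translated period sticks out by ]pi, pi + k], and one period
    moves this piece back onto the missing ]-pi, -pi + k]. A general shift is first reduced by whole
    periods. *)
Lemma ge0_circle_integral_shift f (h : R) : measurable_fun setT f ->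
  (forall x, f (x + pi *+ 2)%R = f x) -> (forall x, 0 <= f x)%E ->
  (\int[mu]_x f (x + h)%R = \int[mu]_x f x)%E.
Proof.
move=> mf fp f0.
have pi0 := @pi_gt0 R.
have T0 : 0 < (pi : R) *+ 2 by rewrite mulrn_wgt0.
have key (k : R) : 0 <= k < pi *+ 2 -> (\int[mu]_x f (x + k)%R = \int[mu]_x f x)%E.
  move=> /andP[k0 k2].
  have mfk : measurable_fun setT (fun x : R => f (x + k)).
    exact: (measurableT_comp mf (measurable_shift k)).
  rewrite !integral_circle//.
  have -> : circ = (fun x : R => x + k) @^-1` `]- pi + k, pi + k].
    by apply/seteqP; split => x /=; rewrite !in_itv/= ltrD2r lerD2r.
  rewrite ge0_integral_shift//.
  have E1 : `]- pi + k, pi + k]%classic = `]- pi + k, pi] `|` `]pi, pi + k] :> set R.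
    by rewrite -itv_bndbnd_setU// bnd_simp; rewrite ?lerDl// -lerBrDl opprK -mulr2n ltW.
  have E2 : circ = `]- pi, - pi + k] `|` `]- pi + k, pi].
    by rewrite -itv_bndbnd_setU// bnd_simp; rewrite ?lerDl// -lerBrDl opprK -mulr2n ltW.
  rewrite E1 ge0_integral_setU//=; last 2 first.
    exact: measurable_funTS.
    apply/disj_setPS => x []/=; rewrite !in_itv/= => /andP[_ xp] /andP[px _].
    by move: (lt_le_trans px xp); rewrite ltxx.
  rewrite -[X in (_ + X)%E](@ge0_integral_shift _ _ (pi *+ 2))//.
  have -> : (fun x : R => x + pi *+ 2) @^-1` `]pi, pi + k] = `]- pi, - pi + k]%classic.
    apply/seteqP; split => x /=; rewrite !in_itv/= => /andP[xa xb]; apply/andP; split; lra.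
  have -> : (\int[leb]_(x in `](- pi)%R, (- pi + k)%R]) f (x + pi *+ 2)%R =
      \int[leb]_(x in `](- pi)%R, (- pi + k)%R]) f x)%E by apply: eq_integral.
  rewrite [in RHS](_ : (fun x : R => x + k) @^-1` _ = circ).
    rewrite E2 ge0_integral_setU//= 1?addeC//; first exact: measurable_funTS.
    apply/disj_setPS => x []/=; rewrite !in_itv/= => /andP[_ xp] /andP[px _].
    by move: (lt_le_trans px xp); rewrite ltxx.
  by rewrite -E1; apply/seteqP; split => x /=; rewrite !in_itv/= ltrD2r lerD2r.
pose n := Num.floor (h / (pi *+ 2)).
have -> : (\int[mu]_x f (x + h)%R = \int[mu]_x f (x + (h - (pi *+ 2) *~ n))%R)%E.
  apply: eq_integral => x _.
  have fn (m : nat) y : f (y + (pi *+ 2) *+ m) = f y.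
    by elim: m y => [|m IH] y; rewrite ?addr0// mulrS addrA IH fp.
  case: n => m; first by rewrite -[in RHS](fn m) -addrA subrK.
  by rewrite NegzE mulrNz opprK addrA fn.
apply: key.
have /andP[n1 n2] : n%:~R <= h / (pi *+ 2) < (n + 1)%:~R.
  exact: floor_itv.
rewrite -mulrzr; move: n1 n2; rewrite ler_pdivlMr// ltr_pdivrMr// intrD.
by lra.
Qed.
Lemma circle_integral_shift f (h : R) : measurable_fun setT f ->
  (forall x, f (x + pi *+ 2)%R = f x) ->
  (\int[mu]_x f (x + h)%R = \int[mu]_x f x)%E.
Proof.
move=> mf fp; rewrite integralE [RHS]integralE.
rewrite (_ : (fun x : R => f (x + h)%R)^\+%E = (fun x : R => f^\+ (x + h)%R)%E)//.
rewrite (_ : (fun x : R => f (x + h)%R)^\-%E = (fun x : R => f^\- (x + h)%R)%E)//.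
rewrite !ge0_circle_integral_shift//.
- exact: measurable_funeneg.
- by move=> x; rewrite !funenegE fp.
- exact: measurable_funepos.
- by move=> x; rewrite !funeposE fp.
- by apply/funext => x; rewrite !funenegE.
- by apply/funext => x; rewrite !funeposE.
Qed.

Lemma circle_Rintegral_shift u (h : R) : measurable_fun setT u ->
  periodic u (pi *+ 2) -> \int[mu]_x u (x + h) = \int[mu]_x u x.
Proof.
move=> mf fp; congr fine.
apply: (circle_integral_shift (EFin \o u)) => [|x]; last by rewrite /= fp.
exact/measurable_EFinP.
Qed.

Definition annulus (i : nat) : set R :=
  [set x | pi / 2 ^+ i.+1 < `|x| <= pi / 2 ^+ i].

Lemma measurable_annulus i : measurable (annulus i).
Proof.
rewrite (_ : annulus i = (fun x : R => `|x|) @^-1` `]pi / 2 ^+ i.+1, pi / 2 ^+ i]).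
  by rewrite -[X in measurable X]setTI; exact: normr_measurable.
by apply/seteqP; split => x /=; rewrite in_itv.
Qed.

Lemma measure_annulus i : (mu (annulus i) <= (pi *+ 2 / 2 ^+ i)%:E)%E.
Proof.
have pi0 : 0 < pi / 2 ^+ i :> R by rewrite divr_gt0 ?pi_gt0// exprn_gt0.
rewrite /circle_measure /= /mrestr.
apply: (@le_trans _ _ (leb `[- (pi / 2 ^+ i), pi / 2 ^+ i])).
  apply: le_measure; rewrite ?inE//.
  - by apply: measurableI => //; exact: measurable_annulus.
  - by move=> x [/= /andP[_ xi] _]; rewrite in_itv/= -ler_norml.
rewrite lebesgue_measure_itv/= lte_fin gt0_cp// -EFinD lee_fin opprK.
by rewrite -mulrDl mulr2n.
Qed.

Lemma trivIset_annulus : trivIset setT annulus.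
Proof.
apply/trivIsetP => i j _ _; wlog ij : i j / (i < j)%N.
  by move=> H; rewrite neq_ltn => /orP[ij|ij]; [|rewrite setIC]; apply: H; rewrite // neq_ltn ij.
move=> _; apply/seteqP; split => // x [/= /andP[x1 _] /andP[_ x2]].
have := lt_le_trans x1 x2; rewrite ltNge => /negP; apply.
by rewrite ler_pM2l ?pi_gt0// lef_pV2 ?posrE ?exprn_gt0// ler_eXn2l ?ltr1n.
Qed.

Lemma annulus_cover (x : R) : circ x -> x != 0 -> exists i, annulus i x.
Proof.
move=> /= /[!in_itv]/= /andP[x1 x2] x0.
have nx0 : 0 < `|x| by rewrite normr_gt0.
have pi0 := @pi_gt0 R.
have [n /= n1] : exists n, pi / 2 ^+ n.+1 < `|x|.
  have q0 : 0 <= pi / `|x| by rewrite divr_ge0// ltW.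
  exists (Num.bound (pi / `|x|)); rewrite ltr_pdivrMr ?exprn_gt0// mulrC.
  rewrite -ltr_pdivrMr//; apply: lt_le_trans (archi_boundP q0) _.
  by rewrite -natrX ler_nat (leq_trans _ (ltnW (ltn_expl _ _))).
have := ex_minnP (ex_intro (fun n => is_true (pi / 2 ^+ n.+1 < `|x|)) n n1).
case=> m mx mmin; exists m; rewrite /annulus/= mx/=.
case: m mx mmin => [|m] mx mmin.
  by rewrite expr0 divr1 ler_norml x2 ltW.
by rewrite leNgt; apply/negP => /mmin; rewrite ltnn.
Qed.

Lemma ge0_integral_annulus f : measurable_fun setT f -> (forall x, 0 <= f x)%E ->
  (\int[mu]_x f x = \sum_(i <oo) \int[mu]_(x in annulus i) f x)%E.
Proof.
move=> mf f0.
have mA := measurable_annulus.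
have mU : measurable (\bigcup_i annulus i) by exact: bigcupT_measurable.
rewrite -ge0_integral_bigcup//; last 2 first.
  exact: measurable_funTS.
  exact: trivIset_annulus.
rewrite -[in LHS](setUv (\bigcup_i annulus i)) ge0_integral_setU//; last 3 first.
- exact: measurableC.
- by rewrite setUv.
- by rewrite disj_set2E setICr.
rewrite [X in (_ + X)%E](_ : _ = 0%E) ?adde0//.
apply: null_set_integral.
- exact: measurableC.
- exact: measurable_funTS.
- apply/eqP; rewrite -measure_le0 /circle_measure /= /mrestr.
  apply: (@le_trans _ _ (leb [set 0])); last by rewrite lebesgue_measure_set1.
  apply: le_measure; rewrite ?inE//.
    by apply: measurableI => //; exact: measurableC.
  move=> x [/= nx cx]; apply/eqP; apply: contrapT => /negP x0; apply: nx.
  by have [i ?] := annulus_cover x cx x0; exists i.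
Qed.

End circle.

(* Applied with s constant, this replaces Jensen's inequality throughout. *)
Lemma powR_threshold {R : realType} (p t s : R) : 1 < p -> 0 <= t -> 0 <= s ->
  t * s `^ (p - 1) <= t `^ p + s `^ p.
Proof.
move=> p1 t0 s0; have p0 : 0 < p by exact: lt_trans p1.
have q0 : 0 <= p - 1 by rewrite subr_ge0 ltW.
have [st|ts] := leP s t.
- rewrite -(mulr_powRB1 t0 p0) -[leLHS]addr0 lerD ?powR_ge0//.
  by rewrite ler_wpM2l// ge0_ler_powR.
- rewrite -(mulr_powRB1 s0 p0) -[leLHS]add0r lerD ?powR_ge0//.
  by rewrite ler_wpM2r ?powR_ge0// ltW.
Qed.

Lemma integral_powR_ge {d} {T : measurableType d} {R : realType}
    (nu : {measure set T -> \bar R}) (A : set T) (u : T -> R) (p m U : R) :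
  measurable A -> measurable_fun A u -> 1 < p -> 0 < m ->
  (nu A <= m%:E)%E -> (\int[nu]_(x in A) `|u x|%:E)%E = U%:E ->
  ((U `^ p)%:E <=
   (2 `^ p * m `^ (p - 1))%:E * \int[nu]_(x in A) (`|u x| `^ p)%:E)%E.
Proof.
move=> mA mu_ p1 m0 nuA UE; have p0 : 0 < p by exact: lt_trans p1.
have U0 : 0 <= U by rewrite -lee_fin -UE integral_ge0.
have c0 : 0 < 2 `^ p * m `^ (p - 1) by rewrite mulr_gt0 ?powR_gt0.
have mn : measurable_fun A (fun x => `|u x|).
  exact: (measurableT_comp (@normr_measurable R setT)).
have mnp : measurable_fun A (fun x => `|u x| `^ p).
  by apply: (measurableT_comp (measurable_powR p)).
(* Half of the mean of |u| over a set of measure m: the integrated threshold inequality then has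
   left side 2 s^p m, and half of it absorbs the term s^p m on the right. *)
pose s := U / (m *+ 2).
have m2 : 0 < m *+ 2 by rewrite mulrn_wgt0.
have s0 : 0 <= s by rewrite divr_ge0// ltW.
have sp : 0 <= s `^ (p - 1) by exact: powR_ge0.
have J0 : (0 <= \int[nu]_(x in A) (`|u x| `^ p)%:E)%E.
  by apply: integral_ge0 => x _; rewrite lee_fin powR_ge0.
have H : ((s `^ (p - 1) * U)%:E <=
    \int[nu]_(x in A) (`|u x| `^ p)%:E + (s `^ p * m)%:E)%E.
  rewrite EFinM -UE -ge0_integralZl_EFin//; last exact/measurable_EFinP.
  apply: (@le_trans _ _ (\int[nu]_(x in A) (`|u x| `^ p + s `^ p)%:E)%E).
    apply: ge0_le_integral => //.
    - by move=> x _; rewrite mule_ge0// lee_fin.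
    - by apply/measurable_EFinP; apply: measurable_funM.
    - by apply/measurable_EFinP; apply: measurable_funD.
    - by move=> x _; rewrite -EFinM lee_fin mulrC powR_threshold.
  under eq_integral => x _ do rewrite EFinD.
  rewrite ge0_integralD//; last 2 first.
  - exact/measurable_EFinP.
  - by move=> x _; rewrite lee_fin powR_ge0.
  rewrite leeD2l// integral_cst// EFinM lee_wpmul2l// lee_fin powR_ge0//.
case E : (\int[nu]_(x in A) (`|u x| `^ p)%:E)%E => [J||]; last by rewrite E in J0.
  2: by rewrite gt0_muley ?leey.
move: H J0; rewrite E -EFinD -EFinM !lee_fin => H J0.
have UE' : U = s * (m *+ 2) by rewrite /s divfK ?gt_eqF.
have E1 : s `^ (p - 1) * U = s `^ p * m *+ 2.
  by rewrite UE' -(mulr_powRB1 s0 p0); ring.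
have E2 : U `^ p = 2 `^ p * m `^ (p - 1) * (s `^ p * m).
  have E3 : (m *+ 2) `^ p = 2 `^ p * m `^ p.
    by rewrite -powRM ?(ltW m0)// mulr_natl.
  by rewrite UE' powRM ?(ltW m2)// E3 -(mulr_powRB1 (ltW m0) p0); ring.
rewrite E2 ler_pM2l//; move: H; rewrite E1; lra.
Qed.

(** * Integrals over annuli and the L^p norm *)

Section circle_norms.
Context {R : realType}.
Local Notation mu := (circle_measure R).
Local Notation leb := (@lebesgue_measure R).
Local Notation circ := (`]- (@pi R), @pi R]%classic).
Implicit Types (f : R -> \bar R) (u : R -> R).

(** The p-th power of the norm, which splits as a sum over annuli; roots are taken only at the very
    end. *)
Definition Lp_integral (p : R) u : \bar R := (\int[mu]_x (`|u x| `^ p)%:E)%E.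

Definition annulus_L1 u (i : nat) : R :=
  fine (\int[mu]_(x in annulus i) `|u x|%:E)%E.

Lemma annulus_L1_ge0 u i : 0 <= annulus_L1 u i.
Proof. by apply: fine_ge0; apply: integral_ge0. Qed.

Lemma measurable_normr_EFin u : measurable_fun setT u ->
  measurable_fun setT (fun x => `|u x|%:E).
Proof.
move=> mu_; apply/measurable_EFinP.
exact: (measurableT_comp (@normr_measurable R setT)).
Qed.

Lemma measurable_normr_powR u (p : R) : measurable_fun setT u ->
  measurable_fun setT (fun x => (`|u x| `^ p)%:E).
Proof.
move=> mu_; apply/measurable_EFinP; apply: (measurableT_comp (measurable_powR p)).
exact: (measurableT_comp (@normr_measurable R setT)).
Qed.

Lemma annulus_L1E u i : measurable_fun setT u ->
  (\int[mu]_x `|u x|%:E < +oo)%E ->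
  (\int[mu]_(x in annulus i) `|u x|%:E)%E = (annulus_L1 u i)%:E.
Proof.
move=> mu_ fu; rewrite fineK// ge0_fin_numE ?integral_ge0//.
apply: le_lt_trans fu; apply: ge0_subset_integral => //.
- exact: (measurable_annulus i).
- exact: (measurable_normr_EFin _ mu_).
Qed.

(** On annulus i the Jensen-type inequality costs the measure to the power p - 1, that is (2 pi /
    2^i)^(p - 1), and this cancels exactly the weight 2^(i (p - 1)) of the dyadic norm. *)
Lemma dyadic_norm_annulus_L1 (p : R) : 1 < p -> exists2 C : R, 0 < C &
  forall u, measurable_fun setT u -> (\int[mu]_x `|u x|%:E < +oo)%E ->
  (dyadic_norm p (annulus_L1 u) <= C%:E * Lp_integral p u)%E.
Proof.
move=> p1; have p0 : 0 < p by exact: lt_trans p1.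
have T0 : 0 < (pi : R) *+ 2 by rewrite mulrn_wgt0// pi_gt0.
exists (2 `^ p * (pi *+ 2) `^ (p - 1)); first by rewrite mulr_gt0 ?powR_gt0.
move=> u mu_ fu; rewrite /Lp_integral ge0_integral_annulus//; last exact: (measurable_normr_powR _ _ mu_).
rewrite -nneseriesZl; last first.
  by move=> i _; apply: integral_ge0 => x _; rewrite lee_fin powR_ge0.
apply: lee_nneseries => [i _ _|i _]; first by rewrite lee_fin powR_ge0.
have e0 : 0 < 2 ^+ i :> R by rewrite exprn_gt0.
have := @integral_powR_ge _ _ R mu (annulus i) u p (pi *+ 2 / 2 ^+ i) (annulus_L1 u i)
  (measurable_annulus i) (measurable_funTS mu_) p1.
rewrite divr_gt0// => /(_ isT (measure_annulus i) (annulus_L1E u i mu_ fu)) H.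
have k0 : 0 <= dyadic_ratio p ^+ i by rewrite exprn_ge0// ltW// (lt_trans _ (dyadic_ratio_gt1 p p1)).
rewrite powRM ?annulus_L1_ge0//.
apply: (@le_trans _ _ (((dyadic_ratio p ^+ i) `^ p)%:E * ((2 `^ p * (pi *+ 2 / 2 ^+ i) `^ (p - 1))%:E *
       \int[mu]_(x in annulus i) (`|u x| `^ p)%:E))%E).
  by rewrite EFinM; apply: lee_wpmul2l => //; rewrite lee_fin powR_ge0.
rewrite muleA -EFinM (dyadic_ratio_powR p p1).
have E : (2 ^+ i) `^ (p - 1) * (pi *+ 2 / 2 ^+ i) `^ (p - 1) =
    (pi *+ 2) `^ (p - 1) :> R.
  by rewrite -powRM ?(ltW e0) ?divr_ge0 ?(ltW T0) ?(ltW e0)// mulrC divfK ?gt_eqF.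
by rewrite mulrCA E.
Qed.

Lemma Rintegral_annulus_le (u P : R -> R) (k : nat -> R) :
  measurable_fun setT u -> (\int[mu]_x `|u x|%:E < +oo)%E ->
  measurable_fun setT P -> (forall i, 0 <= k i) ->
  (forall i x, annulus i x -> `|P x| <= k i) ->
  (`|\int[mu]_x (u x * P x)|%:E <=
   \sum_(i <oo) (k i * annulus_L1 u i)%:E)%E.
Proof.
move=> mu_ fu mP k0 Pk.
have muP : measurable_fun setT (fun x => u x * P x) by exact: measurable_funM.
have H : (\int[mu]_x `|u x * P x|%:E <= \sum_(i <oo) (k i * annulus_L1 u i)%:E)%E.
  rewrite ge0_integral_annulus//; last exact: (measurable_normr_EFin _ muP).
  apply: lee_nneseries => [i _ _|i _]; first exact: integral_ge0.
  rewrite EFinM -annulus_L1E// -ge0_integralZl_EFin//; last 2 first.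
  - exact: (measurable_annulus i).
  - by apply: measurable_funTS; exact: (measurable_normr_EFin _ mu_).
  apply: ge0_le_integral => //.
  - exact: (measurable_annulus i).
  - by apply: measurable_funTS; exact: (measurable_normr_EFin _ muP).
  - by apply: measurable_funeM; apply: measurable_funTS; exact: (measurable_normr_EFin _ mu_).
  - by move=> x Ax; rewrite -EFinM lee_fin normrM mulrC ler_wpM2r// Pk.
case E : (\int[mu]_x (u x * P x)%:E)%E => [r||].
- apply: le_trans H; rewrite /Rintegral E /=.
  have /measurable_EFinP muP' := muP.
  have := le_abse_integral mu measurableT muP'.
  by rewrite /= E.
(* For an infinite value of the integral the real-valued one is 0 by default, and the bound is
   trivial. *)
- by rewrite /Rintegral E /= normr0; apply: le_trans H; exact: integral_ge0.
- by rewrite /Rintegral E /= normr0; apply: le_trans H; exact: integral_ge0.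
Qed.

Lemma ae_circleS (P Q : R -> Prop) : (forall x, P x -> Q x) ->
  {ae mu, forall x, P x} -> {ae mu, forall x, Q x}.
Proof. by move=> PQ; apply: negligibleS; apply: subsetC. Qed.

(** Annulus i contributes at most (2^i y_i)^p times its measure 2 pi / 2^i, which is 2 pi times the
    i-th term of the dyadic norm: this is the source of its weight on the side of the upper
    bound. *)
Lemma Lp_integral_annulus_le (p : R) u (y : nat -> R) : 1 < p ->
  measurable_fun setT u -> (forall i, 0 <= y i) ->
  {ae mu, forall x, forall i, annulus i x -> `|u x| <= 2 ^+ i * y i} ->
  (Lp_integral p u <= (pi *+ 2)%:E * dyadic_norm p y)%E.
Proof.
move=> p1 mu_ y0 uy; have p0 : 0 < p by exact: lt_trans p1.
have T0 : 0 < (pi : R) *+ 2 by rewrite mulrn_wgt0// pi_gt0.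
rewrite /Lp_integral ge0_integral_annulus//; last exact: (measurable_normr_powR _ _ mu_).
rewrite -nneseriesZl; last by move=> i _; rewrite lee_fin powR_ge0.
apply: lee_nneseries => [i _ _|i _].
  by apply: integral_ge0 => x _; rewrite lee_fin powR_ge0.
have mA := @measurable_annulus R i.
have e0 : 0 < 2 ^+ i :> R by rewrite exprn_gt0.
apply: (@le_trans _ _ (\int[mu]_(x in annulus i) ((2 ^+ i * y i) `^ p)%:E)%E).
  apply: ae_ge0_le_integral => //.
  - by apply: measurable_funTS; exact: (measurable_normr_powR _ _ mu_).
  - by move=> x _; rewrite lee_fin powR_ge0.
  - move: uy; apply: ae_circleS => x ux Ax; have H := ux i Ax.
    by rewrite lee_fin ge0_ler_powR ?nnegrE ?(ltW p0)// mulr_ge0// ltW.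
rewrite integral_cst//.
apply: (@le_trans _ _ (((2 ^+ i * y i) `^ p)%:E * (pi *+ 2 / 2 ^+ i)%:E)%E).
  by apply: lee_wpmul2l; [rewrite lee_fin powR_ge0|exact: measure_annulus].
rewrite -!EFinM lee_fin.
have k0 : 0 <= dyadic_ratio p ^+ i by rewrite exprn_ge0// ltW// (lt_trans _ (dyadic_ratio_gt1 p p1)).
rewrite !powRM ?(ltW e0)// (dyadic_ratio_powR p p1) -(mulr_powRB1 (ltW e0) p0).
rewrite [leLHS](_ : _ = pi *+ 2 * ((2 ^+ i) `^ (p - 1) * y i `^ p))//.
by field; rewrite gt_eqF.
Qed.

End circle_norms.

(** * Elementary estimates for sines and trigonometric sums *)

Section trigonometry.
Context {R : realType}.
Implicit Types (x y h : R).

Lemma norm_sin_le y : `|sin y| <= `|y|.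
Proof.
wlog y0 : y / 0 <= y.
  move=> H; have [/H//|/ltW y0] := leP 0 y.
  by rewrite -normrN -sinN -(normrN y) H// oppr_ge0.
have [c _] : exists2 c, c \in `[0, y]%R & sin y - sin 0 = cos c * (y - 0).
  apply: MVT_segment => //.
  by apply: continuous_subspaceT => z; exact: continuous_sin.
rewrite sin0 !subr0 => ->; rewrite normrM.
by rewrite -[leRHS]mul1r ler_wpM2r// cos_max.
Qed.

(** On [0, 1] the cosine is at least 1/2, hence sin z >= z/2; doubling the angle gives y/4 on
    [0, 2]. That range contains x/2 for 0 <= x <= pi and nh/2 for 0 <= nh <= 4, the two uses
    below. *)
Lemma sin_ge_quarter y : 0 <= y <= 2 -> y / 4 <= sin y.
Proof.
have half (z : R) : 0 <= z <= 1 -> 1 / 2 <= cos z.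
  move=> /andP[z0 z1]; rewrite [z](_ : _ = (z / 2) *+ 2); last first.
    by rewrite -mulr_natr divfK.
  rewrite cos_mulr2n cos2sin2.
  have z2 : 0 <= z / 2 by lra.
  have := norm_sin_le (z / 2); rewrite (ger0_norm z2) => H.
  have : `|sin (z / 2)| ^+ 2 <= (1 / 2) ^+ 2.
    by rewrite lerXn2r ?nnegrE// (le_trans H)// ler_pM2r.
  rewrite real_normK ?num_real// => ?; lra.
have small (z : R) : 0 <= z <= 1 -> z / 2 <= sin z.
  move=> /andP[z0 z1].
  have [c /andP[]] : exists2 c, c \in `[0, z]%R & sin z - sin 0 = cos c * (z - 0).
    apply: MVT_segment => //.
    by apply: continuous_subspaceT => w; exact: continuous_sin.
  rewrite !bnd_simp sin0 !subr0 => c0 cz ->.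
  have := half c; rewrite c0 (le_trans cz z1) => /(_ isT) ?.
  rewrite mulrC ler_wpM2r//; lra.
move=> /andP[y0 y2].
have h0 : 0 <= y / 2 <= 1 by apply/andP; split; lra.
rewrite [in leRHS](_ : y = (y / 2) *+ 2); last by rewrite -mulr_natr divfK.
rewrite sin_mulr2n.
have := half _ h0; have := small _ h0; nra.
Qed.

(** By the previous bound |sin(x/2)| >= |x|/8, and on the annulus 2^i |x| > pi/2 >= 1. *)
Lemma sin_half_annulus x i : annulus i x -> 1 <= 8 * 2 ^+ i * `|sin (x / 2)|.
Proof.
wlog x0 : x / 0 <= x.
  move=> H; have [/H//|/ltW x0] := leP 0 x => Ax.
  by rewrite -normrN -sinN -mulNr H ?oppr_ge0// /annulus/= normrN.
move=> /= /andP[]; rewrite ger0_norm// => x1 x2.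
have e1 : 1 <= 2 ^+ i :> R by rewrite exprn_ege1// ler1n.
have e0 : 0 < 2 ^+ i :> R by rewrite exprn_gt0.
have pi4 : pi < 4 :> R by have := @pihalf_lt2 R; lra.
have pi2 := @pi_ge2 R.
have x4 : x <= 4.
  by apply: (le_trans x2); rewrite ler_pdivrMr//; nra.
have := @sin_ge_quarter (x / 2).
have -> : 0 <= x / 2 <= 2 by apply/andP; split; lra.
move=> /(_ isT) H; rewrite ger0_norm; last by apply: le_trans H; lra.
move: x1; rewrite exprS ltr_pdivrMr; last by lra.
move: H; set s := sin _; set e := 2 ^+ i in e1 e0 *.
nra.
Qed.

(** The free phase [th] lets one telescoping identity serve cosines, sines (phase -pi/2) and nested
    sums. *)
Lemma sin_half_sum_cos (th x : R) (a b : nat) : (a <= b)%N ->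
  2 * sin (x / 2) * \sum_(a <= k < b) cos (th + k%:R * x) =
  sin (th + b%:R * x - x / 2) - sin (th + a%:R * x - x / 2).
Proof.
move=> ab; rewrite mulr_sumr.
pose f k := sin (th + k%:R * x - x / 2).
rewrite -[RHS](@telescope_sumr _ a b f)//.
apply: eq_bigr => k _; rewrite /f.
have -> : th + k.+1%:R * x - x / 2 = (th + k%:R * x) + x / 2.
  by rewrite -natr1; field.
by rewrite sinD sinB; ring.
Qed.

Lemma sin_half_sum_cos_le (th x : R) (a b : nat) :
  `|sin (x / 2)| * `|\sum_(a <= k < b) cos (th + k%:R * x)| <= 1.
Proof.
have [ab|ba] := leqP a b; last by rewrite big_geq ?normr0 ?mulr0// ltnW.
rewrite -normrM.
have := sin_half_sum_cos th x a b ab; set S := \sum_(_ <= _ < _) _ => E.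
have -> : sin (x / 2) * S =
    (sin (th + b%:R * x - x / 2) - sin (th + a%:R * x - x / 2)) / 2.
  by rewrite -E; field.
rewrite normrM (ger0_norm (_ : 0 <= 2^-1))// ler_pdivrMr// mul1r.
by rewrite (le_trans (ler_normB _ _))// -[leRHS]/(1 + 1) lerD ?sin_max.
Qed.

(** Multiplying by 2 sin(x/2) collapses each inner sum to two sines, that is, to cosines with phase
    moved by -pi/2; the outer sums are then again of the single type and absorb the second factor
    sin(x/2). *)
Lemma sin_half_sum2_cos_le (th x : R) (m1 m2 : nat) :
  sin (x / 2) ^+ 2 *
  `|\sum_(0 <= k' < m2) \sum_(0 <= k < m1) cos (th + (k + k')%:R * x)| <= 1.
Proof.
set D := \sum_(_ <= _ < _) _.
have E : 2 * sin (x / 2) * D =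
  \sum_(0 <= k' < m2) cos ((th + m1%:R * x - x / 2 - pi / 2) + k'%:R * x) -
  \sum_(0 <= k' < m2) cos ((th - x / 2 - pi / 2) + k'%:R * x).
  rewrite -sumrB /D mulr_sumr; apply: eq_bigr => k' _.
  have Ek k : th + (k + k')%:R * x = th + k'%:R * x + k%:R * x.
    by rewrite natrD; ring.
  under eq_bigr => k _ do rewrite Ek.
  rewrite sin_half_sum_cos//.
  by rewrite -!cosBpihalf; congr (cos _ - cos _); ring.
have -> : sin (x / 2) ^+ 2 * `|D| = `|sin (x / 2) * (2 * sin (x / 2) * D)| / 2.
  by rewrite !normrM (ger0_norm (ler0n _ 2)) -[in LHS]real_normK ?num_real//; field.
rewrite ler_pdivrMr// mul1r E normrM.
apply: le_trans (ler_wpM2l _ (ler_normB _ _)) _ => //.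
by rewrite mulrDr -[leRHS]/(1 + 1) lerD ?sin_half_sum_cos_le.
Qed.

Lemma abel_sum_le (g c : nat -> R) (B : R) (a b : nat) : (a <= b)%N ->
  (forall k, `|\sum_(a <= i < k) c i| <= B) ->
  `|\sum_(a <= k < b) g k * c k| <=
  B * (`|g b| + \sum_(a <= k < b) `|g k - g k.+1|).
Proof.
move=> ab cB.
pose S k := \sum_(a <= i < k) c i.
have E n : \sum_(a <= k < a + n) g k * c k = g (a + n)%N * S (a + n)%N +
    \sum_(a <= k < a + n) (g k - g k.+1) * S k.+1.
  elim: n => [|n IH]; first by rewrite addn0 /S !big_geq// mulr0 addr0.
  have SS : S (a + n).+1 = S (a + n)%N + c (a + n)%N.
    by rewrite /S big_nat_recr ?leq_addr.
  by rewrite addnS !big_nat_recr ?leq_addr//= IH SS; ring.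
rewrite -(subnKC ab) E (le_trans (ler_normD _ _))// mulrDr lerD//.
  by rewrite normrM mulrC ler_wpM2r// cB.
rewrite (le_trans (ler_norm_sum _ _ _))// mulr_sumr ler_sum// => k _.
by rewrite normrM mulrC ler_wpM2r// cB.
Qed.

End trigonometry.

(** * Functions of class L^p and their differences *)

Section circle_functions.
Context {R : realType}.
Local Notation mu := (circle_measure R).
Implicit Types (u v g : R -> R) (p h : R).

Definition circle_Lp p u :=
  [/\ measurable_fun setT u, periodic u (pi *+ 2) & (Lp_integral p u < +oo)%E].

Lemma circle_measure_setT : (mu setT = (pi *+ 2)%:E)%E.
Proof.
rewrite /circle_measure /= /mrestr setTI lebesgue_measure_itv/= lte_fin.
by rewrite gt0_cp ?pi_gt0// -EFinD opprK mulr2n.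
Qed.

Lemma circle_Lp_L1 p u : 1 < p -> circle_Lp p u ->
  (\int[mu]_x `|u x|%:E < +oo)%E.
Proof.
move=> p1 [mu_ _ fu].
have mup := measurable_normr_powR u p mu_.
apply: (@le_lt_trans _ _ (\int[mu]_x (1 + (`|u x| `^ p)%:E))%E).
  apply: ge0_le_integral => //.
  - exact: (measurable_normr_EFin _ mu_).
  - by apply: emeasurable_funD.
  - move=> x _; rewrite -EFinD lee_fin.
    have := powR_threshold p `|u x| 1 p1 (normr_ge0 _) ler01.
    by rewrite !powR1 mulr1 addrC.
rewrite ge0_integralD//.
rewrite integral_cst// mul1e circle_measure_setT.
by rewrite lte_add_pinfty// ltry.
Qed.

Lemma Lp_integral_shift p u h : measurable_fun setT u ->
  periodic u (pi *+ 2) -> Lp_integral p (fun x => u (x + h)) = Lp_integral p u.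
Proof.
move=> mu_ pu.
apply: (circle_integral_shift (fun x => (`|u x| `^ p)%:E) h).
  exact: measurable_normr_powR.
by move=> x; rewrite pu.
Qed.

Lemma powRB_le p (a b : R) : 0 <= p ->
  `|a - b| `^ p <= 2 `^ p * (`|a| `^ p + `|b| `^ p).
Proof.
move=> p0.
apply: (@le_trans _ _ ((2 * Num.max `|a| `|b|) `^ p)).
  apply: ge0_ler_powR; rewrite ?nnegrE ?mulr_ge0 ?le_max ?normr_ge0//.
  rewrite (le_trans (ler_normB _ _))// mulr_natl mulr2n lerD// le_max lexx ?orbT//.
rewrite powRM ?le_max ?normr_ge0// ler_wpM2l ?powR_ge0//.
by case: (leP `|a| `|b|) => _; rewrite ?lerDl ?lerDr powR_ge0.
Qed.

Lemma Lp_integralB_le p u v : 0 <= p -> measurable_fun setT u ->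
  measurable_fun setT v ->
  (Lp_integral p (fun x => (u x - v x)%R) <=
   (2 `^ p)%:E * (Lp_integral p u + Lp_integral p v))%E.
Proof.
move=> p0 mu_ mv; rewrite /Lp_integral.
have mup := measurable_normr_powR u p mu_.
have mvp := measurable_normr_powR v p mv.
rewrite -ge0_integralD//.
rewrite -ge0_integralZl_EFin ?powR_ge0//; last by apply: emeasurable_funD.
apply: ge0_le_integral => //.
- by apply: measurable_normr_powR; apply: measurable_funB.
- by apply: measurable_funeM; apply: emeasurable_funD.
- by move=> x _; rewrite -EFinD -EFinM lee_fin powRB_le.
- by move=> x _; rewrite adde_ge0 ?lee_fin ?powR_ge0.
Qed.

(** A translate of the forward difference, hence with the same L^p norm by periodicity. Centring
    makes its Fourier multiplier the real number 2 sin(nh/2), up to a quarter turn that does not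
    depend on h and n. *)
Definition central_diff h u : R -> R := fun x => u (x + h / 2) - u (x - h / 2).

Lemma circle_Lp_shift p u h : circle_Lp p u -> circle_Lp p (fun x => u (x + h)).
Proof.
move=> [mu_ pu fu]; split.
- exact: (measurableT_comp mu_ (measurable_shift h)).
- by move=> x; rewrite addrAC pu.
- by rewrite Lp_integral_shift.
Qed.

Lemma Lp_integral_central_diff p h u : 0 <= p -> circle_Lp p u ->
  (Lp_integral p (central_diff h u) <= (2 `^ p * 2)%:E * Lp_integral p u)%E.
Proof.
move=> p0 up; have [mu_ pu fu] := up.
have [m1 _ _] := circle_Lp_shift p u (h / 2) up.
have [m2 _ _] := circle_Lp_shift p u (- (h / 2)) up.
apply: (le_trans (Lp_integralB_le _ _ _ p0 m1 m2)).
rewrite !Lp_integral_shift// EFinM -muleA lee_wpmul2l ?lee_fin ?powR_ge0//.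
by rewrite mule_natl mule2n.
Qed.

Lemma circle_Lp_central_diff p h u : 0 <= p -> circle_Lp p u ->
  circle_Lp p (central_diff h u).
Proof.
move=> p0 up; have [mu_ pu fu] := up.
have [m1 _ _] := circle_Lp_shift p u (h / 2) up.
have [m2 _ _] := circle_Lp_shift p u (- (h / 2)) up.
split; first exact: measurable_funB.
  by move=> x; rewrite /central_diff (addrAC x _ (h / 2)) (addrAC x _ (- (h / 2))) !pu.
apply: (le_lt_trans (Lp_integral_central_diff _ _ _ p0 up)).
by rewrite lte_mul_pinfty// lee_fin mulr_ge0// powR_ge0.
Qed.

Lemma circle_Lp_iter_central_diff p h l u : 0 <= p -> circle_Lp p u ->
  circle_Lp p (iter l (central_diff h) u).
Proof.
move=> p0 up; elim: l => [//|l IH]; rewrite iterS.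
exact: (circle_Lp_central_diff p h _ p0 IH).
Qed.

Lemma Lp_integral_iter_central_diff p h l u : 0 <= p -> circle_Lp p u ->
  (Lp_integral p (iter l (central_diff h) u) <=
   ((2 `^ p * 2) ^+ l)%:E * Lp_integral p u)%E.
Proof.
move=> p0 up; elim: l => [|l IH]; first by rewrite expr0 mul1e.
have upl := circle_Lp_iter_central_diff _ h l _ p0 up.
apply: (le_trans (Lp_integral_central_diff _ _ _ p0 upl)).
by rewrite exprS [in leRHS]EFinM -muleA lee_wpmul2l// lee_fin mulr_ge0// powR_ge0.
Qed.

Lemma iter_fwd_diff h l u x :
  iter l (fwd_diff h) u x = iter l (central_diff h) u (x + l%:R * (h / 2)).
Proof.
elim: l x => [|l IH] x; first by rewrite mul0r addr0.
rewrite !iterS [LHS]/fwd_diff [RHS]/central_diff !IH.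
have -> : l.+1%:R = l%:R + 1 :> R by rewrite natr1.
have -> : x + h + l%:R * (h / 2) = x + (l%:R + 1) * (h / 2) + h / 2 by field.
by have -> : x + l%:R * (h / 2) = x + (l%:R + 1) * (h / 2) - h / 2 by field.
Qed.

Lemma Lp_integral_iter_fwd_diff p h l u : 0 <= p -> circle_Lp p u ->
  Lp_integral p (iter l (fwd_diff h) u) = Lp_integral p (iter l (central_diff h) u).
Proof.
move=> p0 up; have [m1 m2 _] := circle_Lp_iter_central_diff p h l u p0 up.
rewrite -(Lp_integral_shift _ _ (l%:R * (h / 2)) m1 m2).
by congr Lp_integral; apply/funext => x; rewrite iter_fwd_diff.
Qed.

Definition bounded_measurable g :=
  measurable_fun setT g /\ exists M, forall x, `|g x| <= M.

Lemma integrableM_bounded u g : measurable_fun setT u ->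
  (\int[mu]_x `|u x|%:E < +oo)%E -> bounded_measurable g ->
  mu.-integrable setT (EFin \o (fun x => u x * g x)).
Proof.
move=> mu_ fu [mg [M gM]].
have M0 : 0 <= M by exact: le_trans (normr_ge0 _) (gM 0).
have mug : measurable_fun setT (fun x => u x * g x) by exact: measurable_funM.
apply/integrableP; split; first exact/measurable_EFinP.
apply: (@le_lt_trans _ _ (\int[mu]_x (M%:E * `|u x|%:E))%E).
  apply: ge0_le_integral => //.
  - exact: (measurable_normr_EFin _ mug).
  - by apply: measurable_funeM; exact: (measurable_normr_EFin _ mu_).
  - by move=> x _; rewrite /= lee_fin normrM mulrC ler_wpM2r.
rewrite ge0_integralZl_EFin//; last exact: (measurable_normr_EFin _ mu_).
by rewrite lte_mul_pinfty// lee_fin.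
Qed.

Lemma bounded_measurable_sum (m : nat) (g : nat -> R -> R) :
  (forall k, bounded_measurable (g k)) ->
  bounded_measurable (fun x => \sum_(0 <= k < m) g k x).
Proof.
move=> gb; elim: m => [|m [m1 [M HM]]].
  split; last by exists 0 => x; rewrite big_geq// normr0.
  by under eq_fun do rewrite big_geq//; exact: measurable_cst.
have [m2 [M2 HM2]] := gb m.
split; last first.
  exists (M + M2) => x; rewrite big_nat_recr//=.
  by rewrite (le_trans (ler_normD _ _))// lerD.
by under eq_fun do rewrite big_nat_recr//=; exact: measurable_funD.
Qed.

Lemma circle_RintegralM_sum u (m : nat) (g : nat -> R -> R) :
  measurable_fun setT u -> (\int[mu]_x `|u x|%:E < +oo)%E ->
  (forall k, bounded_measurable (g k)) ->
  \int[mu]_x (u x * \sum_(0 <= k < m) g k x) =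
  \sum_(0 <= k < m) \int[mu]_x (u x * g k x).
Proof.
move=> mu_ fu gb; elim: m => [|m IH].
  rewrite big_geq//; under eq_Rintegral do rewrite big_geq// mulr0.
  by rewrite Rintegral_cst// mul0r.
rewrite big_nat_recr//= -IH -RintegralD//; last 2 first.
- by apply: integrableM_bounded => //; exact: bounded_measurable_sum.
- exact: integrableM_bounded.
by apply: eq_Rintegral => x _; rewrite big_nat_recr//= mulrDr.
Qed.

Lemma circle_RintegralM_shift u g h : measurable_fun setT u ->
  measurable_fun setT g -> periodic u (pi *+ 2) -> periodic g (pi *+ 2) ->
  \int[mu]_x (u (x + h) * g x) = \int[mu]_x (u x * g (x - h)).
Proof.
move=> mu_ mg pu pg.
rewrite -[RHS](circle_Rintegral_shift (fun x => u x * g (x - h)) h).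
- by apply: eq_Rintegral => x _; rewrite addrK.
- apply: measurable_funM => //.
  exact: (measurableT_comp mg (measurable_shift (- h))).
- by move=> x; rewrite pu addrAC pg.
Qed.

End circle_functions.

(** * Fourier coefficients of differences, and test polynomials *)

Section fourier_coefficients.
Context {R : realType}.
Local Notation mu := (circle_measure R).
Implicit Types (u v g : R -> R) (p h : R).

Definition fourier_cos u (n : nat) : R := \int[mu]_x (u x * cos (n%:R * x)).
Definition fourier_sin u (n : nat) : R := \int[mu]_x (u x * sin (n%:R * x)).

Lemma measurable_cos_affine (a b : R) :
  measurable_fun setT (fun x : R => cos (a + b * x)).
Proof.
apply: continuous_measurable_fun => x; apply: continuous_comp; last exact: continuous_cos.
by apply: cvgD; [exact: cvg_cst|apply: cvgM; [exact: cvg_cst|exact: cvg_id]].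
Qed.

Lemma bounded_measurable_cos (a b : R) :
  bounded_measurable (fun x : R => cos (a + b * x)).
Proof. by split; [exact: measurable_cos_affine|exists 1 => x; exact: cos_max]. Qed.

Lemma periodic_cos_affine (a : R) (n : nat) :
  periodic (fun x : R => cos (a + n%:R * x)) (pi *+ 2).
Proof.
move=> x; rewrite mulrDr addrA [n%:R * (pi *+ 2)]mulr_natl.
exact: (periodicn (@cosD2pi R)).
Qed.

Lemma fourier_cosE u n : fourier_cos u n = \int[mu]_x (u x * cos (0 + n%:R * x)).
Proof. by apply: eq_Rintegral => x _; rewrite add0r. Qed.

Lemma fourier_sinE u n :
  fourier_sin u n = \int[mu]_x (u x * cos (- (pi / 2) + n%:R * x)).
Proof. by apply: eq_Rintegral => x _; rewrite addrC cosBpihalf. Qed.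

(** Translation invariance moves both shifts from u to the cosine, where cos(A - B) - cos(A + B) = 2
    sin A sin B with B = nh/2, and sin A is the cosine with phase lowered by pi/2. *)
Lemma circle_Rintegral_cos_diff p u h (a : R) (n : nat) : 1 < p -> circle_Lp p u ->
  \int[mu]_x (central_diff h u x * cos (a + n%:R * x)) =
  2 * sin (n%:R * h / 2) * \int[mu]_x (u x * cos (a - pi / 2 + n%:R * x)).
Proof.
move=> p1 up; have [mu_ pu _] := up; have fu := circle_Lp_L1 _ _ p1 up.
have p0 : 0 <= p by rewrite ltW// (lt_trans _ p1).
have um := circle_Lp_shift p u (- (h / 2)) up.
have uq := circle_Lp_shift p u (h / 2) up.
have [mm pm _] := um; have [mq pq _] := uq.
have fm := circle_Lp_L1 _ _ p1 um; have fq := circle_Lp_L1 _ _ p1 uq.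
have bc := bounded_measurable_cos a n%:R.
have mc := measurable_cos_affine a n%:R.
have pc := periodic_cos_affine a n.
transitivity (\int[mu]_x (u (x + h / 2) * cos (a + n%:R * x)) -
              \int[mu]_x (u (x - h / 2) * cos (a + n%:R * x))).
  rewrite -RintegralB//; last 2 first.
  - exact: (integrableM_bounded _ _ mq fq bc).
  - exact: (integrableM_bounded _ _ mm fm bc).
  by apply: eq_Rintegral => x _; rewrite /central_diff mulrBl.
rewrite (circle_RintegralM_shift u _ (h / 2) mu_ mc pu pc).
rewrite (circle_RintegralM_shift u _ (- (h / 2)) mu_ mc pu pc).
rewrite -RintegralB//; last 2 first.
- have := integrableM_bounded _ _ mu_ fu (bounded_measurable_cos (a - n%:R * (h / 2)) n%:R).
  by apply: eq_integrable => // x _ /=; congr (_ * cos _)%:E; ring.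
- have := integrableM_bounded _ _ mu_ fu (bounded_measurable_cos (a + n%:R * (h / 2)) n%:R).
  by apply: eq_integrable => // x _ /=; rewrite opprK; congr (_ * cos _)%:E; ring.
rewrite -RintegralZl//; last first.
  exact: (integrableM_bounded _ _ mu_ fu (bounded_measurable_cos (a - pi / 2) n%:R)).
apply: eq_Rintegral => x _.
have -> : a - pi / 2 + n%:R * x = (a + n%:R * x) - pi / 2 by ring.
have -> : a + n%:R * (x - h / 2) = (a + n%:R * x) - n%:R * h / 2 by field.
have -> : a + n%:R * (x - - (h / 2)) = (a + n%:R * x) + n%:R * h / 2 by field.
by rewrite cosBpihalf; set A := a + n%:R * x; rewrite cosB cosD; ring.
Qed.

Lemma fourier_cos_central_diff p u h n : 1 < p -> circle_Lp p u ->
  fourier_cos (central_diff h u) n = 2 * sin (n%:R * h / 2) * fourier_sin u n.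
Proof.
move=> p1 up; rewrite fourier_cosE (circle_Rintegral_cos_diff p)//.
by rewrite fourier_sinE add0r.
Qed.

Lemma fourier_sin_central_diff p u h n : 1 < p -> circle_Lp p u ->
  fourier_sin (central_diff h u) n = - (2 * sin (n%:R * h / 2) * fourier_cos u n).
Proof.
move=> p1 up; have [mu_ pu _] := up; have fu := circle_Lp_L1 _ _ p1 up.
rewrite fourier_sinE (circle_Rintegral_cos_diff p)// -[RHS]mulrN; congr (_ * _).
rewrite /fourier_cos -[RHS]mulN1r -RintegralZl//; last first.
  have := integrableM_bounded _ _ mu_ fu (bounded_measurable_cos 0 n%:R).
  by apply: eq_integrable => // x _ /=; rewrite add0r.
apply: eq_Rintegral => x _.
rewrite (_ : - (pi / 2) - pi / 2 + n%:R * x = n%:R * x - pi / 2 - pi / 2); last by ring.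
by rewrite cosBpihalf sinBpihalf mulN1r mulrN.
Qed.

(* Each central difference rotates the pair (cosine, sine) of coefficients by a
   quarter turn, so a fixed choice of signs recovers their sum. *)
Lemma fourier_iter_central_diff (l : nat) : exists s t : R,
  [/\ `|s| <= 1, `|t| <= 1 & forall p u h n, 1 < p -> circle_Lp p u ->
  (2 * sin (n%:R * h / 2)) ^+ l * (fourier_cos u n + fourier_sin u n) =
  s * fourier_cos (iter l (central_diff h) u) n +
  t * fourier_sin (iter l (central_diff h) u) n].
Proof.
elim: l => [|l [s [t [s1 t1 IH]]]].
  exists 1, 1; split; rewrite ?normr1// => p u h n _ _.
  by rewrite expr0 !mul1r.
exists t, (- s); split; rewrite ?normrN// => p u h n p1 up.
have p0 : 0 <= p by rewrite ltW// (lt_trans _ p1).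
have upl := circle_Lp_iter_central_diff _ h l _ p0 up.
rewrite exprS -mulrA (IH p)//= (fourier_cos_central_diff p)//.
by rewrite (fourier_sin_central_diff p)//; ring.
Qed.

(* The double sum has about [4 ^ j] terms, and summing each geometric progression
   gains a factor [1 / sin (x / 2)]; the two bounds cross at [i = j]. *)
Lemma double_sum_cos_kernel (a x : R) (q m1 m2 i j : nat) :
  (m1 <= 2 * 2 ^ j)%N -> (m2 <= 2 ^ j)%N -> annulus i x ->
  `|\sum_(0 <= k' < m2) \sum_(0 <= k < m1) cos (a + (q + (k + k'))%:R * x)| <=
  64 * 4 ^+ j * dyadic_kernel i j.
Proof.
move=> m1j m2j Ax.
have E4 k : 4 ^+ k = 2 ^+ k * 2 ^+ k :> R by rewrite -exprMn -natrM.
have e0 k : 0 < 2 ^+ k :> R by rewrite exprn_gt0.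
set D := \sum_(0 <= k' < m2) _.
have D1 : `|D| <= 2 * 4 ^+ j.
  apply: (@le_trans _ _ (\sum_(0 <= k' < m2) \sum_(0 <= k < m1) (1 : R))).
    rewrite (le_trans (ler_norm_sum _ _ _))// ler_sum// => k' _.
    by rewrite (le_trans (ler_norm_sum _ _ _))// ler_sum// => k _; exact: cos_max.
  rewrite !big_const_nat !subn0 !iter_addr_0 -mulrnA.
  rewrite [leRHS](_ : _ = (2 * 2 ^ j * 2 ^ j)%:R); last by rewrite E4 !natrM !natrX mulrA.
  by rewrite ler_nat leq_mul.
have D2 : `|D| <= 64 * 4 ^+ i.
  have := sin_half_sum2_cos_le (a + q%:R * x) x m1 m2.
  have -> : \sum_(0 <= k' < m2) \sum_(0 <= k < m1)
      cos (a + q%:R * x + (k + k')%:R * x) = D.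
    apply: eq_bigr => k' _; apply: eq_bigr => k _; congr cos.
    by rewrite [in RHS]natrD; ring.
  have := sin_half_annulus x i Ax.
  rewrite -[sin (x / 2) ^+ 2]real_normK ?num_real//.
  have := normr_ge0 D; have := normr_ge0 (sin (x / 2)).
  set s := `|sin _|; set d := `|D| => s0 d0 H1 H2.
  have H3 : 1 <= 64 * 4 ^+ i * s ^+ 2.
    rewrite E4 (_ : _ * s ^+ 2 = (8 * 2 ^+ i * s) * (8 * 2 ^+ i * s)); last by ring.
    by rewrite -[leLHS]mulr1 ler_pM// ler01.
  have i0 : 0 < 64 * 4 ^+ i :> R by rewrite mulr_gt0// exprn_gt0.
  apply: (@le_trans _ _ (64 * 4 ^+ i * (s ^+ 2 * d))).
    by rewrite mulrA ler_peMl.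
  by rewrite ler_piMr// ltW.
rewrite /dyadic_kernel; case: (leP 1 (2 ^+ i / 2 ^+ j)) => _.
  rewrite mulr1 (le_trans D1)// ler_wpM2r ?exprn_ge0//; lra.
have [ij|ij] := leqP i j; last first.
  apply: (le_trans D1); rewrite E4.
  have : 1 <= 2 ^+ i / 2 ^+ j :> R.
    by rewrite ler_pdivlMr// mul1r ler_eXn2l ?ltr1n// ltnW.
  have := mulr_gt0 (e0 j) (e0 j); nra.
apply: (le_trans D2); rewrite !E4.
rewrite [leRHS](_ : _ = 64 * (2 ^+ i * 2 ^+ j)); last by field; rewrite gt_eqF.
by rewrite ler_pM2l// ler_pM2l// ler_eXn2l ?ltr1n.
Qed.

Lemma double_sum_fourier_le p u (a : R) (q m1 m2 j : nat) :
  1 < p -> circle_Lp p u -> (m1 <= 2 * 2 ^ j)%N -> (m2 <= 2 ^ j)%N ->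
  (`|\sum_(0 <= k' < m2) \sum_(0 <= k < m1)
      \int[mu]_x (u x * cos (a + (q + (k + k'))%:R * x))|%:E <=
   (64 * 4 ^+ j)%:E * \sum_(i <oo) (dyadic_kernel i j * annulus_L1 u i)%:E)%E.
Proof.
move=> p1 up m1j m2j; have [mu_ pu _] := up; have fu := circle_Lp_L1 _ _ p1 up.
pose g k' k x := cos (a + (q + (k + k'))%:R * x).
have bg k' k : bounded_measurable (g k' k) by exact: bounded_measurable_cos.
have bs k' : bounded_measurable (fun x => \sum_(0 <= k < m1) g k' k x).
  exact: bounded_measurable_sum.
have -> : \sum_(0 <= k' < m2) \sum_(0 <= k < m1)
      \int[mu]_x (u x * cos (a + (q + (k + k'))%:R * x)) =
    \int[mu]_x (u x * \sum_(0 <= k' < m2) \sum_(0 <= k < m1) g k' k x).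
  rewrite circle_RintegralM_sum//; apply: eq_bigr => k' _.
  by rewrite circle_RintegralM_sum.
have [mD _] := bounded_measurable_sum m2 _ bs.
have c0 : 0 <= 64 * 4 ^+ j :> R by rewrite mulr_ge0// exprn_ge0.
have k0 i : 0 <= dyadic_kernel i j :> R by exact: dyadic_kernel_ge0.
rewrite -nneseriesZl; last by move=> i _; rewrite lee_fin mulr_ge0 ?annulus_L1_ge0.
under eq_eseriesr do rewrite -EFinM mulrA.
apply: (Rintegral_annulus_le _ _ _ mu_ fu mD); first by move=> i; rewrite mulr_ge0.
by move=> i x Ax; exact: double_sum_cos_kernel.
Qed.

Lemma fourier_block_le p u (s t : R) (q m1 m2 j : nat) :
  1 < p -> circle_Lp p u -> `|s| <= 1 -> `|t| <= 1 ->
  (m1 <= 2 * 2 ^ j)%N -> (m2 <= 2 ^ j)%N ->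
  (`|\sum_(0 <= k' < m2) \sum_(0 <= k < m1)
      (s * fourier_cos u (q + (k + k')) + t * fourier_sin u (q + (k + k')))|%:E <=
   (128 * 4 ^+ j)%:E * \sum_(i <oo) (dyadic_kernel i j * annulus_L1 u i)%:E)%E.
Proof.
move=> p1 up s1 t1 m1j m2j.
set B := (\sum_(i <oo) _)%E.
have B0 : (0 <= B)%E.
  by apply: nneseries_ge0 => i _ _; rewrite lee_fin mulr_ge0 ?dyadic_kernel_ge0 ?annulus_L1_ge0.
have c0 : 0 <= 64 * 4 ^+ j :> R by rewrite mulr_ge0// exprn_ge0.
pose F := \sum_(0 <= k' < m2) \sum_(0 <= k < m1) fourier_cos u (q + (k + k')).
pose G := \sum_(0 <= k' < m2) \sum_(0 <= k < m1) fourier_sin u (q + (k + k')).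
have -> : \sum_(0 <= k' < m2) \sum_(0 <= k < m1)
      (s * fourier_cos u (q + (k + k')) + t * fourier_sin u (q + (k + k'))) = s * F + t * G.
  rewrite /F /G !mulr_sumr -big_split; apply: eq_bigr => k' _.
  by rewrite !mulr_sumr -big_split.
have HF := double_sum_fourier_le p u 0 q m1 m2 j p1 up m1j m2j.
have HG := double_sum_fourier_le p u (- (pi / 2)) q m1 m2 j p1 up m1j m2j.
apply: (@le_trans _ _ (`|F|%:E + `|G|%:E)%E).
  rewrite -EFinD lee_fin (le_trans (ler_normD _ _))// !normrM.
  by rewrite lerD// ler_piMl.
rewrite (_ : 128 * 4 ^+ j = 64 * 4 ^+ j + 64 * 4 ^+ j); last by ring.
rewrite EFinD ge0_muleDl ?lee_fin//; apply: leeD.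
  apply: le_trans HF; rewrite lee_fin le_eqVlt; apply/orP; left; apply/eqP; congr (`|_|).
  by apply: eq_bigr => k' _; apply: eq_bigr => k _; rewrite fourier_cosE.
apply: le_trans HG; rewrite lee_fin le_eqVlt; apply/orP; left; apply/eqP; congr (`|_|).
by apply: eq_bigr => k' _; apply: eq_bigr => k _; rewrite fourier_sinE.
Qed.

End fourier_coefficients.

(** * Pointwise convergence of Fourier series *)

Section fejer_lebesgue.
Context {R : realType}.
Local Notation mu := (circle_measure R).
Local Notation leb := (@lebesgue_measure R).
Local Notation circ := (`]- (@pi R), @pi R]%classic).
Implicit Types (u v g : R -> R) (p h : R).

(* The usual Fejer kernel is this sum divided by [m]. *)
Definition fejer_kernel (m : nat) (y : R) : R :=
  \sum_(0 <= n < m) (1 + 2 * \sum_(1 <= k < n.+1) cos (k%:R * y)).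

(** The right-hand side is 64 min(4^i, 4^j), written as the geometric mean 2^(i + j) times the decay
    2^-|i - j|. The bound 4^j counts terms; the bound 64 * 4^i comes from the factor 1 /
    sin(y/2)^2. *)
Lemma fejer_kernel_le (j i : nat) (y : R) : annulus i y ->
  `|fejer_kernel (2 ^ j) y| <= 64 * (2 ^+ i * 2 ^+ j) * 2^-1 ^+ natdist i j.
Proof.
move=> Ay.
have e0 k : 0 < 2 ^+ k :> R by rewrite exprn_gt0.
have EV k : 2^-1 ^+ k = (2 ^+ k)^-1 :> R by rewrite exprVn.
set D := fejer_kernel _ _.
have D1 : `|D| <= 2 ^+ j * 2 ^+ j.
  have H m : `|fejer_kernel m y| <= m%:R * m%:R.
    rewrite (le_trans (ler_norm_sum _ _ _))//.
    (* The Dirichlet kernel of degree n is at most 2n + 1, and the first m odd numbers add up to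
       m^2. *)
    apply: (@le_trans _ _ (\sum_(0 <= n < m) (n.*2.+1)%:R)); last first.
      elim: m => [|m IH]; first by rewrite big_geq// mul0r.
      rewrite big_nat_recr//= (le_trans (lerD IH (lexx _)))//.
      by rewrite -!natrM -natrD ler_nat; nia.
    apply: ler_sum => n _; rewrite -[n.*2.+1%:R]natr1 [leRHS]addrC (le_trans (ler_normD _ _))//.
    rewrite normr1 lerD2l normrM ger0_norm// -mul2n natrM ler_wpM2l//.
    rewrite (le_trans (ler_norm_sum _ _ _))//.
    apply: (@le_trans _ _ (\sum_(1 <= k < n.+1) (1 : R))).
      by apply: ler_sum => k _; exact: cos_max.
    by rewrite big_const_nat iter_addr_0 subn1.
  by have := H (2 ^ j)%N; rewrite natrX.
have D2 : `|D| <= 64 * (2 ^+ i * 2 ^+ i).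
  have := sin_half_annulus y i Ay.
  have : sin (y / 2) ^+ 2 * `|D| <= 1.
    (* Times sin(y/2) the Dirichlet kernel is sin(y/2 + ny), a cosine with arguments in arithmetic
       progression in n, so that the sum over n telescopes against the second sin(y/2). *)
    have E n : sin (y / 2) * (1 + 2 * \sum_(1 <= k < n.+1) cos (k%:R * y)) =
        cos (y / 2 - pi / 2 + n%:R * y).
      have := sin_half_sum_cos 0 y 1 n.+1 isT.
      under eq_bigr do rewrite add0r.
      rewrite !add0r mul1r (_ : y - y / 2 = y / 2); last by field.
      have -> : n.+1%:R * y - y / 2 = y / 2 + n%:R * y by rewrite -(natr1 n); field.
      rewrite (_ : y / 2 - pi / 2 + n%:R * y = y / 2 + n%:R * y - pi / 2); last by ring.
      rewrite cosBpihalf => H.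
      by rewrite mulrDr mulr1 mulrCA mulrA H; ring.
    rewrite -[sin (y / 2) ^+ 2]real_normK ?num_real// expr2 -mulrA -[X in _ * X]normrM.
    rewrite /D /fejer_kernel mulr_sumr; under eq_bigr do rewrite E.
    exact: sin_half_sum_cos_le.
  rewrite -[sin (y / 2) ^+ 2]real_normK ?num_real//.
  have := normr_ge0 D; have := normr_ge0 (sin (y / 2)).
  set s := `|sin _|; set d := `|D| => s0 d0 H1 H2.
  have H3 : 1 <= 64 * (2 ^+ i * 2 ^+ i) * s ^+ 2.
    rewrite (_ : _ * s ^+ 2 = (8 * 2 ^+ i * s) * (8 * 2 ^+ i * s)); last by ring.
    by rewrite -[leLHS]mulr1 ler_pM// ler01.
  apply: (@le_trans _ _ (64 * (2 ^+ i * 2 ^+ i) * (s ^+ 2 * d))).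
    by rewrite mulrA ler_peMl.
  by rewrite ler_piMr// !mulr_ge0// ltW.
have [ij|ji] := leqP i j.
- apply: (le_trans D2); rewrite /natdist (eqP ij) add0n EV.
  have E : 2 ^+ j = 2 ^+ (j - i) * 2 ^+ i :> R by rewrite -exprD subnK.
  by rewrite E le_eqVlt; apply/orP; left; apply/eqP; field; rewrite gt_eqF.
- have {}ji := ltnW ji; apply: (le_trans D1); rewrite /natdist (eqP ji) addn0 EV.
  have E : 2 ^+ i = 2 ^+ (i - j) * 2 ^+ j :> R by rewrite -exprD subnK.
  rewrite E [leRHS](_ : _ = 64 * (2 ^+ j * 2 ^+ j)); last by field; rewrite gt_eqF.
  by rewrite ler_peMl ?mulr_ge0 ?(ltW (e0 _))// ler1n.
Qed.

(** Translation by pi/k changes the sign of cos(kx) and preserves the integral. *)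
Lemma circle_Rintegral_cos_eq0 (k : nat) : (0 < k)%N ->
  \int[mu]_x cos (k%:R * x) = 0.
Proof.
move=> k0.
have mc : measurable_fun setT (fun x : R => cos (k%:R * x)).
  by have := measurable_cos_affine (0 : R) k%:R; under eq_fun do rewrite add0r.
have pc : periodic (fun x : R => cos (k%:R * x)) (pi *+ 2).
  by move=> x; have := periodic_cos_affine (0 : R) k x; rewrite !add0r.
have := circle_Rintegral_shift _ (pi / k%:R) mc pc.
rewrite (_ : (fun x : R => cos (k%:R * (x + pi / k%:R))) = (fun x => -1 * cos (k%:R * x))); last first.
  apply/funext => x; rewrite mulrDr [k%:R * (pi / _)]mulrC divfK ?pnatr_eq0 -?lt0n//.
  by rewrite cosDpi mulN1r.
have fu : (\int[mu]_x `|(cst 1 : R -> R) x|%:E < +oo)%E.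
  by rewrite (eq_integral (cst `|1 : R|%:E))// integral_cst// circle_measure_setT -EFinM ltry.
rewrite RintegralZl//; last first.
  have := integrableM_bounded _ _ (measurable_cst _) fu (bounded_measurable_cos 0 k%:R).
  by apply: eq_integrable => // x _ /=; rewrite add0r mul1r.
by rewrite mulN1r; set I := Rintegral _ _ _; lra.
Qed.

(** The bound [K] is exclusive, so the sum of degree n is taken at [n.+1]. There is no constant
    term: this is the full partial sum only when u has mean zero. *)
Definition fourier_partial_sum u (K : nat) (x : R) : R :=
  \sum_(1 <= k < K) (pi^-1 * fourier_cos u k * cos (k%:R * x) +
                     pi^-1 * fourier_sin u k * sin (k%:R * x)).

Lemma bounded_measurable_cos0 (k : nat) :
  bounded_measurable (fun y : R => cos (k%:R * y)).
Proof.
by have := bounded_measurable_cos (0 : R) k%:R; under eq_fun do rewrite add0r.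
Qed.

Lemma bounded_measurable_cos2 (k : nat) :
  bounded_measurable (fun y : R => 2 * cos (k.+1%:R * y)).
Proof.
have [m1 [M HM]] := bounded_measurable_cos0 k.+1; split; first exact: measurable_funM.
by exists (2 * M) => y; rewrite normrM ger0_norm// ler_wpM2l.
Qed.

Lemma dirichlet_sumE (n : nat) (y : R) :
  1 + 2 * \sum_(1 <= k < n.+1) cos (k%:R * y) =
  1 + \sum_(0 <= k < n) 2 * cos (k.+1%:R * y).
Proof. by rewrite big_add1 mulr_sumr. Qed.

Lemma bounded_measurable_dirichlet (n : nat) :
  bounded_measurable (fun y : R => 1 + 2 * \sum_(1 <= k < n.+1) cos (k%:R * y)).
Proof.
under eq_fun do rewrite dirichlet_sumE.
have [m1 [M HM]] := bounded_measurable_sum n (fun k y => 2 * cos (k.+1%:R * y)) bounded_measurable_cos2.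
split; first exact: measurable_funD.
by exists (1 + M) => y; rewrite (le_trans (ler_normD _ _))// normr1 lerD2l.
Qed.

Lemma measurable_fejer_kernel (m : nat) : measurable_fun setT (fejer_kernel m).
Proof. by have [] := bounded_measurable_sum m _ bounded_measurable_dirichlet. Qed.

Lemma circle_L1_cst (c : R) : (\int[mu]_x `|(cst c : R -> R) x|%:E < +oo)%E.
Proof.
by rewrite (eq_integral (cst `|c|%:E))// integral_cst// circle_measure_setT -EFinM ltry.
Qed.

Lemma circle_L1_translate_diff p u (x : R) : 1 < p -> circle_Lp p u ->
  (\int[mu]_y `|u (y + x) - u x|%:E < +oo)%E.
Proof.
move=> p1 up; have [mu_ pu _] := up; have fu := circle_Lp_L1 _ _ p1 up.
have ux := circle_Lp_shift p u x up; have [mx px _] := ux.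
have fx := circle_Lp_L1 _ _ p1 ux.
have mv : measurable_fun setT (fun y : R => u (y + x) - u x) by exact: measurable_funB.
apply: (@le_lt_trans _ _ (\int[mu]_y (`|u (y + x)|%:E + `|u x|%:E))%E).
  apply: ge0_le_integral => //.
  - exact: (measurable_normr_EFin _ mv).
  - by apply: emeasurable_funD => //; exact: (measurable_normr_EFin _ mx).
  - by move=> y _; rewrite -EFinD lee_fin ler_normB.
rewrite ge0_integralD//; last exact: (measurable_normr_EFin _ mx).
by rewrite lte_add_pinfty//; exact: (circle_L1_cst (u x)).
Qed.

(** Each Dirichlet kernel has total mass 2 pi, which turns the subtracted constant [u x] into the
    subtraction on the right; the mean zero of u removes the constant mode. *)
Lemma circle_Rintegral_fejer p u (x : R) (m : nat) : 1 < p -> circle_Lp p u ->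
  \int[mu]_x u x = 0 ->
  \int[mu]_y ((u (y + x) - u x) * fejer_kernel m y) =
  pi *+ 2 * (\sum_(0 <= n < m) (fourier_partial_sum u n.+1 x - u x)).
Proof.
move=> p1 up Iu; have [mu_ pu _] := up; have fu := circle_Lp_L1 _ _ p1 up.
have ux := circle_Lp_shift p u x up; have [mx px _] := ux.
have fx := circle_Lp_L1 _ _ p1 ux.
have pi0 := @pi_gt0 R.
pose v y := u (y + x) - u x.
have mv : measurable_fun setT v by exact: measurable_funB.
have fc := circle_L1_cst.
have fv := circle_L1_translate_diff p u x p1 up.
have b1 : bounded_measurable (fun _ : R => 1 : R).
  by split; [exact: measurable_cst|exists 1 => y; rewrite normr1].
have bc := bounded_measurable_cos0.
have b2 := bounded_measurable_cos2.
have EE := dirichlet_sumE.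
have bn := bounded_measurable_dirichlet.
have bs n : bounded_measurable (fun y : R => \sum_(0 <= k < n) 2 * cos (k.+1%:R * y)).
  exact: (bounded_measurable_sum n (fun k y => 2 * cos (k.+1%:R * y)) b2).
rewrite /fejer_kernel -/v.
rewrite (circle_RintegralM_sum v m (fun n y => 1 + 2 * \sum_(1 <= k < n.+1) cos (k%:R * y)))//.
rewrite mulr_sumr; apply: eq_bigr => n _.
under eq_Rintegral do rewrite EE mulrDr.
have iv g : bounded_measurable g -> mu.-integrable setT (EFin \o (fun y => v y * g y)).
  exact: integrableM_bounded.
have iu g : bounded_measurable g -> mu.-integrable setT (EFin \o (fun y => u (y + x) * g y)).
  exact: integrableM_bounded.
have ic g : bounded_measurable g -> mu.-integrable setT (EFin \o (fun y => u x * g y)).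
  exact: (integrableM_bounded (cst (u x))).
have vg g : bounded_measurable g -> \int[mu]_y (v y * g y) =
    \int[mu]_y (u (y + x) * g y) - u x * \int[mu]_y g y.
  move=> bg; rewrite -RintegralZl//; last first.
    have [mg _] := bg.
    have := integrableM_bounded (cst 1) g (measurable_cst _) (fc 1) bg.
    by apply: eq_integrable => // y _ /=; rewrite mul1r.
  rewrite -RintegralB//; [|exact: iu|exact: ic].
  by apply: eq_Rintegral => y _; rewrite /v mulrBl.
rewrite RintegralD//; [|exact: iv|exact: iv].
rewrite vg//.
have -> : \int[mu]_y (u (y + x) * 1) = 0.
  under eq_Rintegral do rewrite mulr1.
  by rewrite circle_Rintegral_shift.
have -> : \int[mu]_y (1 : R) = pi *+ 2.
  by rewrite Rintegral_cst// mul1r circle_measure_setT.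
rewrite (circle_RintegralM_sum v n (fun k y => 2 * cos (k.+1%:R * y)))//.
rewrite /fourier_partial_sum big_add1 /= mulrBr addrC sub0r.
rewrite [u x * _]mulrC; congr (_ - _).
rewrite mulr_sumr; apply: eq_bigr => k _.
rewrite vg//.
have m1 : measurable_fun setT (fun y : R => cos (k.+1%:R * y)) by case: (bc k.+1).
rewrite RintegralZl//; last first.
  have := integrableM_bounded (cst 1) _ (measurable_cst _) (fc 1) (bc k.+1).
  by apply: eq_integrable => // y _ /=; rewrite mul1r.
rewrite circle_Rintegral_cos_eq0// !mulr0 subr0.
have iuc a : mu.-integrable setT (EFin \o (fun y => u y * cos (a + k.+1%:R * y))).
  exact: (integrableM_bounded _ _ mu_ fu (bounded_measurable_cos _ _)).
have -> : \int[mu]_y (u (y + x) * (2 * cos (k.+1%:R * y))) =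
    2 * \int[mu]_y (u (y + x) * cos (k.+1%:R * y)).
  rewrite -RintegralZl//; last exact: (iu _ (bc k.+1)).
  by apply: eq_Rintegral => y _; rewrite mulrCA.
rewrite circle_RintegralM_shift//; last first.
  by move=> y; have := periodic_cos_affine (0 : R) k.+1 y; rewrite !add0r.
have -> : \int[mu]_y (u y * cos (k.+1%:R * (y - x))) =
    cos (k.+1%:R * x) * fourier_cos u k.+1 + sin (k.+1%:R * x) * fourier_sin u k.+1.
  have E1 := RintegralZl (cos (k.+1%:R * x)) measurableT (iuc 0).
  have E2 := RintegralZl (sin (k.+1%:R * x)) measurableT (iuc (- (pi / 2))).
  rewrite fourier_cosE fourier_sinE -E1 -E2 -RintegralD//; last 2 first.
  - exact: (integrableZl measurableT (cos (k.+1%:R * x)) (iuc 0)).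
  - exact: (integrableZl measurableT (sin (k.+1%:R * x)) (iuc (- (pi / 2)))).
  apply: eq_Rintegral => y _.
  rewrite [- (pi / 2) + _]addrC cosBpihalf add0r mulrBr cosB; ring.
have -> : pi *+ 2 = 2 * pi :> R by rewrite mulr_natl.
have : pi != 0 :> R by rewrite gt_eqF.
by move: (@pi R) => P P0; field.
Qed.

(** Convolution with a summable kernel preserves null sequences: large indices i are controlled by
    the size of [e i], the finitely many small ones by the decay of the kernel as j grows. *)
Lemma cvg_conv_natdist (e : nat -> R) : (forall i, 0 <= e i) ->
  e @ \oo --> (0 : R) ->
  forall eps : R, 0 < eps -> \forall j \near \oo,
  (\sum_(i <oo) (2^-1 ^+ natdist i j * e i)%:E <= eps%:E)%E.
Proof.
move=> e0 ecv eps eps0.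
have h0 : 0 < (2^-1 : R) < 1 by apply/andP; split; lra.
have q0 n : 0 <= 2^-1 ^+ n :> R by rewrite exprn_ge0.
have [M M0 eM] : exists2 M : R, 0 < M & forall i, e i <= M.
  have /cvg_seq_bounded[M [_ HM]] : cvgn e by apply/cvg_ex; exists 0.
  exists (`|M| + 1); first by rewrite ltr_wpDl.
  move=> i; have := HM (`|M| + 1); rewrite (le_lt_trans (ler_norm M)) ?ltrDl//.
  by move=> /(_ isT i I); apply: le_trans; exact: ler_norm.
(* The kernel with q = 1/2 has mass at most 4, so these indices contribute at most eps / 2. *)
have [N _ HN] : \forall i \near \oo, e i <= eps / 8.
  have e8 : 0 < eps / 8 by rewrite divr_gt0.
  move/cvgrPdist_le : ecv => /(_ _ e8); apply: filterS => i.
  by rewrite sub0r normrN; apply: le_trans; exact: ler_norm.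
(* Each of the N indices i < N contributes at most M 2^-(j - i) <= M 2^N 2^-j. *)
have : \forall j \near \oo, (geometric (M * N%:R * 2 ^+ N) 2^-1) j <= eps / 2.
  have := @cvg_geometric R (M * N%:R * 2 ^+ N) 2^-1.
  rewrite ger0_norm// => /(_ _)/cvgrPdist_le => H.
  have e2 : 0 < eps / 2 by rewrite divr_gt0.
  have /H/(_ _ e2) : 2^-1 < 1 :> R by lra.
  by apply: filterS => j; rewrite sub0r normrN; apply: le_trans; exact: ler_norm.
move=> H; near=> j.
have jN : (N <= j)%N by near: j; exact: nbhs_infty_ge.
have : (geometric (M * N%:R * 2 ^+ N) 2^-1) j <= eps / 2 by near: j.
rewrite /= => Hj.
apply: nneseries_le_ub => [i|n]; first by rewrite lee_fin mulr_ge0.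
rewrite sumEFin lee_fin.
apply: (@le_trans _ _ (\sum_(0 <= i < n) (2^-1 ^+ natdist i j * (eps / 8) +
    (if (i < N)%N then M * 2 ^+ N * 2^-1 ^+ j else 0)))).
  apply: ler_sum => i _; case: ltnP => iN; last by rewrite addr0 ler_wpM2l// HN.
  rewrite -[leLHS]add0r lerD ?mulr_ge0 ?divr_ge0 ?(ltW eps0)//.
  rewrite -mulrA mulrC ler_pM//.
  have ij : (i <= j)%N by rewrite ltnW// (leq_trans iN jN).
  rewrite /natdist (eqP ij) add0n exprVn exprVn ler_pdivlMr ?exprn_gt0//.
  rewrite mulrC ler_pdivrMr ?exprn_gt0// -exprD ler_eXn2l ?ltr1n//.
  by move: iN ij; lia.
rewrite big_split/= -mulr_suml.
apply: (@le_trans _ _ (eps / 2 + eps / 2)); last by lra.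
apply: lerD.
  have := sum_expr_natdist (2^-1 : R) n j h0.
  have -> : 2 / (1 - 2^-1) = 4 :> R by field.
  move=> S4; apply: (@le_trans _ _ (4 * (eps / 8))); last by lra.
  by rewrite ler_wpM2r ?divr_ge0// ltW.
apply: le_trans Hj.
set c := M * 2 ^+ N * 2^-1 ^+ j.
have c0 : 0 <= c by rewrite !mulr_ge0 ?exprn_ge0// ltW.
have -> : \sum_(0 <= i < n) (if (i < N)%N then c else 0) = c * (minn n N)%:R.
  elim: n => [|n IH]; first by rewrite big_geq// min0n mulr0.
  rewrite big_nat_recr//= IH; case: ltnP => nN.
    by rewrite (minn_idPl nN) -[n.+1%:R]natr1 mulrDr mulr1.
  by rewrite addr0 (minn_idPr (leqW nN)).
rewrite (_ : _ * N%:R * _ * _ = c * N%:R); last first.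
  by rewrite /c [M * N%:R * _]mulrAC [_ * N%:R * _]mulrAC.
by rewrite ler_wpM2l// ler_nat geq_minr.
Unshelve. all: by end_near.
Qed.

End fejer_lebesgue.

(** * Recovering the function from its partial sums at Lebesgue points *)

Section lebesgue_points.
Context {R : realType}.
Local Notation mu := (circle_measure R).
Local Notation leb := (@lebesgue_measure R).
Local Notation circ := (`]- (@pi R), @pi R]%classic).
Implicit Types (u v g : R -> R) (p h : R).

(* The measure of [annulus i] is of order [2 ^- i], so every Lebesgue point of u
   has this property. *)
Definition annulus_lebesgue_pt u (x : R) :=
  (2 ^+ i * annulus_L1 (fun y => u (y + x) - u x) i) @[i --> \oo] --> (0 : R).

(** At such a point the Fejer means of order 2^j tend to [u x], because the kernel bound turns their
    error into a convolution of the null sequence of annular averages. A mean of numbers within B of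
    c stays within B of c, so the bound survives the limit. *)
Lemma fourier_partial_sum_bound p u (x c B : R) (N : nat) : 1 < p ->
  circle_Lp p u -> \int[mu]_x u x = 0 -> annulus_lebesgue_pt u x ->
  (forall K, (N <= K)%N -> `|fourier_partial_sum u K x - c| <= B) ->
  `|u x - c| <= B.
Proof.
move=> p1 up Iu lu SB; have [mu_ pu _] := up.
have ux := circle_Lp_shift p u x up; have [mx px _] := ux.
have fx := circle_Lp_L1 _ _ p1 ux.
pose v y := u (y + x) - u x.
have mv : measurable_fun setT v by exact: measurable_funB.
have B0 : 0 <= B by apply: le_trans (SB N (leqnn _)).
pose eta i := 2 ^+ i * annulus_L1 v i.
have eta0 i : 0 <= eta i by rewrite mulr_ge0 ?exprn_ge0 ?annulus_L1_ge0.
have fv := circle_L1_translate_diff p u x p1 up.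
(* The terms of index below N are not controlled; their total is fixed and becomes negligible after
   division by 2^j. *)
pose T := \sum_(0 <= n < N) `|fourier_partial_sum u n.+1 x - c|.
have T0 : 0 <= T by apply: sumr_ge0.
apply/ler_addgt0Pr => eps eps0.
have e2 : 0 < eps / 2 / 64 by rewrite !divr_gt0.
have H1 := cvg_conv_natdist eta eta0 lu _ e2.
have H2 : \forall j \near \oo, geometric T 2^-1 j <= eps / 2.
  have := @cvg_geometric R T 2^-1; rewrite ger0_norm// => /(_ _)/cvgrPdist_le => H.
  have e3 : 0 < eps / 2 by rewrite divr_gt0.
  have /H/(_ _ e3) : 2^-1 < 1 :> R by lra.
  by apply: filterS => j; rewrite sub0r normrN; apply: le_trans; exact: ler_norm.
have [j [Hj1 Hj2]] : exists j, (\sum_(i <oo) (2^-1 ^+ natdist i j * eta i)%:E <= (eps / 2 / 64)%:E)%E /\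
     geometric T 2^-1 j <= eps / 2.
  have [j1 _ K1] := H1; have [j2 _ K2] := H2.
  exists (maxn j1 j2); split; first by apply: K1; rewrite /= leq_maxl.
  by apply: K2; rewrite /= leq_maxr.
pose m := (2 ^ j)%N.
have mE : m%:R = 2 ^+ j :> R by rewrite /m natrX.
have m0 : 0 < m%:R :> R by rewrite mE exprn_gt0.
pose A := \sum_(0 <= n < m) (fourier_partial_sum u n.+1 x - u x).
have A1 : `|A| <= m%:R * (eps / 2).
  have := circle_Rintegral_fejer p u x m p1 up Iu; rewrite -/v -/A => E.
  have mD := @measurable_fejer_kernel R m.
  have k0 i : 0 <= 64 * (2 ^+ i * 2 ^+ j) * 2^-1 ^+ natdist i j :> R.
    by rewrite !mulr_ge0// exprn_ge0.
  have := Rintegral_annulus_le v _ _ mv fv mD k0 (fun i y => fejer_kernel_le j i y).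
  rewrite E => HA.
  have : (`|pi *+ 2 * A|%:E <= (64 * 2 ^+ j)%:E * (eps / 2 / 64)%:E)%E.
    apply: (le_trans HA); apply: le_trans (lee_wpmul2l _ Hj1); last first.
      by rewrite lee_fin mulr_ge0// exprn_ge0.
    rewrite -nneseriesZl; last by move=> i _; rewrite lee_fin mulr_ge0// exprn_ge0.
    apply: lee_nneseries => [i _ _|i _]; first by rewrite lee_fin mulr_ge0 ?annulus_L1_ge0.
    by rewrite -EFinM lee_fin /eta le_eqVlt; apply/orP; left; apply/eqP; ring.
  rewrite -EFinM lee_fin -mE => HB.
  apply: (@le_trans _ _ `|pi *+ 2 * A|); last by apply: (le_trans HB); lra.
  have P1 : 1 <= `|pi *+ 2 : R|.
    have p2 := @pi_ge2 R; apply: le_trans (ler_norm _).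
    by rewrite -[pi *+ 2]mulr_natr; lra.
  by rewrite normrM ler_peMl.
have A2 : `|\sum_(0 <= n < m) (fourier_partial_sum u n.+1 x - c)| <= m%:R * B + T.
  rewrite (le_trans (ler_norm_sum _ _ _))//.
  apply: (@le_trans _ _ (\sum_(0 <= n < m) (B +
     (if (n < N)%N then `|fourier_partial_sum u n.+1 x - c| else 0)))).
    apply: ler_sum => n _; case: ltnP => nN; first by rewrite lerDr.
    by rewrite addr0 SB// leqW.
  rewrite big_split/= big_const_nat iter_addr_0 subn0 -[B *+ m]mulr_natl lerD2l.
  have -> : \sum_(0 <= n < m) (if (n < N)%N then `|fourier_partial_sum u n.+1 x - c| else 0) =
    \sum_(0 <= n < minn m N) `|fourier_partial_sum u n.+1 x - c|.
    move: (m) => {mE m0 A A1} {}m; elim: m => [|m IH]; first by rewrite min0n !big_geq.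
    rewrite big_nat_recr//= IH; case: ltnP => nN.
      by rewrite (minn_idPl nN) big_nat_recr.
    by rewrite addr0 (minn_idPr (leqW nN)).
  rewrite /T [leRHS](big_cat_nat _ _ (n := minn m N))//= ?geq_minr//.
  by rewrite lerDl sumr_ge0.
have : m%:R * `|u x - c| <= m%:R * (B + eps / 2) + T.
  rewrite -[X in X * _](ger0_norm (ltW m0)) -normrM.
  have -> : m%:R * (u x - c) = \sum_(0 <= n < m) (fourier_partial_sum u n.+1 x - c) - A.
    rewrite /A -sumrB (eq_bigr (fun=> u x - c)); last by move=> n _; ring.
    by rewrite big_const_nat iter_addr_0 subn0 mulr_natl.
  rewrite (le_trans (ler_normB _ _))//.
  by apply: (le_trans (lerD A2 A1)); lra.
have Tm : T <= m%:R * (eps / 2).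
  by move: Hj2; rewrite /= exprVn ler_pdivrMr ?exprn_gt0// mE mulrC.
move=> H; rewrite -(ler_pM2l m0); apply: (le_trans H); lra.
Qed.

Lemma ae_annulus_lebesgue_pt p u : 1 < p -> circle_Lp p u ->
  {ae mu, forall x, annulus_lebesgue_pt u x}.
Proof.
move=> p1 up; have [mu_ pu _] := up; have fu := circle_Lp_L1 _ _ p1 up.
have pi0 := @pi_gt0 R.
(* Cutting u off outside three periods makes it integrable on the line, and leaves it unchanged on
   every ball of radius at most pi centred in the circle. *)
pose D : set R := `]- (pi *+ 3), pi *+ 3]%classic.
pose g := u \_ D.
have mD : measurable D by exact: measurable_itv.
have mnu := measurable_normr_EFin u mu_.
have intD : (\int[leb]_(y in D) `|u y|%:E < +oo)%E.
  pose D1 : set R := `]- (pi *+ 3), - pi]%classic; pose D3 : set R := `]pi, pi *+ 3]%classic.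
  have -> : D = D1 `|` (circ `|` D3).
    rewrite /D /D1 /D3 -!itv_bndbnd_setU// bnd_simp; lra.
  have sh (k : R) (E : set R) : (fun x : R => x + k) @^-1` E = circ ->
      (forall x, u (x + k) = u x) -> measurable E -> (\int[leb]_(y in E) `|u y|%:E < +oo)%E.
    move=> Ek pk mE.
    rewrite -(@ge0_integral_shift R (fun y => `|u y|%:E) E k)// Ek.
    under eq_integral do rewrite pk.
    by rewrite -integral_circle.
  have i1 : (\int[leb]_(y in D1) `|u y|%:E < +oo)%E.
    apply: (sh (- (pi *+ 2))) => //.
      by apply/seteqP; split => x; rewrite /D1 /D3 /= !in_itv/= => /andP[? ?]; apply/andP; split; lra.
      by move=> x; rewrite -(pu (x - _)) subrK.
    exact: measurable_itv.
  have i3 : (\int[leb]_(y in D3) `|u y|%:E < +oo)%E.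
    apply: (sh (pi *+ 2)) => //; last exact: measurable_itv.
    by apply/seteqP; split => x; rewrite /D1 /D3 /= !in_itv/= => /andP[? ?]; apply/andP; split; lra.
  have i2 : (\int[leb]_(y in circ) `|u y|%:E < +oo)%E by rewrite -integral_circle.
  have mD1 : measurable D1 by exact: measurable_itv.
  have mD3 : measurable D3 by exact: measurable_itv.
  have mC3 : measurable (circ `|` D3) by apply: measurableU => //; exact: measurable_itv.
  rewrite ge0_integral_setU//=; last 2 first.
  - exact: measurable_funTS.
  - apply/disj_setPS => x [/=]; rewrite /D1 /D3 /= !in_itv/= => /andP[_ xa] [] /andP[xb _]; lra.
  apply: lte_add_pinfty => //.
  rewrite ge0_integral_setU//=; last 2 first.
  - exact: measurable_funTS.
  - apply/disj_setPS => x [/=]; rewrite /D1 /D3 /= !in_itv/= => /andP[_ xa] /andP[xb _]; lra.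
  exact: lte_add_pinfty.
have mg : measurable_fun setT g by apply/measurable_restrict => //; exact: measurable_funTS.
have locg : locally_integrable setT g.
  apply: open_integrable_locally; first exact: openT.
  apply/integrableP; split; first exact/measurable_EFinP.
  rewrite (_ : (fun x => _) = (fun x => `|u x|%:E) \_ D).
    by rewrite -integral_mkcond; exact: intD.
  by apply/funext => x; rewrite /= /g !patchE; case: ifP => _ //=; rewrite normr0.
have := lebesgue_differentiation locg.
have sub : forall x, circ x -> lebesgue_pt g x -> annulus_lebesgue_pt u x.
  (* Twice the outer radius, so that the open ball contains the closed outer edge of annulus i. The
     ball has length 4 pi / 2^i, whence the factor [pi *+ 4] below. *)
  move=> x cx lx; pose r_ i : R := pi *+ 2 / 2 ^+ i.
  have r0 i : 0 < r_ i by rewrite divr_gt0 ?exprn_gt0// mulrn_wgt0.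
  have rcv : r_ @ \oo --> (0 : R).
    rewrite (_ : r_ = geometric (pi *+ 2) 2^-1).
      by apply: cvg_geometric; rewrite ger0_norm// invf_lt1// ltr1n.
    by apply/funext => i; rewrite /r_ /= exprVn.
  have dcv : davg g x (r_ i) @[i --> \oo] --> 0%E.
    by move/cvge_at_rightP : lx => /(_ r_); apply; split.
  pose v y := u (y + x) - u x.
  have fv := circle_L1_translate_diff p u x p1 up.
  have [mx _ _] := circle_Lp_shift p u x up.
  have mv : measurable_fun setT v by exact: measurable_funB.
  have key i : (2 <= i)%N -> ((2 ^+ i * annulus_L1 v i)%:E <= (pi *+ 4)%:E * davg g x (r_ i))%E.
    move=> i2.
    have i1 : 4 <= 2 ^+ i :> R by rewrite (_ : 4 = 2 ^+ 2) ?ler_eXn2l ?ltr1n//; ring.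
    have e0 : 0 < 2 ^+ i :> R by rewrite exprn_gt0.
    have rpi : r_ i <= pi.
      by rewrite /r_ ler_pdivrMr// -[pi *+ 2]mulr_natr; nra.
    rewrite EFinM -annulus_L1E//.
    have Acirc : annulus i `<=` circ.
      move=> y /= /andP[_ yi]; rewrite in_itv/=.
      have : `|y| < pi.
        by apply: (le_lt_trans yi); rewrite ltr_pdivrMr//; nra.
      by rewrite ltr_norml => /andP[-> /ltW].
    have -> : (\int[mu]_(y in annulus i) `|v y|%:E = \int[leb]_(y in annulus i) `|v y|%:E)%E.
      apply: eq_measure_integral => B mB BA.
      rewrite /circle_measure /= /mrestr setIidl//.
      exact: subset_trans BA Acirc.
    pose f y : \bar R := `|u y - u x|%:E.
    have mf : measurable_fun setT f.
      by apply: measurable_normr_EFin; exact: measurable_funB.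
    have mb : measurable (ball x (r_ i)) by exact: measurable_ball.
    have I1 : (\int[leb]_(y in annulus i) `|v y|%:E <= \int[leb]_(y in ball x (r_ i)) f y)%E.
      have f0 z : (0 <= f z)%E by rewrite lee_fin.
      rewrite -(@ge0_integral_shift R f _ x)//.
      apply: ge0_subset_integral => //.
      - exact: (measurable_annulus i).
      - by rewrite -[X in measurable X]setTI; exact: (measurable_shift x).
      - apply: measurable_funTS; exact: (measurable_normr_EFin _ mv).
      - move=> y /= /andP[_ yi]; rewrite /ball/= opprD addrCA subrr addr0 normrN.
        apply: (le_lt_trans yi); rewrite /r_ ltr_pM2r ?invr_gt0//.
        by rewrite mulr2n ltrDl.
    apply: (le_trans (lee_wpmul2l _ I1)); first by rewrite lee_fin ltW.
    have -> : (\int[leb]_(y in ball x (r_ i)) f y = (r_ i *+ 2)%:E * davg g x (r_ i))%E.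
      rewrite /davg /iavg lebesgue_measure_ball ?(ltW (r0 i))// muleA.
      rewrite inver ?gt_eqF ?mulrn_wgt0// -EFinM divff ?gt_eqF ?mulrn_wgt0// mul1e.
      apply: eq_integral => y; rewrite inE /ball/= => yb.
      have gE z : D z -> g z = u z by move=> Dz; rewrite /g patchE mem_set.
      rewrite /f /= !gE//.
      + move: cx; rewrite /D /= !in_itv/= => /andP[? ?]; apply/andP; split; lra.
      + move: cx yb; rewrite /D /= !in_itv/= ltr_norml => /andP[? ?] /andP[? ?].
        by apply/andP; split; lra.
    rewrite muleA -EFinM le_eqVlt; apply/orP; left; apply/eqP; congr (_%:E * _)%E.
    rewrite /r_ -![pi *+ _]mulr_natr -[_ *+ 2]mulr_natr.
    by move: e0; move: (2 ^+ i) (@pi R) => e P e0; field; rewrite gt_eqF.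
  have E : (2 ^+ i * annulus_L1 v i)%:E @[i --> \oo] --> (0 : R)%:E.
    apply: (@squeeze_cvge _ _ _ _ (cst 0%E) _ (fun i => (pi *+ 4)%:E * davg g x (r_ i))%E).
    - near=> i; rewrite key ?andbT ?lee_fin ?mulr_ge0 ?exprn_ge0 ?annulus_L1_ge0//.
      by near: i; exact: nbhs_infty_ge.
    - exact: cvg_cst.
    - rewrite -[X in _ --> X](mule0 (pi *+ 4)%:E); apply: cvgeZl => //.
  exact: (fine_cvg E).
move=> [N [mN N0 HN]].
exists (N `|` ~` circ); split.
- by apply: measurableU => //; exact: measurableC.
- apply/eqP; rewrite -measure_le0.
  rewrite /circle_measure /= /mrestr setIUl setICl setU0 -N0.
  by apply: le_measure; rewrite ?inE//; exact: measurableI.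
- move=> x /= nx; have [cx|] := pselect (circ x); last by right.
  by left; apply: HN => /= lx; apply: nx; exact: sub.
Unshelve. all: by end_near.
Qed.

End lebesgue_points.

(** * Dyadic blocks of general monotone sequences *)

Section dyadic_sequences.
Context {R : realType}.
Implicit Types (a b e x y v : nat -> R) (p : R).

Lemma big_dyadic_blocks (V : nmodType) (u : nat -> V) (m n : nat) : (m <= n)%N ->
  \sum_(2 ^ m <= k < 2 ^ n) u k =
  \sum_(m <= j < n) \sum_(2 ^ j <= k < 2 ^ j.+1) u k.
Proof.
move=> mn; rewrite -(subnKC mn); elim: (n - m)%N => [|d IH].
  by rewrite addn0 !big_geq.
rewrite addnS big_nat_recr ?leq_addr//= -IH.
by rewrite (big_cat_nat (n := 2 ^ (m + d)))//= leq_exp2l// ?leq_addr// leqW.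
Qed.

Lemma nneseries_dyadic (u : nat -> \bar R) (m : nat) : (forall k, 0 <= u k)%E ->
  (\sum_(2 ^ m <= k <oo) u k =
   \sum_(m <= j <oo) \sum_(2 ^ j <= k < 2 ^ j.+1) u k)%E.
Proof.
move=> u0; have b0 j : (0 <= \sum_(2 ^ j <= k < 2 ^ j.+1) u k)%E by exact: sume_ge0.
apply/eqP; rewrite eq_le; apply/andP; split; apply: nneseries_le_ub => // n.
- have [mn|nm] := leqP (2 ^ m) n; last first.
    by rewrite big_geq ?(ltnW nm)//; apply: nneseries_ge0.
  have mn' : (m <= n)%N by rewrite (leq_trans _ mn)// ltnW// ltn_expl.
  apply: (@le_trans _ _ (\sum_(2 ^ m <= k < 2 ^ n) u k)%E).
    by apply: lee_sum_nneg_natr => //; rewrite ltnW// ltn_expl.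
  by rewrite big_dyadic_blocks//; apply: nneseries_lim_ge.
- have [mn|nm] := leqP m n; last first.
    by rewrite big_geq ?(ltnW nm)//; apply: nneseries_ge0.
  by rewrite -big_dyadic_blocks//; apply: nneseries_lim_ge.
Qed.

Definition dyadic_avg e (j : nat) : R :=
  2^-1 ^+ j * \sum_(2 ^ j <= k < 2 ^ j.+1) e k.

Lemma dyadic_avg_ge0 e j : (forall k, (0 < k)%N -> 0 <= e k) -> 0 <= dyadic_avg e j.
Proof.
move=> e0; rewrite /dyadic_avg mulr_ge0 ?exprn_ge0// big_nat sumr_ge0// => k /andP[kj _].
by rewrite e0// (leq_trans _ kj)// expn_gt0.
Qed.

Lemma gm_dyadic_tail a (c C : R) (s j : nat) :
  @general_monotone R R^o c C a -> (forall k, (0 < k)%N -> 0 <= a k) ->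
  c <= 2 ^+ s ->
  (\sum_(2 ^ j <= k <oo) (`|a k - a k.+1|)%:E <=
   C%:E * \sum_((j - s)%N <= i <oo) (dyadic_avg a i)%:E)%E.
Proof.
move=> [c1 C0 _ /(_ (2 ^ j)%N)] + a0 cs; rewrite expn_gt0 => /(_ isT) H.
apply: (le_trans H); apply: lee_wpmul2l; first by rewrite lee_fin ltW.
have c0 : 0 < c by exact: lt_trans c1.
set m0 := maxn _ _.
have m0j : (2 ^ (j - s) <= m0)%N.
  rewrite /m0 leq_max; have [sj|js] := leqP s j; last by rewrite (eqP (ltnW js)).
  apply/orP; right; rewrite truncn_ge_nat ?divr_ge0 ?(ltW c0)//.
  rewrite ler_pdivlMr// !natrX (_ : 2 ^+ j = 2 ^+ (j - s) * 2 ^+ s).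
    by rewrite ler_wpM2l// exprn_ge0.
  by rewrite -exprD subnK.
pose u k : \bar R := (`|a k| / k%:R)%:E.
have u0 k : (0 <= u k)%E by rewrite lee_fin divr_ge0.
apply: (@le_trans _ _ (\sum_(2 ^ (j - s) <= k <oo) u k)%E).
  rewrite (@nneseries_split _ u (2 ^ (j - s)) (m0 - 2 ^ (j - s)))//.
  by rewrite subnKC// leeDr// sume_ge0.
rewrite nneseries_dyadic//; apply: lee_nneseries => [i _ _|i _]; first exact: sume_ge0.
rewrite sumEFin lee_fin /dyadic_avg mulr_sumr big_nat [leRHS]big_nat.
apply: ler_sum => k /andP[ki _].
have k0 : (0 < k)%N by rewrite (leq_trans _ ki)// expn_gt0.
rewrite ger0_norm ?a0// mulrC ler_wpM2r ?a0// exprVn lef_pV2 ?posrE ?exprn_gt0 ?ltr0n//.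
by rewrite -natrX ler_nat.
Qed.

Lemma dyadic_kernel0 i : dyadic_kernel i 0 = 1 :> R.
Proof. by rewrite /dyadic_kernel expr0 divr1 min_l// exprn_ege1// ler1n. Qed.

(** The kernel is at least 2^-s for i >= j - s: a tail that starts s blocks early is still of Hardy
    type. *)
Lemma tail_dyadic_kernel x (s j : nat) : (forall i, 0 <= x i) ->
  (\sum_((j - s)%N <= i <oo) (x i)%:E <=
   (2 ^+ s)%:E * \sum_(i <oo) (dyadic_kernel i j * x i)%:E)%E.
Proof.
move=> x0; have k0 i : 0 <= dyadic_kernel i j :> R by exact: dyadic_kernel_ge0.
rewrite -nneseriesZl; last by move=> i _; rewrite lee_fin mulr_ge0.
apply: (@le_trans _ _ (\sum_((j - s)%N <= i <oo) ((2 ^+ s)%:E * (dyadic_kernel i j * x i)%:E))%E).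
  rewrite eseries_cond [leRHS]eseries_cond.
  apply: lee_nneseries => [i _ _|i /andP[_]]; first by rewrite lee_fin.
  move=> ij; rewrite -EFinM lee_fin mulrA ler_peMl// /dyadic_kernel.
  case: (leP 1 (2 ^+ i / 2 ^+ j)) => _; first by rewrite mulr1 exprn_ege1// ler1n.
  rewrite mulrA ler_pdivlMr ?exprn_gt0// mul1r -exprD ler_eXn2l ?ltr1n//.
  by rewrite -leq_subLR.
rewrite [leRHS](@nneseries_split _ _ 0 (j - s)); last first.
  by move=> i _; rewrite -EFinM lee_fin !mulr_ge0 ?exprn_ge0.
rewrite add0n leeDr// sume_ge0// => i _.
by rewrite -EFinM lee_fin !mulr_ge0 ?exprn_ge0.
Qed.

(* The witness built below is the total variation of a and b beyond [2 ^ j]; for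
   null sequences it dominates the terms, and the last item is what general
   monotonicity gives. *)
Definition dyadic_variation (s : nat) (C : R) a b v :=
  [/\ forall j, 0 <= v j,
      forall j m, \sum_(2 ^ j <= k < m) (`|a k - a k.+1| + `|b k - b k.+1|) <= v j,
      forall j k, (2 ^ j <= k)%N -> a k + b k <= v j &
      forall j, ((v j)%:E <= C%:E * \sum_((j - s)%N <= i <oo)
                  (dyadic_avg (fun k => (a k + b k)%R) i)%:E)%E].

Lemma gm_dyadic_variation p a b (ca Ca cb Cb : R) (s : nat) : 1 < p ->
  @general_monotone R R^o ca Ca a -> @general_monotone R R^o cb Cb b ->
  (forall k, (0 < k)%N -> 0 <= a k) -> (forall k, (0 < k)%N -> 0 <= b k) ->
  ca <= 2 ^+ s -> cb <= 2 ^+ s ->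
  (dyadic_norm p (dyadic_avg (fun k => (a k + b k)%R)) < +oo)%E ->
  exists v, dyadic_variation s (Ca + Cb) a b v.
Proof.
move=> p1 ga gb a0 b0 cas cbs fin.
pose al := dyadic_avg (fun k => (a k + b k)%R).
have al0 i : 0 <= al i by apply: dyadic_avg_ge0 => k k0; rewrite addr_ge0 ?a0 ?b0.
have Ca0 : 0 < Ca by case: ga.
have Cb0 : 0 < Cb by case: gb.
(* The kernel with second index 0 is identically 1, so a finite dyadic norm already makes the block
   means summable; hence the variations are finite and v can be real-valued. *)
have sfin : (\sum_(i <oo) (al i)%:E < +oo)%E.
  have := dyadic_norm_fin p p1 al 0 al0 fin.
  by under eq_eseriesr do rewrite dyadic_kernel0 mul1r.
pose tl j := (\sum_((j - s)%N <= i <oo) (al i)%:E)%E.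
have tlfin j : (tl j < +oo)%E.
  apply: le_lt_trans sfin; rewrite [leRHS](@nneseries_split _ _ 0 (j - s)); last first.
    by move=> i _; rewrite lee_fin.
  by rewrite add0n leeDr// sume_ge0// => i _; rewrite lee_fin.
have tl0 j : (0 <= tl j)%E by apply: nneseries_ge0 => i _ _; rewrite lee_fin.
have tail x (c C : R) j : @general_monotone R R^o c C x -> (forall k, (0 < k)%N -> 0 <= x k) ->
    c <= 2 ^+ s -> (forall k, (0 < k)%N -> x k <= a k + b k) ->
    (\sum_(2 ^ j <= k <oo) (`|x k - x k.+1|)%:E <= C%:E * tl j)%E.
  move=> gx x0 cs xab; apply: (le_trans (gm_dyadic_tail _ _ _ _ j gx x0 cs)).
  have C0 : 0 < C by case: gx.
  apply: lee_wpmul2l; first by rewrite lee_fin ltW.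
  apply: lee_nneseries => [i _ _|i _]; first by rewrite lee_fin dyadic_avg_ge0.
  rewrite lee_fin ler_wpM2l ?exprn_ge0// big_nat [leRHS]big_nat ler_sum// => k /andP[ki _].
  by rewrite xab// (leq_trans _ ki)// expn_gt0.
pose va j := (\sum_(2 ^ j <= k <oo) (`|a k - a k.+1|)%:E)%E.
pose vb j := (\sum_(2 ^ j <= k <oo) (`|b k - b k.+1|)%:E)%E.
have va_le j : (va j <= Ca%:E * tl j)%E.
  by apply: (tail a ca) => // k k0; rewrite lerDl b0.
have vb_le j : (vb j <= Cb%:E * tl j)%E.
  by apply: (tail b cb) => // k k0; rewrite lerDr a0.
have va0 j : (0 <= va j)%E by exact: nneseries_ge0.
have vb0 j : (0 <= vb j)%E by exact: nneseries_ge0.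
have vaE j : va j = (fine (va j))%:E.
  rewrite fineK// ge0_fin_numE//; apply: (le_lt_trans (va_le j)).
  by rewrite lte_mul_pinfty// lee_fin ltW.
have vbE j : vb j = (fine (vb j))%:E.
  rewrite fineK// ge0_fin_numE//; apply: (le_lt_trans (vb_le j)).
  by rewrite lte_mul_pinfty// lee_fin ltW.
(* A null sequence is the sum of its later increments: telescope from k to m, then let m tend to
   infinity. *)
have le_tail x j k : x n @[n --> \oo] --> (0 : R) -> (forall k, (0 < k)%N -> 0 <= x k) ->
    (\sum_(2 ^ j <= k <oo) (`|x k - x k.+1|)%:E < +oo)%E ->
    (2 ^ j <= k)%N -> x k <= fine (\sum_(2 ^ j <= k <oo) (`|x k - x k.+1|)%:E)%E.
  move=> xcv x0 xf jk; set W := fine _.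
  have Hm m : (k <= m)%N -> x k <= W + x m.
    move=> km; rewrite -lerBlDr.
    apply: (@le_trans _ _ (\sum_(k <= i < m) `|x i - x i.+1|)).
      rewrite (_ : x k - x m = \sum_(k <= i < m) (x i - x i.+1)).
        by apply: ler_sum => i _; exact: ler_norm.
      rewrite -[LHS]opprB -(telescope_sumr x km) -sumrN.
      by apply: eq_bigr => i _; rewrite opprB.
    rewrite -lee_fin /W fineK; last by rewrite ge0_fin_numE// nneseries_ge0.
    rewrite -sumEFin.
    apply: (@le_trans _ _ (\sum_(2 ^ j <= i < m) (`|x i - x i.+1|)%:E)%E).
      rewrite [leRHS](big_cat_nat _ _ (n := k))//=.
      by rewrite leeDr// sume_ge0.
    exact: nneseries_lim_ge.
  apply/ler_addgt0Pr => eps eps0.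
  have [N _ HN] : \forall n \near \oo, x n <= eps.
    move/cvgrPdist_le : xcv => /(_ _ eps0); apply: filterS => i.
    by rewrite sub0r normrN; apply: le_trans; exact: ler_norm.
  apply: (le_trans (Hm (maxn k N) (leq_maxl _ _))); rewrite lerD2l.
  by apply: HN; rewrite /= leq_maxr.
exists (fun j => fine (va j) + fine (vb j)); split.
- by move=> j; rewrite addr_ge0 ?fine_ge0.
- move=> j m; rewrite big_split/= lerD//.
    by rewrite -lee_fin -vaE -sumEFin; apply: nneseries_lim_ge.
  by rewrite -lee_fin -vbE -sumEFin; apply: nneseries_lim_ge.
- move=> j k jk; apply: lerD.
    by apply: le_tail => //; [case: ga|rewrite -/(va j) vaE ltry].
  by apply: le_tail => //; [case: gb|rewrite -/(vb j) vbE ltry].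
- move=> j; apply: (@le_trans _ _ (Ca%:E * tl j + Cb%:E * tl j)%E).
    by rewrite EFinD -vaE -vbE leeD.
  by rewrite [in leRHS]EFinD ge0_muleDl ?lee_fin ?(ltW Ca0) ?(ltW Cb0).
Qed.

End dyadic_sequences.

(** * Comparing the series of the theorem with dyadic norms *)

Section dyadic_norm_algebra.
Context {R : realType}.
Variable p : R.
Hypothesis p1 : 1 < p.
Let p0 : 0 < p. Proof. exact: lt_trans p1. Qed.
Local Notation kap := (dyadic_ratio p).
Let kn (j : nat) : 0 <= kap ^+ j.
Proof. by rewrite exprn_ge0// ltW// (lt_trans _ (dyadic_ratio_gt1 p p1)). Qed.

Lemma le_dyadic_norm (x y : nat -> R) : (forall j, 0 <= x j) ->
  (forall j, x j <= y j) -> (dyadic_norm p x <= dyadic_norm p y)%E.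
Proof.
move=> x0 xy; apply: lee_nneseries => [j _ _|j _]; first by rewrite lee_fin powR_ge0.
rewrite lee_fin ge0_ler_powR ?nnegrE ?mulr_ge0 ?(ltW p0)//.
  exact: le_trans (xy j).
by rewrite ler_wpM2l.
Qed.

Lemma dyadic_normZ (c : R) (x : nat -> R) : 0 <= c -> (forall j, 0 <= x j) ->
  dyadic_norm p (fun j => c * x j) = ((c `^ p)%:E * dyadic_norm p x)%E.
Proof.
move=> c0 x0; rewrite /dyadic_norm -nneseriesZl; last by move=> j _; rewrite lee_fin powR_ge0.
apply: eq_eseriesr => j _; by rewrite -EFinM mulrCA [(c * _) `^ p]powRM// mulr_ge0.
Qed.

Lemma dyadic_normD_le (x y : nat -> R) : (forall j, 0 <= x j) -> (forall j, 0 <= y j) ->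
  (dyadic_norm p (fun j => (x j + y j)%R) <=
   (2 `^ p)%:E * (dyadic_norm p x + dyadic_norm p y))%E.
Proof.
move=> x0 y0; rewrite /dyadic_norm -nneseriesD; last 2 first.
- by move=> j _ _; rewrite lee_fin powR_ge0.
- by move=> j _ _; rewrite lee_fin powR_ge0.
rewrite -nneseriesZl; last by move=> j _; rewrite adde_ge0// lee_fin powR_ge0.
apply: lee_nneseries => [j _ _|j _]; first by rewrite lee_fin powR_ge0.
rewrite -EFinD -EFinM lee_fin mulrDr.
have := powRB_le p (kap ^+ j * x j) (- (kap ^+ j * y j)) (ltW p0).
by rewrite opprK normrN !ger0_norm ?addr_ge0 ?mulr_ge0.
Qed.

Lemma hardy_dyadic_scaled : exists2 C : R, 0 < C & forall (c : R) x y,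
  0 <= c -> (forall i, 0 <= x i) -> (forall j, 0 <= y j) ->
  (forall j, ((y j)%:E <= c%:E * \sum_(i <oo) (dyadic_kernel i j * x i)%:E)%E) ->
  (dyadic_norm p y <= (c `^ p * C)%:E * dyadic_norm p x)%E.
Proof.
have [C C0 H] := hardy_dyadic p p1.
exists C => // c x y c0 x0 y0 yx.
rewrite mulrC EFinM -muleA -dyadic_normZ//.
apply: H => // [i|j]; first exact: mulr_ge0.
apply: (le_trans (yx j)); rewrite -nneseriesZl; last first.
  by move=> i _; rewrite lee_fin mulr_ge0 ?dyadic_kernel_ge0.
rewrite le_eqVlt; apply/orP; left; apply/eqP; apply: eq_eseriesr => i _.
by rewrite -EFinM mulrCA.
Qed.

Definition dyadic_weight (l : nat) (t : R) (j : nat) : R := Num.min 1 (2 ^+ j * t) ^+ l.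

Lemma dyadic_weight_ge0 l t j : 0 < t -> 0 <= dyadic_weight l t j.
Proof. by move=> t0; rewrite exprn_ge0// le_min ler01 mulr_ge0 ?exprn_ge0 ?ltW. Qed.

Lemma dyadic_weight_le1 l t j : 0 < t -> dyadic_weight l t j <= 1.
Proof.
move=> t0; rewrite exprn_ile1//; last by rewrite ge_min lexx.
by rewrite le_min ler01 mulr_ge0 ?exprn_ge0 ?ltW.
Qed.

Lemma dyadic_weight_shift l t s i j : 0 < t -> (j - s <= i)%N ->
  dyadic_weight l t j <= (2 ^+ s) ^+ l * dyadic_weight l t i.
Proof.
move=> t0 ij; rewrite -exprMn lerXn2r ?nnegrE//.
- by rewrite le_min ler01 mulr_ge0 ?exprn_ge0 ?ltW.
- by rewrite mulr_ge0 ?exprn_ge0// le_min ler01 mulr_ge0 ?exprn_ge0 ?ltW.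
have s1 : 1 <= 2 ^+ s :> R by rewrite exprn_ege1// ler1n.
case: (leP 1 (2 ^+ i * t)) => _.
  by rewrite mulr1 ge_min s1.
rewrite ge_min mulrA -exprD ler_wpM2r ?(ltW t0) ?orbT// ler_eXn2l ?ltr1n//.
by rewrite -leq_subLR.
Qed.

Definition smoothness_term (l : nat) (a b : nat -> R) (t : R) (k : nat) : R :=
  Num.min 1 (k%:R * t) `^ (l%:R * p) * k%:R `^ (p - 2) * (a k `^ p + b k `^ p).

(** The exponent p - 2 may have either sign; as k^(p - 1) / k each factor is monotone in k and can
    be compared with its value at 2^j. *)
Lemma smoothness_termE l a b t k : 0 < t -> (0 < k)%N ->
  smoothness_term l a b t k =
  (Num.min 1 (k%:R * t) ^+ l) `^ p * (k%:R `^ (p - 1) / k%:R) * (a k `^ p + b k `^ p).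
Proof.
move=> t0 k0; rewrite /smoothness_term; congr (_ * _ * _).
  rewrite powRrM powR_mulrn// le_min ler01 mulr_ge0// ltW//.
rewrite (_ : p - 2 = (p - 1) - 1); last by ring.
by rewrite powRB ?pnatr_eq0 -?lt0n ?k0 ?implybT// powRr1.
Qed.

Lemma smoothness_term_ge0 l a b t k : 0 <= smoothness_term l a b t k.
Proof. by rewrite !mulr_ge0 ?powR_ge0// addr_ge0 ?powR_ge0. Qed.

Definition smoothness_series l a b t : \bar R :=
  (\sum_(1 <= k <oo) (smoothness_term l a b t k)%:E)%E.

Lemma smoothness_series_dyadic l a b t : smoothness_series l a b t =
  (\sum_(j <oo) (\sum_(2 ^ j <= k < 2 ^ j.+1) smoothness_term l a b t k)%:E)%E.
Proof.
rewrite /smoothness_series -[1%N]/(2 ^ 0)%N nneseries_dyadic; last first.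
  by move=> k; rewrite lee_fin smoothness_term_ge0.
by apply: eq_eseriesr => j _; rewrite sumEFin.
Qed.

(** Discrete counterpart of [integral_powR_ge]: with half the mean as threshold the left side is 2
    (al/2)^p, and one copy is absorbed. *)
Lemma dyadic_avg_powR_le (e : nat -> R) j : (forall k, (0 < k)%N -> 0 <= e k) ->
  dyadic_avg e j `^ p <= 2 `^ p * (2^-1 ^+ j * \sum_(2 ^ j <= k < 2 ^ j.+1) e k `^ p).
Proof.
move=> e0; set al := dyadic_avg e j.
have al0 : 0 <= al by exact: dyadic_avg_ge0.
have h0 : 0 < 2^-1 ^+ j :> R by rewrite exprn_gt0.
have al20 : 0 <= al / 2 by rewrite divr_ge0.
set S := \sum_(_ <= _ < _) _.
have cnt (c : R) : \sum_(2 ^ j <= k < 2 ^ j.+1) c = 2 ^+ j * c.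
  rewrite big_const_nat iter_addr_0 -[LHS]mulr_natl; congr (_ * _).
  by rewrite expnS mul2n -addnn addnK natrX.
have H : (\sum_(2 ^ j <= k < 2 ^ j.+1) e k) * (al / 2) `^ (p - 1) <=
    S + 2 ^+ j * (al / 2) `^ p.
  rewrite mulr_suml -cnt -big_split/= big_nat [leRHS]big_nat ler_sum// => k /andP[kj _].
  apply: powR_threshold => //; apply: e0.
  by rewrite (leq_trans _ kj)// expn_gt0.
have EV : 2^-1 ^+ j * 2 ^+ j = 1 :> R by rewrite -exprMn mulVf// expr1n.
have H2 : al * (al / 2) `^ (p - 1) <= 2^-1 ^+ j * S + (al / 2) `^ p.
  have := ler_wpM2l (ltW h0) H.
  by rewrite mulrA mulrDr [_ * (2 ^+ j * _)]mulrA EV mul1r.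
have E2 : al * (al / 2) `^ (p - 1) = 2 * (al / 2) `^ p.
  by rewrite -(mulr_powRB1 al20 p0); field.
rewrite E2 in H2.
have -> : al `^ p = 2 `^ p * (al / 2) `^ p by rewrite -powRM// mulrCA divff ?mulr1.
by rewrite ler_wpM2l ?powR_ge0//; lra.
Qed.

Lemma min_weight_bounds l t j k : 0 < t -> (2 ^ j <= k)%N -> (k < 2 ^ j.+1)%N ->
  dyadic_weight l t j <= Num.min 1 (k%:R * t) ^+ l <= 2 ^+ l * dyadic_weight l t j.
Proof.
move=> t0 jk kj.
have e0 : 0 < 2 ^+ j * t by rewrite mulr_gt0// exprn_gt0.
have k1 : 2 ^+ j <= k%:R :> R by rewrite -natrX ler_nat.
have k2 : k%:R <= 2 * 2 ^+ j :> R by rewrite -exprS -natrX ler_nat ltnW.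
have m0 (z : R) : 0 < z -> 0 <= Num.min 1 z by move=> z0; rewrite le_min ler01 ltW.
have kt0 : 0 < k%:R * t by apply: lt_le_trans e0 _; rewrite ler_wpM2r// ltW.
apply/andP; split.
  rewrite lerXn2r ?nnegrE ?m0//; rewrite le_min !ge_min lexx/=.
  by rewrite ler_wpM2r ?orbT// ltW.
rewrite -exprMn lerXn2r ?nnegrE ?mulr_ge0 ?m0//.
case: (leP 1 (2 ^+ j * t)) => _; first by rewrite ge_min mulr1 ler1n.
by rewrite ge_min mulrA ler_wpM2r ?orbT// ltW.
Qed.

Lemma dyadic_norm_avg_le l : exists2 C : R, 0 < C & forall (a b : nat -> R) t,
  (forall k, (0 < k)%N -> 0 <= a k) -> (forall k, (0 < k)%N -> 0 <= b k) -> 0 < t ->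
  (dyadic_norm p (fun j => (dyadic_weight l t j * dyadic_avg (fun k => a k + b k) j)%R)
   <= C%:E * smoothness_series l a b t)%E.
Proof.
exists (2 * 2 `^ p * 2 `^ p); first by rewrite !mulr_gt0 ?powR_gt0.
move=> a b t a0 b0 t0.
rewrite smoothness_series_dyadic -nneseriesZl; last first.
  by move=> j _; rewrite lee_fin sumr_ge0// => k _; exact: smoothness_term_ge0.
apply: lee_nneseries => [j _ _|j _]; first by rewrite lee_fin powR_ge0.
rewrite -EFinM lee_fin.
set w := dyadic_weight l t j.
have w0 : 0 <= w by exact: dyadic_weight_ge0.
pose e k := a k + b k.
have e0 k : (0 < k)%N -> 0 <= e k by move=> k0; rewrite addr_ge0 ?a0 ?b0.
have al0 : 0 <= dyadic_avg e j by exact: dyadic_avg_ge0.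
rewrite [(kap ^+ j * _) `^ p]powRM ?(mulr_ge0 w0 al0)// (dyadic_ratio_powR p p1) [(w * _) `^ p]powRM//.
apply: (@le_trans _ _ ((2 ^+ j) `^ (p - 1) * (w `^ p *
    (2 `^ p * (2^-1 ^+ j * \sum_(2 ^ j <= k < 2 ^ j.+1) e k `^ p))))).
  by rewrite !ler_wpM2l ?powR_ge0// dyadic_avg_powR_le.
rewrite !mulr_sumr big_nat [leRHS]big_nat ler_sum// => k /andP[jk kj].
have k0 : (0 < k)%N by rewrite (leq_trans _ jk)// expn_gt0.
have kR0 : 0 < k%:R :> R by rewrite ltr0n.
rewrite smoothness_termE//.
have /andP[W1 _] := min_weight_bounds l t j k t0 jk kj.
have W : w `^ p <= (Num.min 1 (k%:R * t) ^+ l) `^ p.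
  by rewrite ge0_ler_powR ?nnegrE ?(ltW p0)// (le_trans w0).
have K : (2 ^+ j) `^ (p - 1) * 2^-1 ^+ j <= 2 * (k%:R `^ (p - 1) / k%:R).
  rewrite [leRHS](_ : _ = k%:R `^ (p - 1) * (2 / k%:R)); last by ring.
  apply: ler_pM; rewrite ?exprn_ge0 ?powR_ge0//.
    by rewrite ge0_ler_powR ?nnegrE ?exprn_ge0 ?subr_ge0 ?(ltW p1)// -natrX ler_nat.
  rewrite exprVn ler_pdivlMr// ler_pdivrMl ?exprn_gt0// mulrC -exprS -natrX ler_nat.
  exact: ltnW.
have E : e k `^ p <= 2 `^ p * (a k `^ p + b k `^ p).
  have := powRB_le p (a k) (- b k) (ltW p0).
  by rewrite opprK normrN !ger0_norm ?a0 ?b0 ?addr_ge0 ?a0 ?b0.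
rewrite [leLHS](_ : _ = 2 `^ p * ((w `^ p * ((2 ^+ j) `^ (p - 1) * 2^-1 ^+ j)) * e k `^ p)); last by ring.
rewrite [leRHS](_ : _ = 2 `^ p * ((Num.min 1 (k%:R * t) ^+ l) `^ p * (2 * (k%:R `^ (p - 1) / k%:R))
  * (2 `^ p * (a k `^ p + b k `^ p)))); last by ring.
have h0 : 0 <= 2^-1 ^+ j :> R by rewrite exprn_ge0.
have K0 := mulr_ge0 (powR_ge0 (2 ^+ j) (p - 1)) h0.
have WK := ler_pM (powR_ge0 w p) K0 W K.
apply: ler_wpM2l; first exact: powR_ge0.
exact: (ler_pM (mulr_ge0 (powR_ge0 w p) K0) (powR_ge0 (e k) p) WK E).
Qed.

Lemma smoothness_series_le l : exists2 C : R, 0 < C & forall (a b v : nat -> R) s C0 t,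
  (forall k, (0 < k)%N -> 0 <= a k) -> (forall k, (0 < k)%N -> 0 <= b k) -> 0 < t ->
  dyadic_variation s C0 a b v ->
  (smoothness_series l a b t <=
   C%:E * dyadic_norm p (fun j => (dyadic_weight l t j * v j)%R))%E.
Proof.
exists ((2 ^+ l) `^ p * 2 `^ p); first by rewrite !mulr_gt0 ?powR_gt0 ?exprn_gt0.
move=> a b v s C0 t a0 b0 t0 [v0 _ abv _].
rewrite smoothness_series_dyadic -nneseriesZl; last by move=> j _; rewrite lee_fin powR_ge0.
apply: lee_nneseries => [j _ _|j _].
  by rewrite lee_fin sumr_ge0// => k _; exact: smoothness_term_ge0.
rewrite -EFinM lee_fin.
set w := dyadic_weight l t j.
have w0 : 0 <= w by exact: dyadic_weight_ge0.
have e0 : 0 < 2 ^+ j :> R by rewrite exprn_gt0.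
rewrite [(kap ^+ j * _) `^ p]powRM ?mulr_ge0// (dyadic_ratio_powR p p1).
apply: (@le_trans _ _ (\sum_(2 ^ j <= k < 2 ^ j.+1)
    ((2 ^+ l * w) `^ p * ((2 * 2 ^+ j) `^ (p - 1) / 2 ^+ j) * (v j `^ p + v j `^ p)))).
  rewrite big_nat [leRHS]big_nat ler_sum// => k /andP[jk kj].
  have k0 : (0 < k)%N by rewrite (leq_trans _ jk)// expn_gt0.
  have kR0 : 0 < k%:R :> R by rewrite ltr0n.
  rewrite smoothness_termE//.
  have /andP[W0 W1] := min_weight_bounds l t j k t0 jk kj.
  have ab := abv j k jk; have ak := a0 k k0; have bk := b0 k k0.
  apply: ler_pM; rewrite ?mulr_ge0 ?addr_ge0 ?powR_ge0 ?invr_ge0//.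
    apply: ler_pM; rewrite ?mulr_ge0 ?powR_ge0 ?invr_ge0//.
      apply: ge0_ler_powR; rewrite ?nnegrE ?(ltW p0)//; first exact: le_trans W0.
      by rewrite mulr_ge0// exprn_ge0.
    apply: ler_pM; rewrite ?powR_ge0 ?invr_ge0//.
      rewrite ge0_ler_powR ?nnegrE ?subr_ge0 ?(ltW p1) ?mulr_ge0 ?(ltW e0)//.
      by rewrite -exprS -natrX ler_nat ltnW.
    by rewrite lef_pV2 ?posrE// -natrX ler_nat.
  by rewrite lerD// ge0_ler_powR ?nnegrE ?(ltW p0)//; lra.
rewrite big_const_nat iter_addr_0 -[leLHS]mulr_natl.
have -> : (2 ^ j.+1 - 2 ^ j)%:R = 2 ^+ j :> R by rewrite expnS mul2n -addnn addnK natrX.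
have l0 : 0 <= 2 ^+ l :> R by rewrite exprn_ge0.
have j0 := ltW e0.
rewrite [(2 ^+ l * w) `^ p]powRM// [(2 * 2 ^+ j) `^ _]powRM// [(w * v j) `^ p]powRM//.
rewrite -(@mulr_powRB1 _ 2 p)// le_eqVlt; apply/orP; left; apply/eqP.
by field; rewrite gt_eqF.
Qed.

End dyadic_norm_algebra.

(** * Lower bound for the modulus of smoothness *)

Section lower_bound.
Context {R : realType}.
Local Notation mu := (circle_measure R).
Implicit Types (u f : R -> R) (a b e z v : nat -> R) (p h t : R).

Definition kernel_sum u (j : nat) : \bar R :=
  (\sum_(i <oo) (dyadic_kernel i j * annulus_L1 u i)%:E)%E.

Lemma kernel_sum_ge0 u j : (0 <= kernel_sum u j)%E.
Proof.
apply: nneseries_ge0 => i _ _.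
by rewrite lee_fin mulr_ge0 ?dyadic_kernel_ge0 ?annulus_L1_ge0.
Qed.

(** Rounding up gives 1 rather than 0 at j = 0. The last bound ensures that a window starting at
    [uphalf (2 ^ j) + k'] with k' < [uphalf (2 ^ j)] starts no later than 2^j, so that every window
    contains the whole block. *)
Lemma uphalf_pow2 (j : nat) :
  [/\ (0 < uphalf (2 ^ j))%N, (uphalf (2 ^ j) <= 2 ^ j)%N, (2 ^ j <= 2 * uphalf (2 ^ j))%N &
      (2 * uphalf (2 ^ j) <= (2 ^ j).+1)%N].
Proof.
have := expn_gt0 2 j => /= L0; have := odd_double_half (2 ^ j).
by rewrite uphalf_half; case: odd => /=; rewrite -muln2; split; lia.
Qed.

Lemma uphalf_pow2_ge (j : nat) : (0 < j)%N -> (2 ^ j.-1 <= uphalf (2 ^ j))%N.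
Proof.
by case: j => // j _; have [_ _ + _] := uphalf_pow2 j.+1; rewrite expnS leq_mul2l.
Qed.

(* Coefficient functional of the test polynomial: every frequency of the block
   [2 ^ j <= n < 2 ^ j.+1] receives the full multiplicity [uphalf (2 ^ j)], all
   multiplicities are nonnegative, and only [0 < n < 4 * 2 ^ j] occurs. *)
Definition window_sum z (j : nat) : R :=
  \sum_(0 <= k' < uphalf (2 ^ j)) \sum_(0 <= k < 2 * 2 ^ j) z (uphalf (2 ^ j) + (k + k'))%N.

Lemma window_sumE z j k' :
  \sum_(0 <= k < 2 * 2 ^ j) z (uphalf (2 ^ j) + (k + k'))%N =
  \sum_(uphalf (2 ^ j) + k' <= n < uphalf (2 ^ j) + k' + 2 * 2 ^ j) z n.
Proof.
rewrite -{1}[(_ + k')%N]add0n big_addn addnC addnK.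
by apply: eq_bigr => k _; congr z; lia.
Qed.

Lemma window_ge z j k' : (forall n, (0 < n)%N -> (n < 4 * 2 ^ j)%N -> 0 <= z n) ->
  (k' < uphalf (2 ^ j))%N ->
  \sum_(2 ^ j <= k < 2 ^ j.+1) z k <=
  \sum_(uphalf (2 ^ j) + k' <= n < uphalf (2 ^ j) + k' + 2 * 2 ^ j) z n.
Proof.
move=> z0 kq; have [q0 qL Lq qL1] := uphalf_pow2 j.
have E2 : (2 ^ j.+1 = 2 * 2 ^ j)%N by rewrite expnS.
rewrite (big_cat_nat (n := 2 ^ j) (m := uphalf (2 ^ j) + k'))//=; [|lia|lia].
rewrite [X in _ <= _ + X](big_cat_nat (n := 2 ^ j.+1))//=; [|lia|lia].
rewrite addrCA lerDl addr_ge0// big_nat sumr_ge0// => n /andP[n1 n2]; apply: z0; lia.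
Qed.

Lemma window_sum_ge z j : (forall n, (0 < n)%N -> (n < 4 * 2 ^ j)%N -> 0 <= z n) ->
  (uphalf (2 ^ j))%:R * \sum_(2 ^ j <= k < 2 ^ j.+1) z k <= window_sum z j.
Proof.
move=> z0; rewrite /window_sum.
rewrite -[leLHS]/(_%:R * _) mulr_natl -{1}[uphalf _]subn0 -iter_addr_0 -big_const_nat.
rewrite big_nat [leRHS]big_nat ler_sum// => k' /andP[_ kq].
by rewrite window_sumE window_ge.
Qed.

Lemma window_sum_le p u (s t : R) z j : 1 < p -> circle_Lp p u ->
  `|s| <= 1 -> `|t| <= 1 ->
  (forall n, (0 < n)%N -> (n < 4 * 2 ^ j)%N ->
     pi * z n = s * fourier_cos u n + t * fourier_sin u n) ->
  ((window_sum z j)%:E <= (64 * 4 ^+ j)%:E * kernel_sum u j)%E.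
Proof.
move=> p1 up s1 t1 zE; have [q0 qL Lq qL1] := uphalf_pow2 j.
have K0 := kernel_sum_ge0 u j.
(* Dividing by pi >= 2 turns the constant 128 of the block estimate into 64. *)
have pi2 := @pi_ge2 R.
have := fourier_block_le p u s t (uphalf (2 ^ j)) (2 * 2 ^ j) (uphalf (2 ^ j)) j
  p1 up s1 t1 (leqnn _) qL.
rewrite -/(kernel_sum u j); set Z := \sum_(_ <= _ < _) _ => HZ.
have ZE : Z = pi * window_sum z j.
  rewrite /Z /window_sum mulr_sumr big_nat [RHS]big_nat; apply: eq_bigr => k' /andP[_ k'q].
  rewrite mulr_sumr big_nat [RHS]big_nat; apply: eq_bigr => k /andP[_ km].
  by rewrite zE//; lia.
case E : (kernel_sum u j) K0 HZ => [B||]//= K0 HZ; last first.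
  by rewrite gt0_muley ?leey// lte_fin mulr_gt0// exprn_gt0.
move: HZ; rewrite -!EFinM !lee_fin ZE => HZ.
have {HZ} : pi * window_sum z j <= 128 * 4 ^+ j * B by apply: le_trans HZ; exact: ler_norm.
have : 0 <= 4 ^+ j * B by rewrite mulr_ge0 ?exprn_ge0// -lee_fin.
move: (4 ^+ j * B) (mulrA 128 (4 ^+ j) B) (mulrA 64 (4 ^+ j) B) => D <- <- D0 HD.
have [W0|W0] := leP 0 (window_sum z j); last by rewrite (le_trans (ltW W0))// mulr_ge0.
nra.
Qed.

(** The block is counted at least 2^j / 2 times in a window sum of size 64 * 4^j; averaging over its
    2^j terms leaves 128. *)
Lemma dyadic_avg_fourier_le p u (s t : R) z j : 1 < p -> circle_Lp p u ->
  `|s| <= 1 -> `|t| <= 1 ->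
  (forall n, (0 < n)%N -> (n < 4 * 2 ^ j)%N -> 0 <= z n) ->
  (forall n, (0 < n)%N -> (n < 4 * 2 ^ j)%N ->
     pi * z n = s * fourier_cos u n + t * fourier_sin u n) ->
  ((dyadic_avg z j)%:E <= 128%:E * kernel_sum u j)%E.
Proof.
move=> p1 up s1 t1 z0 zE; have [q0 qL Lq qL1] := uphalf_pow2 j.
have K0 := kernel_sum_ge0 u j.
have := window_sum_le p u s t z j p1 up s1 t1 zE.
have := window_sum_ge z j z0.
case E : (kernel_sum u j) K0 => [B||]//= K0; last first.
  by move=> _ _; rewrite gt0_muley ?leey// lte_fin.
rewrite -!EFinM !lee_fin /dyadic_avg; set S := \sum_(_ <= _ < _) _ => H1 H2.
have S0 : 0 <= S.
  rewrite /S big_nat sumr_ge0// => n /andP[n1 n2].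
  have := expn_gt0 2 j => /= L0; apply: z0; first by lia.
  by move: n2; rewrite expnS; lia.
have e0 : 0 < 2 ^+ j :> R by rewrite exprn_gt0.
have E4 : 4 ^+ j = 2 ^+ j * 2 ^+ j :> R by rewrite -exprMn -natrM.
have H3 : 2 ^+ j <= 2 * (uphalf (2 ^ j))%:R :> R by rewrite -natrX -natrM ler_nat.
have H4 : 2 ^+ j * S <= 128 * (2 ^+ j * 2 ^+ j) * B.
  by move: H1 H2; rewrite E4 => H1 H2; nra.
rewrite exprVn mulrC ler_pdivrMr// -(ler_pM2l e0).
by apply: (le_trans H4); rewrite le_eqVlt; apply/orP; left; apply/eqP; ring.
Qed.

Definition fourier_coeffs f a b := forall n, (0 < n)%N ->
  pi * a n = fourier_cos f n /\ pi * b n = fourier_sin f n.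

(** If 2^j h <= 1, every frequency n < 4 * 2^j of the test polynomial has nh/2 <= 2, where the sine
    is at least nh/8. So no multiplier is negative, and on the block they are at least 2^j h / 4. *)
Lemma dyadic_avg_low p f a b (l j : nat) h : 1 < p -> circle_Lp p f ->
  fourier_coeffs f a b ->
  (forall k, (0 < k)%N -> 0 <= a k) -> (forall k, (0 < k)%N -> 0 <= b k) ->
  0 < h -> 2 ^+ j * h <= 1 ->
  (((2 ^+ j * h / 4) ^+ l * dyadic_avg (fun k => a k + b k) j)%:E <=
   128%:E * kernel_sum (iter l (central_diff h) f) j)%E.
Proof.
move=> p1 fp fc a0 b0 h0 jh; have p0 : 0 <= p by rewrite ltW// (lt_trans _ p1).
have [s [t [s1 t1 st]]] := @fourier_iter_central_diff R l.
pose z n := (2 * sin (n%:R * h / 2)) ^+ l * (a n + b n).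
have sin0 n : (n < 4 * 2 ^ j)%N -> n%:R * h / 8 <= sin (n%:R * h / 2).
  move=> n4; have n0 : 0 <= n%:R * h by rewrite mulr_ge0// ltW.
  have n2 : n%:R * h <= 4.
    apply: (@le_trans _ _ ((4 * 2 ^ j)%:R * h)).
      by rewrite ler_wpM2r ?(ltW h0)// ler_nat ltnW.
    by rewrite natrM natrX -mulrA; lra.
  have := @sin_ge_quarter R (n%:R * h / 2).
  have -> : 0 <= n%:R * h / 2 <= 2 by apply/andP; split; lra.
  by move=> /(_ isT); apply: le_trans; lra.
have z0 n : (0 < n)%N -> (n < 4 * 2 ^ j)%N -> 0 <= z n.
  move=> n0 n4; rewrite mulr_ge0 ?addr_ge0 ?a0 ?b0// exprn_ge0// mulr_ge0//.
  by apply: le_trans (sin0 n n4); rewrite divr_ge0// mulr_ge0// ltW.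
have up := circle_Lp_iter_central_diff p h l f p0 fp.
have := dyadic_avg_fourier_le p _ s t z j p1 up s1 t1 z0.
move=> H; apply: le_trans (H _); last first.
  move=> n n0 n4; rewrite -(st p)// /z mulrCA; congr (_ * _).
  by have [<- <-] := fc n n0; rewrite mulrDr.
rewrite lee_fin /dyadic_avg mulrCA ler_wpM2l ?exprn_ge0//.
rewrite mulr_sumr big_nat [leRHS]big_nat ler_sum// => n /andP[n1 n2].
have n0 : (0 < n)%N by rewrite (leq_trans _ n1)// expn_gt0.
have n4 : (n < 4 * 2 ^ j)%N by move: n2; rewrite expnS; lia.
rewrite /z ler_wpM2r ?addr_ge0 ?a0 ?b0//.
have q0 : 0 <= 2 ^+ j * h / 4 by rewrite divr_ge0// mulr_ge0 ?exprn_ge0// ltW.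
have Hq : 2 ^+ j * h / 4 <= 2 * sin (n%:R * h / 2).
  have : 2 ^+ j * h <= n%:R * h by rewrite ler_wpM2r ?(ltW h0)// -natrX ler_nat.
  have := sin0 n n4; lra.
by rewrite lerXn2r ?nnegrE// (le_trans q0).
Qed.

(** For larger 2^j h the sines may vanish or change sign. At order 2l the multiplier is at least 1 -
    2l cos(nh), so the plain window sums exceed the weighted ones by cosine sums only, which the
    regularity of the coefficients keeps small. *)
Lemma dyadic_avg_high p f a b v (s l j : nat) (C0 : R) h : 1 < p -> circle_Lp p f ->
  fourier_coeffs f a b ->
  (forall k, (0 < k)%N -> 0 <= a k) -> (forall k, (0 < k)%N -> 0 <= b k) ->
  dyadic_variation s C0 a b v -> 0 < h <= 1 -> (0 < j)%N ->
  ((dyadic_avg (fun k => (a k + b k)%R) j)%:E <=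
   128%:E * kernel_sum (iter (l + l) (central_diff h) f) j +
   (32 * l%:R / (2 ^+ j * h) * v j.-1)%:E)%E.
Proof.
move=> p1 fp fc a0 b0 [v0 var vab _] /andP[h0 h1] j0.
have p0 : 0 <= p by rewrite ltW// (lt_trans _ p1).
have [s' [t [s1 t1 st]]] := @fourier_iter_central_diff R (l + l).
have up := circle_Lp_iter_central_diff p h (l + l) f p0 fp.
pose e n := a n + b n.
pose z n := (2 * sin (n%:R * h / 2)) ^+ (l + l) * e n.
have e0 n : (0 < n)%N -> 0 <= e n by move=> n0; rewrite addr_ge0 ?a0 ?b0.
have [q0 qL Lq qL1] := uphalf_pow2 j.
have HW := window_sum_le p _ s' t z j p1 up s1 t1 _.
have {HW}HW : ((window_sum z j)%:E <= (64 * 4 ^+ j)%:E * kernel_sum (iter (l + l) (central_diff h) f) j)%E.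
  apply: HW => n n0 n4; rewrite -(st p)// /z mulrCA; congr (_ * _).
  by have [<- <-] := fc n n0; rewrite mulrDr.
have sh : h / 8 <= sin (h / 2).
  have := @sin_ge_quarter R (h / 2).
  have -> : 0 <= h / 2 <= 2 by apply/andP; split; lra.
  by move=> /(_ isT); apply: le_trans; lra.
have sh0 : 0 < sin (h / 2) by apply: lt_le_trans sh; rewrite divr_gt0.
(* Bernoulli: (2 sin(nh/2))^(2l) = (1 + (1 - 2 cos nh))^l >= 1 + l (1 - 2 cos nh). *)
have bern n : 1 - 2 * l%:R * cos (n%:R * h) <= (2 * sin (n%:R * h / 2)) ^+ (l + l).
  have E : (2 * sin (n%:R * h / 2)) ^+ 2 = 1 + (1 - 2 * cos (n%:R * h)).
    rewrite [in RHS](_ : n%:R * h = (n%:R * h / 2) *+ 2); last by rewrite -[RHS]mulr_natr divfK.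
    by rewrite cos_mulr2n cos2sin2 exprMn; ring.
  rewrite addnn -mul2n exprM E.
  have c1 := cos_le1 (n%:R * h).
  have : 1 + (1 - 2 * cos (n%:R * h)) *+ l <= (1 + (1 - 2 * cos (n%:R * h))) ^+ l.
    elim: (l) => [|d IH]; first by rewrite mulr0n addr0 expr0.
    rewrite exprS mulrS; have : 0 <= d%:R * (1 - 2 * cos (n%:R * h)) ^+ 2.
      by rewrite mulr_ge0// sqr_ge0.
    move: IH; rewrite -mulr_natl; set c := cos _ in c1 *; set P := _ ^+ d.
    move=> IH H; have : 0 <= (1 + (1 - 2 * c)) * (P - (1 + d%:R * (1 - 2 * c))).
      by rewrite mulr_ge0 ?subr_ge0//; lra.
    by move: H; rewrite expr2; lra.
  apply: le_trans; rewrite -mulr_natl; have := ler0n R l; lra.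
pose A k' := (uphalf (2 ^ j) + k')%N; pose m := (2 * 2 ^ j)%N.
(* Partial sums of cos(nh) are at most 1 / sin(h/2) <= 8/h. The end value and the variation of e
   contribute [v j.-1] each, since for j > 0 every window starts at or beyond 2^(j - 1). *)
have Ebd k' : `|\sum_(A k' <= n < A k' + m) e n * cos (n%:R * h)| <= 16 / h * v j.-1.
  have cb k : `|\sum_(A k' <= i < k) cos (i%:R * h)| <= 8 / h.
    have := sin_half_sum_cos_le 0 h (A k') k.
    under eq_bigr do rewrite add0r.
    rewrite (gtr0_norm sh0) => H.
    rewrite ler_pdivlMr//; have := normr_ge0 (\sum_(A k' <= i < k) cos (i%:R * h)); nra.
  have Aj n : (A k' <= n)%N -> (2 ^ j.-1 <= n)%N.
    by apply: leq_trans; rewrite /A (leq_trans (uphalf_pow2_ge j j0)) ?leq_addr.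
  have := abel_sum_le e (fun n => cos (n%:R * h)) (8 / h) (A k') (A k' + m) (leq_addr _ _) cb.
  move=> /le_trans; apply.
  have B0 : 0 <= 8 / h by rewrite divr_ge0// ltW.
  rewrite (_ : 16 / h * v j.-1 = 8 / h * (v j.-1 + v j.-1)); last by ring.
  rewrite ler_wpM2l// lerD//.
    rewrite ger0_norm; first by apply: vab; apply: Aj; rewrite leq_addr.
    by apply: e0; rewrite /A !addn_gt0 q0.
  apply: le_trans (var j.-1 (A k' + m)%N).
  rewrite [leRHS](big_cat_nat (n := A k'))//=; [|exact: Aj|exact: leq_addr].
  rewrite -[leLHS]add0r lerD//; first by apply: sumr_ge0 => i _; rewrite addr_ge0.
  apply: ler_sum => n _; rewrite /e (_ : a n + b n - _ = (a n - a n.+1) + (b n - b n.+1)); last by ring.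
  exact: ler_normD.
have HH : (uphalf (2 ^ j))%:R * \sum_(2 ^ j <= k < 2 ^ j.+1) e k <=
    window_sum z j + (uphalf (2 ^ j))%:R * (2 * l%:R * (16 / h * v j.-1)).
  apply: le_trans (window_sum_ge e j _) _; first by move=> n n0 _; exact: e0.
  have cst c m' : \sum_(0 <= k' < m') c = m'%:R * c :> R.
    by rewrite big_const_nat iter_addr_0 subn0 -[LHS]mulr_natl.
  rewrite -cst /window_sum -big_split/=.
  apply: ler_sum => k' _; rewrite !window_sumE.
  apply: (@le_trans _ _ (\sum_(A k' <= n < A k' + m) z n + 2 * l%:R * \sum_(A k' <= n < A k' + m) e n * cos (n%:R * h))).
    rewrite mulr_sumr -big_split/= big_nat [leRHS]big_nat ler_sum// => n /andP[n1 _].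
    have en : 0 <= e n by apply: e0; apply: leq_trans n1; rewrite addn_gt0 q0.
    have := ler_wpM2r en (bern n); rewrite /z; lra.
  rewrite lerD2l ler_wpM2l ?mulr_ge0//.
  by apply: le_trans (Ebd k'); exact: ler_norm.
have K0 := kernel_sum_ge0 (iter (l + l) (central_diff h) f) j.
case E : (kernel_sum _ _) K0 HW => [B||]//= K0 HW; last by rewrite gt0_muley// addye// leey.
move: HW; rewrite -!EFinM -EFinD !lee_fin /dyadic_avg -/e => HW.
have L0 : 0 < 2 ^+ j :> R by rewrite exprn_gt0.
have E4 : 4 ^+ j = 2 ^+ j * 2 ^+ j :> R by rewrite -exprMn -natrM.
have H3 : 2 ^+ j <= 2 * (uphalf (2 ^ j))%:R :> R by rewrite -natrX -natrM ler_nat.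
have q0' : 0 < (uphalf (2 ^ j))%:R :> R by rewrite ltr0n.
rewrite exprVn mulrC ler_pdivrMr// mulrDl.
rewrite [X in _ + X](_ : _ = 2 * l%:R * (16 / h * v j.-1)); last first.
  by field; rewrite !gt_eqF.
rewrite -lerBlDr -(ler_pM2l q0') mulrBr.
have : (uphalf (2 ^ j))%:R * \sum_(2 ^ j <= k < 2 ^ j.+1) e k -
   (uphalf (2 ^ j))%:R * (2 * l%:R * (16 / h * v j.-1)) <= 64 * (2 ^+ j * 2 ^+ j) * B.
  by rewrite lerBlDr (le_trans HH)// lerD2r -E4.
move=> /le_trans; apply.
have : 0 <= 2 ^+ j * B by rewrite mulr_ge0// ltW.
nra.
Qed.

End lower_bound.

(** * The lower bound: joining low and high frequencies *)

Section lower_theorem.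
Context {R : realType}.
Implicit Types (u f : R -> R) (a b v : nat -> R) (p h t : R).
Local Notation alpha a b := (dyadic_avg (fun k : nat => (a k + b k)%R)).

(** The lower bound for f itself, without differences. Only its qualitative content is needed: it
    makes v finite and licenses the absorption below. *)
Lemma dyadic_norm_avg_fin p f a b : 1 < p -> circle_Lp p f -> fourier_coeffs f a b ->
  (forall k, (0 < k)%N -> 0 <= a k) -> (forall k, (0 < k)%N -> 0 <= b k) ->
  (dyadic_norm p (alpha a b) < +oo)%E.
Proof.
move=> p1 fp fc a0 b0; have [mf pf ff] := fp.
have [C C0 H] := hardy_dyadic_scaled p p1.
have [D D0 HD] := dyadic_norm_annulus_L1 p p1.
have fL1 := circle_Lp_L1 _ _ p1 fp.
have e0 k : (0 < k)%N -> 0 <= a k + b k by move=> k0; rewrite addr_ge0 ?a0 ?b0.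
have CC0 : 0 <= 128 `^ p * C by rewrite mulr_ge0 ?powR_ge0// ltW.
apply: (@le_lt_trans _ _ ((128 `^ p * C)%:E * (D%:E * Lp_integral p f))%E); last first.
  have Lf0 : (0 <= Lp_integral p f)%E.
    by apply: integral_ge0 => x _; rewrite lee_fin powR_ge0.
  by rewrite lte_mul_pinfty ?mule_ge0 ?lee_fin ?(ltW D0)// lte_mul_pinfty ?lee_fin ?(ltW D0).
apply: le_trans (lee_wpmul2l _ (HD f mf fL1)); last by rewrite lee_fin.
apply: H => // [i|j|j]; [exact: annulus_L1_ge0|exact: dyadic_avg_ge0|].
apply: (dyadic_avg_fourier_le p f 1 1) => //; rewrite ?normr1//.
  by move=> n n0 _; exact: e0.
by move=> n n0 _; have [<- <-] := fc n n0; rewrite !mul1r mulrDr.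
Qed.

Lemma dyadic_weight_low (l M j : nat) t : 0 < t -> 2 ^+ j * t < 2 ^+ M ->
  dyadic_weight l t j <= (4 * 2 ^+ M) ^+ l * (2 ^+ j * (t / 2 ^+ M) / 4) ^+ l.
Proof.
move=> t0 jt; have M0 : 0 < 2 ^+ M :> R by rewrite exprn_gt0.
have jt0 : 0 < 2 ^+ j * t by rewrite mulr_gt0 ?exprn_gt0.
rewrite -exprMn (_ : 4 * 2 ^+ M * _ = 2 ^+ j * t); last by field; rewrite gt_eqF.
rewrite lerXn2r ?nnegrE//; [by rewrite le_min ler01 ltW|exact: ltW|].
by rewrite ge_min lexx orbT.
Qed.

(** When 2^j t >= 2^M the error of [dyadic_avg_high] carries 1/(2^j t) <= 2^-M, and [v j.-1] is a
    tail of block means; this gives the last term, a Hardy sum of the very sequence being estimated,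
    with a factor that decreases in M. *)
Lemma low_high_bound p f a b v (s l M j : nat) (C0 : R) t : 1 < p ->
  circle_Lp p f -> fourier_coeffs f a b ->
  (forall k, (0 < k)%N -> 0 <= a k) -> (forall k, (0 < k)%N -> 0 <= b k) ->
  dyadic_variation s C0 a b v -> 0 <= C0 -> 0 < t <= 1 -> (s < M)%N ->
  ((dyadic_weight l t j * alpha a b j)%:E <=
   ((4 * 2 ^+ M) ^+ l * 128)%:E * kernel_sum (iter l (central_diff (t / 2 ^+ M)) f) j +
   128%:E * kernel_sum (iter (l + l) (central_diff t) f) j +
   (32 * l%:R * C0 * 2 ^+ s.+1 / 2 ^+ M)%:E *
   \sum_(i <oo) (dyadic_kernel i j * (dyadic_weight l t i * alpha a b i))%:E)%E.
Proof.
move=> p1 fp fc a0 b0 vv C00 t01 sM; have /andP[t0 t1] := t01.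
have M0 : 0 < 2 ^+ M :> R by rewrite exprn_gt0.
have e0 k : (0 < k)%N -> 0 <= a k + b k by move=> k0; rewrite addr_ge0 ?a0 ?b0.
have al0 i : 0 <= alpha a b i by exact: dyadic_avg_ge0.
have w0 i : 0 <= dyadic_weight l t i by exact: dyadic_weight_ge0.
have S0 : (0 <= \sum_(i <oo) (dyadic_kernel i j * (dyadic_weight l t i * alpha a b i))%:E)%E.
  by apply: nneseries_ge0 => i _ _; rewrite lee_fin mulr_ge0 ?dyadic_kernel_ge0// mulr_ge0.
have c30 : 0 <= 32 * l%:R * C0 * 2 ^+ s.+1 / 2 ^+ M.
  by rewrite !mulr_ge0 ?exprn_ge0 ?invr_ge0 ?(ltW M0).
have c10 : 0 <= (4 * 2 ^+ M) ^+ l :> R by rewrite exprn_ge0// mulr_ge0// ltW.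
have [jt|jt] := ltP (2 ^+ j * t) (2 ^+ M).
- have h0 : 0 < t / 2 ^+ M by rewrite divr_gt0.
  have jh : 2 ^+ j * (t / 2 ^+ M) <= 1 by rewrite mulrA ler_pdivrMr// mul1r ltW.
  have H := dyadic_avg_low p f a b l j _ p1 fp fc a0 b0 h0 jh.
  apply: (@le_trans _ _ (((4 * 2 ^+ M) ^+ l * 128)%:E *
      kernel_sum (iter l (central_diff (t / 2 ^+ M)) f) j)%E); last first.
    rewrite -addeA leeDl// adde_ge0 ?mule_ge0 ?lee_fin// ?kernel_sum_ge0//.
  rewrite EFinM -muleA; apply: le_trans (lee_wpmul2l _ H); last by rewrite lee_fin.
  rewrite -EFinM lee_fin [leRHS]mulrA ler_wpM2r//.
  exact: dyadic_weight_low.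
- have j0 : (0 < j)%N.
    case: j jt S0 => // jt _; exfalso; move: jt; rewrite expr0 mul1r => jt.
    have : (2 : R) ^+ 1 <= 2 ^+ M by rewrite ler_eXn2l ?ltr1n// (leq_ltn_trans _ sM).
    by rewrite expr1 => ?; move: (le_trans jt t1); lra.
  have H := dyadic_avg_high p f a b v s l j C0 t p1 fp fc a0 b0 vv t01 j0.
  apply: (@le_trans _ _ (128%:E * kernel_sum (iter (l + l) (central_diff t) f) j +
    (32 * l%:R * C0 * 2 ^+ s.+1 / 2 ^+ M)%:E *
   \sum_(i <oo) (dyadic_kernel i j * (dyadic_weight l t i * alpha a b i))%:E)%E); last first.
    by rewrite -[leRHS]addeA leeDr// mule_ge0 ?kernel_sum_ge0// lee_fin mulr_ge0.
  apply: (@le_trans _ _ (alpha a b j)%:E).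
    by rewrite lee_fin ler_piMl// dyadic_weight_le1.
  apply: (le_trans H); rewrite leeD2l//.
  have [v0 _ _ vC] := vv.
  apply: (@le_trans _ _ ((32 * l%:R / 2 ^+ M)%:E * (v j.-1)%:E)%E).
    rewrite -EFinM lee_fin ler_wpM2r// ler_wpM2l ?mulr_ge0// lef_pV2 ?posrE//.
    by rewrite mulr_gt0 ?exprn_gt0.
  have -> : 32 * l%:R * C0 * 2 ^+ s.+1 / 2 ^+ M = (32 * l%:R / 2 ^+ M) * (C0 * 2 ^+ s.+1).
    by field; rewrite gt_eqF.
  rewrite [in leRHS]EFinM -muleA lee_wpmul2l ?lee_fin ?divr_ge0 ?mulr_ge0 ?(ltW M0)//.
  apply: (le_trans (vC j.-1)); rewrite EFinM -muleA lee_wpmul2l ?lee_fin//.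
  have -> : (j.-1 - s = j - s.+1)%N by rewrite -subn1 -subnDA add1n.
  apply: le_trans (tail_dyadic_kernel (fun i => dyadic_weight l t i * alpha a b i) s.+1 j _).
    rewrite eseries_cond [leRHS]eseries_cond; apply: lee_nneseries => [i _ _|i /andP[_ ij]].
      by rewrite lee_fin.
    rewrite lee_fin ler_peMl//.
    (* On the tail i >= j - (s + 1) the weight is already 1: 2^i t is at least 2^M / 2^(s + 1), and
       s < M. The weight can thus be inserted for free. *)
    rewrite /dyadic_weight min_l ?expr1n//.
    have : (2 : R) ^+ M <= 2 ^+ s.+1 * (2 ^+ i * t).
      apply: (le_trans jt); rewrite mulrA -exprD ler_wpM2r ?(ltW t0)//.
      by rewrite ler_eXn2l ?ltr1n// -leq_subLR.
    have : (2 : R) ^+ s.+1 <= 2 ^+ M by rewrite ler_eXn2l ?ltr1n.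
    have s0 : 0 < 2 ^+ s.+1 :> R by rewrite exprn_gt0.
    move=> H1 H2; have := le_trans H1 H2.
    by rewrite -[leLHS]mulr1 ler_pM2l.
  by move=> i; rewrite mulr_ge0.
Qed.

(* The blocks with [2 ^ j * t < 2 ^ M] are seen by differences of step [t / 2 ^ M],
   the others by the difference of order [l + l] and step t. The error term
   carries a factor [d] which tends to 0 as M grows; it is absorbed in the left
   hand side, which is finite because f is in L^p. *)
Lemma lower_bound_core p (l s : nat) (C0 : R) : 1 < p -> 0 <= C0 ->
  exists2 K : R, 0 < K & forall f a b v t (Om : \bar R),
  circle_Lp p f -> fourier_coeffs f a b ->
  (forall k, (0 < k)%N -> 0 <= a k) -> (forall k, (0 < k)%N -> 0 <= b k) ->
  dyadic_variation s C0 a b v -> 0 < t <= 1 ->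
  (forall h, `|h| <= t -> (Lp_integral p (iter l (central_diff h) f) <= Om)%E) ->
  (dyadic_norm p (fun j => (dyadic_weight l t j * alpha a b j)%R) <= K%:E * Om)%E.
Proof.
move=> p1 C00; have p0 : 0 < p by exact: lt_trans p1.
have [C Cpos HC] := hardy_dyadic p p1.
have [D D0 HD] := dyadic_norm_annulus_L1 p p1.
pose c3 := 32 * l%:R * C0 * 2 ^+ s.+1.
have c30 : 0 <= c3 by rewrite !mulr_ge0// exprn_ge0.
pose T := 2 `^ p; have T0 : 0 < T by rewrite powR_gt0.
(* Chosen so that d <= 1/y gives C T^2 d^p <= 1/2. T is the constant of the quasi-triangle
   inequality for dyadic norms, used twice because x below has three terms. *)
pose y := (2 * (C * T * T)) `^ p^-1.
have y0 : 0 < y by rewrite powR_gt0// !mulr_gt0.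
have [M sM HM] : exists2 M, (s < M)%N & c3 * y <= 2 ^+ M.
  exists (maxn s.+1 (Num.bound (c3 * y))); first by rewrite leq_maxl.
  have q0 : 0 <= c3 * y by rewrite mulr_ge0// ltW.
  apply: le_trans (ltW (archi_boundP q0)) _.
  by rewrite -natrX ler_nat (leq_trans (ltnW (ltn_expl _ (isT : 1 < 2)%N)))// leq_exp2l// leq_maxr.
have M0 : 0 < 2 ^+ M :> R by rewrite exprn_gt0.
pose c1 : R := (4 * 2 ^+ M) ^+ l * 128.
have c10 : 0 <= c1 by rewrite mulr_ge0// exprn_ge0// mulr_ge0// ltW.
pose d := c3 / 2 ^+ M.
have d0 : 0 <= d by rewrite divr_ge0// ltW.
have dsmall : C * T * T * d `^ p <= 2^-1.
  have : d `^ p <= (y^-1) `^ p.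
    rewrite ge0_ler_powR ?nnegrE ?(ltW p0) ?invr_ge0 ?(ltW y0)//.
    by rewrite /d ler_pdivrMr// mulrC ler_pdivlMr.
  have -> : y^-1 `^ p = (2 * (C * T * T))^-1.
    have Y0 : 0 <= 2 * (C * T * T) by rewrite !mulr_ge0// ltW.
    have yp : y `^ p = 2 * (C * T * T) by rewrite /y -powRrM mulVf ?gt_eqF// powRr1.
    by rewrite -(powR_inv1 (ltW y0)) powRAC yp powR_inv1.
  have X0 : 0 < C * T * T by rewrite !mulr_gt0.
  move=> H; apply: le_trans (ler_wpM2l (ltW X0) H) _.
  by rewrite invfM mulrCA divff ?gt_eqF// mulr1.
pose Q := (2 `^ p * 2) ^+ l.
have Q0 : 0 <= Q by rewrite exprn_ge0// mulr_ge0// powR_ge0.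
pose A := C * T * T * (c1 `^ p * D + 128 `^ p * (D * Q)).
have A0 : 0 <= A by rewrite !mulr_ge0 ?addr_ge0 ?mulr_ge0 ?powR_ge0// ltW.
exists (2 * A + 1); first by rewrite ltr_wpDl// mulr_ge0.
move=> f a b v t Om fp fc a0 b0 vv t01 HOm; have /andP[t0 t1] := t01.
have e0 k : (0 < k)%N -> 0 <= a k + b k by move=> k0; rewrite addr_ge0 ?a0 ?b0.
have al0 i : 0 <= alpha a b i by exact: dyadic_avg_ge0.
have w0 i : 0 <= dyadic_weight l t i by exact: dyadic_weight_ge0.
pose g j := dyadic_weight l t j * alpha a b j.
have g0 j : 0 <= g j by rewrite mulr_ge0.
pose u1 := iter l (central_diff (t / 2 ^+ M)) f.
pose u2 := iter (l + l) (central_diff t) f.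
have u1p : circle_Lp p u1 by exact: circle_Lp_iter_central_diff (ltW p0) fp.
have u2p : circle_Lp p u2 by exact: circle_Lp_iter_central_diff (ltW p0) fp.
have Om0 : (0 <= Om)%E.
  apply: le_trans (HOm 0 _); last by rewrite normr0 ltW.
  by apply: integral_ge0 => x _; rewrite lee_fin powR_ge0.
have L1 : (dyadic_norm p (annulus_L1 u1) <= D%:E * Om)%E.
  have [m1 _ _] := u1p; apply: (le_trans (HD _ m1 (circle_Lp_L1 _ _ p1 u1p))).
  apply: lee_wpmul2l; first by rewrite lee_fin ltW.
  have h0 : 0 < t / 2 ^+ M by rewrite divr_gt0.
  apply: HOm; rewrite (gtr0_norm h0).
  by rewrite ler_pdivrMr// ler_peMr ?(ltW t0)// exprn_ege1// ler1n.
(* A difference of order 2l is an l-th difference of an l-th difference, so doubling the order costs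
   only the factor Q. *)
have L2 : (dyadic_norm p (annulus_L1 u2) <= (D * Q)%:E * Om)%E.
  have [m1 _ _] := u2p; apply: (le_trans (HD _ m1 (circle_Lp_L1 _ _ p1 u2p))).
  rewrite EFinM -muleA; apply: lee_wpmul2l; first by rewrite lee_fin ltW.
  have fpl := circle_Lp_iter_central_diff p t l f (ltW p0) fp.
  rewrite /u2 iterD; apply: (le_trans (Lp_integral_iter_central_diff p t l _ (ltW p0) fpl)).
  by apply: lee_wpmul2l; [rewrite lee_fin|apply: HOm; rewrite gtr0_norm].
pose x i := (c1 * annulus_L1 u1 i + 128 * annulus_L1 u2 i) + d * g i.
have U0 u i := @annulus_L1_ge0 R u i.
have x10 i : 0 <= c1 * annulus_L1 u1 i by rewrite mulr_ge0.
have x20 i : 0 <= 128 * annulus_L1 u2 i by rewrite mulr_ge0.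
have x30 i : 0 <= d * g i by rewrite mulr_ge0.
have x0 i : 0 <= x i by rewrite !addr_ge0.
have E1 : (dyadic_norm p g <= C%:E * dyadic_norm p x)%E.
  apply: HC => // j.
  have LH : ((g j)%:E <= c1%:E * kernel_sum u1 j + 128%:E * kernel_sum u2 j +
      d%:E * \sum_(i <oo) (dyadic_kernel i j * g i)%:E)%E.
    exact: low_high_bound p f a b v s l M j C0 t p1 fp fc a0 b0 vv C00 t01 sM.
  apply: (le_trans LH); rewrite /kernel_sum.
  have k0 i : 0 <= dyadic_kernel i j :> R by exact: dyadic_kernel_ge0.
  have kZ (c : R) (z : nat -> R) : 0 <= c -> (forall i, 0 <= z i) ->
      (c%:E * \sum_(i <oo) (dyadic_kernel i j * z i)%:E =
       \sum_(i <oo) (dyadic_kernel i j * (c * z i))%:E)%E.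
    move=> c0 z0; rewrite -nneseriesZl => [|i _]; last by rewrite lee_fin mulr_ge0.
    by apply: eq_eseriesr => i _; rewrite -EFinM mulrCA.
  have kD (z1 z2 : nat -> R) : (forall i, 0 <= z1 i) -> (forall i, 0 <= z2 i) ->
      (\sum_(i <oo) (dyadic_kernel i j * z1 i)%:E + \sum_(i <oo) (dyadic_kernel i j * z2 i)%:E =
       \sum_(i <oo) (dyadic_kernel i j * (z1 i + z2 i)%R)%:E)%E.
    move=> z10 z20; rewrite -nneseriesD => [|i _ _|i _ _]; try by rewrite lee_fin mulr_ge0.
    by apply: eq_eseriesr => i _; rewrite -EFinD -mulrDr.
  rewrite (kZ c1 _ c10 (U0 u1)) (kZ 128 _ (ler0n _ _) (U0 u2)) (kZ d g d0 g0).
  by rewrite (kD _ _ x10 x20) (kD _ _ _ x30)// => i; rewrite addr_ge0.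
have E2 : (dyadic_norm p x <= (T * T)%:E *
    ((c1 `^ p * D + 128 `^ p * (D * Q))%:E * Om + (d `^ p)%:E * dyadic_norm p g))%E.
  have n0 z : (0 <= dyadic_norm p z)%E by exact: dyadic_norm_ge0.
  apply: (@le_trans _ _ (T%:E * (T%:E * ((c1 `^ p)%:E * dyadic_norm p (annulus_L1 u1) +
      (128 `^ p)%:E * dyadic_norm p (annulus_L1 u2)) + T%:E * ((d `^ p)%:E * dyadic_norm p g)))%E).
    apply: (le_trans (dyadic_normD_le p p1 _ _ _ x30)); first by move=> j; rewrite addr_ge0.
    apply: lee_wpmul2l; first by rewrite lee_fin ltW.
    apply: leeD.
      by apply: (le_trans (dyadic_normD_le p p1 _ _ x10 x20)); rewrite !dyadic_normZ.
    rewrite dyadic_normZ// -[leLHS]mul1e; apply: lee_wpmul2r.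
      by rewrite mule_ge0 ?lee_fin ?powR_ge0.
    by rewrite lee_fin -(powRr0 2) ler_powR ?ler1n// ltW.
  rewrite -ge0_muleDr; last 2 first.
  - by rewrite adde_ge0 ?mule_ge0 ?lee_fin ?powR_ge0.
  - by rewrite mule_ge0 ?lee_fin ?powR_ge0.
  rewrite muleA -EFinM; apply: lee_wpmul2l; first by rewrite lee_fin mulr_ge0 ?ltW.
  rewrite leeD2r//.
  have q1 : (0 <= (c1 `^ p * D)%:E)%E by rewrite lee_fin mulr_ge0 ?powR_ge0// ltW.
  have DQ0 : 0 <= D * Q by rewrite mulr_ge0// ltW.
  have q2 : (0 <= (128 `^ p * (D * Q))%:E)%E by rewrite lee_fin mulr_ge0 ?powR_ge0.
  rewrite EFinD (ge0_muleDl _ q1 q2).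
  apply: leeD.
    rewrite [in leRHS]EFinM -muleA; apply: lee_wpmul2l => //.
    by rewrite lee_fin powR_ge0.
  by rewrite [in leRHS]EFinM -muleA; apply: lee_wpmul2l.
have gfin : (dyadic_norm p g < +oo)%E.
  apply: le_lt_trans (dyadic_norm_avg_fin p f a b p1 fp fc a0 b0).
  by apply: le_dyadic_norm => // j; rewrite /g ler_piMl// dyadic_weight_le1.
have gE : dyadic_norm p g \is a fin_num by rewrite ge0_fin_numE// dyadic_norm_ge0.
case: Om Om0 HOm L1 L2 E2 => [om||]//= om0 _ _ _ E2; last first.
  by rewrite gt0_muley ?leey// lte_fin ltr_wpDl// mulr_ge0.
have := le_trans E1 (lee_wpmul2l _ E2); rewrite lee_fin (ltW Cpos) => /(_ isT).
rewrite -(fineK gE); set G := fine _ => H.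
have G0 : 0 <= G by apply: fine_ge0; exact: dyadic_norm_ge0.
move: H; rewrite -!EFinM lee_fin => H.
have H2 : G <= A * om + (C * T * T * d `^ p) * G.
  by apply: (le_trans H); rewrite le_eqVlt; apply/orP; left; apply/eqP; rewrite /A; ring.
have := ler_wpM2r G0 dsmall; move: om0; rewrite lee_fin => om0.
rewrite -?EFinM lee_fin; move: H2; set q := C * T * T * _ * G => H2 H3.
have -> : (2 * A + 1) * om = 2 * (A * om) + om by rewrite mulrDl mul1r mulrA.
lra.
Qed.

End lower_theorem.

(** * Upper bound for the modulus of smoothness *)

Section upper_bound.
Context {R : realType}.
Implicit Types (u f : R -> R) (a b g y v : nat -> R) (p h t : R).

Lemma dyadic_kernel_ge i m : (i <= m)%N -> dyadic_kernel m i = 1 :> R.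
Proof.
move=> im; rewrite /dyadic_kernel min_l// ler_pdivlMr ?exprn_gt0// mul1r.
by rewrite ler_weXn2l// ler1n.
Qed.

Lemma dyadic_kernel_lt i m : (m < i)%N -> 2 ^+ i * dyadic_kernel m i = 2 ^+ m :> R.
Proof.
move=> mi; have i0 : 0 < 2 ^+ i :> R by rewrite exprn_gt0.
rewrite /dyadic_kernel min_r; first by rewrite mulrCA divff ?gt_eqF// mulr1.
by rewrite ler_pdivrMr// mul1r ler_weXn2l ?ler1n// ltnW.
Qed.

(** The right end 2^(m + 1) is included because summation by parts up to K leaves the value of g at
    K, which may be that end of the last block. *)
Definition block_bounded (J K : nat) g y := forall m, (J <= m)%N -> (2 ^ m < K)%N ->
  (forall k, (2 ^ m <= k <= 2 ^ m.+1)%N -> `|g k| <= y m) /\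
  \sum_(2 ^ m <= k < 2 ^ m.+1) `|g k - g k.+1| <= y m.

(** Blocks m < i lie below frequency 2^i, where counting gives 2^m y_m = 2^i times kernel times y_m.
    Beyond, summation by parts with partial sums at most 8 * 2^i costs the end value and the
    variation. Together 1 + 2 * 8 = 17. *)
Lemma cos_sum_annulus_le g y th x i J K : (forall m, 0 <= y m) ->
  block_bounded J K g y -> annulus i x ->
  (`|\sum_(2 ^ J <= k < K) g k * cos (th + k%:R * x)|%:E <=
   (17 * 2 ^+ i)%:E * \sum_(m <oo) (dyadic_kernel m i * y m)%:E)%E.
Proof.
move=> y0 gy Ax; have i0 : 0 < 2 ^+ i :> R by rewrite exprn_gt0.
have ky0 m : 0 <= dyadic_kernel m i * y m by rewrite mulr_ge0// dyadic_kernel_ge0.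
have [KJ|JK] := leqP K (2 ^ J).
  rewrite big_geq// normr0; apply: mule_ge0; first by rewrite lee_fin mulr_ge0// ltW.
  by apply: nneseries_ge0 => m _ _; rewrite lee_fin.
have K1 : (0 < K.-1)%N by rewrite -ltnS (ltn_predK JK) (leq_ltn_trans _ JK)// expn_gt0.
(* M is the block of the last frequency K - 1, not of K. *)
have [M /andP[MK KM]] : exists M, (2 ^ M < K <= 2 ^ M.+1)%N.
  exists (trunc_log 2 K.-1); have /andP[l1 l2] := trunc_log_bounds (isT : 1 < 2)%N K1.
  apply/andP; split; first by rewrite -[ltnRHS](ltn_predK JK) ltnS.
  by rewrite -[X in (X <= _)%N](ltn_predK JK).
have JM : (J <= M)%N by rewrite -ltnS -(@ltn_exp2l 2)// (leq_trans JK).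
pose S := \sum_(J <= m < M.+1) dyadic_kernel m i * y m.
suff H : `|\sum_(2 ^ J <= k < K) g k * cos (th + k%:R * x)| <= 17 * 2 ^+ i * S.
  apply: (@le_trans _ _ ((17 * 2 ^+ i)%:E * S%:E)%E); first by rewrite -EFinM lee_fin.
  apply: lee_wpmul2l; first by rewrite lee_fin mulr_ge0// ltW.
  apply: (@le_trans _ _ (\sum_(0 <= m < M.+1) (dyadic_kernel m i * y m)%:E)%E).
    by rewrite sumEFin lee_fin /S (big_cat_nat (n := J) (m := 0%N))//= ?(leqW JM)// lerDr sumr_ge0.
  by apply: nneseries_lim_ge => m _ _; rewrite lee_fin.
have inK m : (m <= M)%N -> (2 ^ m < K)%N.
  by move=> mM; rewrite (leq_ltn_trans _ MK)// leq_exp2l.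
pose q := maxn J i; pose Q := minn (2 ^ q) K.
have JQ : (2 ^ J <= Q)%N by rewrite /Q leq_min leq_exp2l// leq_maxl ltnW.
rewrite (big_cat_nat (n := Q))//= ?geq_minr//.
have low : `|\sum_(2 ^ J <= k < Q) g k * cos (th + k%:R * x)| <= 2 ^+ i * S.
  apply: (le_trans (ler_norm_sum _ _ _)).
  pose q' := minn q M.+1.
  have Jq' : (J <= q')%N by rewrite /q' leq_min leq_maxl (leqW JM).
  have Qq' : (Q <= 2 ^ q')%N.
    rewrite /Q /q'; case: (leqP q M.+1) => _; first by rewrite geq_minl.
    by rewrite (leq_trans (geq_minr _ _)).
  apply: (@le_trans _ _ (\sum_(2 ^ J <= k < 2 ^ q') `|g k|)).
    apply: (@le_trans _ _ (\sum_(2 ^ J <= k < Q) `|g k|)).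
      by apply: ler_sum => k _; rewrite normrM ler_piMr// cos_max.
    by rewrite [leRHS](big_cat_nat (n := Q))//= lerDl sumr_ge0.
  rewrite big_dyadic_blocks// mulr_sumr [leRHS](big_cat_nat (n := q'))//= ?geq_minr//.
  rewrite -[leLHS]addr0 lerD//; last by apply: sumr_ge0 => m _; rewrite mulr_ge0// ltW.
  rewrite big_nat [leRHS]big_nat; apply: ler_sum => m /andP[Jm].
  rewrite /q' leq_min => /andP[mq mM].
  have mi : (m < i)%N by move: mq; rewrite /q leq_max ltnNge Jm.
  rewrite mulrA dyadic_kernel_lt//.
  apply: (@le_trans _ _ (\sum_(2 ^ m <= k < 2 ^ m.+1) y m)).
    rewrite big_nat [leRHS]big_nat; apply: ler_sum => k /andP[k1 k2].
    by have [+ _] := gy m Jm (inK m mM); apply; rewrite k1 ltnW.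
  by rewrite sumr_const_nat expnS mul2n -addnn addnK -[leLHS]mulr_natl natrX.
have high : `|\sum_(Q <= k < K) g k * cos (th + k%:R * x)| <= 8 * 2 ^+ i * (2 * S).
  have S0 : 0 <= S by apply: sumr_ge0.
  have [Kq|qK] := leqP K (2 ^ q).
    rewrite big_geq; last by rewrite /Q (minn_idPr Kq).
    by rewrite normr0 !mulr_ge0// ltW.
  have qM : (q <= M)%N by rewrite -ltnS -(@ltn_exp2l 2)// (leq_trans qK).
  have iq : (i <= q)%N by rewrite leq_maxr.
  have Jq : (J <= q)%N by rewrite leq_maxl.
  rewrite /Q (minn_idPl (ltnW qK)).
  apply: le_trans (abel_sum_le g _ (8 * 2 ^+ i) _ _ (ltnW qK) _) _.
    move=> k; have := sin_half_sum_cos_le th x (2 ^ q) k.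
    set T := `|\sum_(_ <= _ < _) _| => H1.
    have := sin_half_annulus x i Ax; set s := `|sin _| in H1 * => H2.
    have T0 : 0 <= T by exact: normr_ge0.
    rewrite -[leLHS]mul1r; apply: (le_trans (ler_wpM2r T0 H2)).
    by rewrite -[leLHS]mulrA -[leRHS]mulr1 ler_wpM2l// mulr_ge0// ltW.
  rewrite ler_wpM2l//.
  have tS : \sum_(q <= m < M.+1) y m <= S.
    rewrite /S [leRHS](big_cat_nat (n := q))//= ?(leqW qM)//.
    rewrite -[leLHS]add0r lerD ?sumr_ge0// big_nat [leRHS]big_nat.
    by apply: ler_sum => m /andP[qm _]; rewrite dyadic_kernel_ge ?mul1r// (leq_trans iq).
  have -> : 2 * S = S + S by ring.
  apply: lerD.
    have [+ _] := gy M JM MK => /(_ K); rewrite KM (ltnW MK) => /(_ isT) H.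
    by apply: (le_trans H); apply: le_trans tS; rewrite big_nat_recr//= lerDr sumr_ge0.
  apply: le_trans tS.
  apply: (@le_trans _ _ (\sum_(2 ^ q <= k < 2 ^ M.+1) `|g k - g k.+1|)).
    by rewrite [leRHS](big_cat_nat (n := K))//= ?(ltnW qK)// lerDl sumr_ge0.
  rewrite big_dyadic_blocks ?(leqW qM)// big_nat [leRHS]big_nat.
  apply: ler_sum => m /andP[qm mM].
  by have [_ ] := gy m (leq_trans Jq qm) (inK m mM).
apply: (le_trans (ler_normD _ _)); apply: (le_trans (lerD low high)).
by rewrite le_eqVlt; apply/orP; left; apply/eqP; ring.
Qed.

(** The phase [th] keeps these sums closed under central differences, each of which multiplies the
    coefficients and advances the phase by pi/2. *)
Definition trig_sum a b th (J K : nat) x : R :=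
  \sum_(2 ^ J <= k < K) (a k * cos (th + k%:R * x) + b k * sin (th + k%:R * x)).

Lemma trig_sum_annulus_le a b y th x i J K : (forall m, 0 <= y m) ->
  block_bounded J K a y -> block_bounded J K b y -> annulus i x ->
  (`|trig_sum a b th J K x|%:E <=
   (34 * 2 ^+ i)%:E * \sum_(m <oo) (dyadic_kernel m i * y m)%:E)%E.
Proof.
move=> y0 ay by_ Ax; rewrite /trig_sum big_split/=.
have -> : \sum_(2 ^ J <= k < K) b k * sin (th + k%:R * x) =
    \sum_(2 ^ J <= k < K) b k * cos ((th - pi / 2) + k%:R * x).
  by apply: eq_bigr => k _; rewrite -cosBpihalf; congr (_ * cos _); ring.
have H1 := cos_sum_annulus_le a y th x i J K y0 ay Ax.
have H2 := cos_sum_annulus_le b y (th - pi / 2) x i J K y0 by_ Ax.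
move: H1 H2; set A := \sum_(_ <= _ < _) _; set B := \sum_(_ <= _ < _) _ => H1 H2.
apply: (@le_trans _ _ (`|A|%:E + `|B|%:E)%E); first by rewrite -EFinD lee_fin ler_normD.
apply: (le_trans (leeD H1 H2)).
rewrite -ge0_muleDl ?lee_fin ?mulr_ge0 ?exprn_ge0// -EFinD.
by have -> : 17 * 2 ^+ i + 17 * 2 ^+ i = 34 * 2 ^+ i :> R by ring.
Qed.

Lemma Lp_integral_block_le p : 1 < p -> exists2 C : R, 0 < C & forall u y,
  measurable_fun setT u -> (forall m, 0 <= y m) ->
  {ae circle_measure R, forall x, forall i, annulus i x ->
     (`|u x|%:E <= (34 * 2 ^+ i)%:E * \sum_(m <oo) (dyadic_kernel m i * y m)%:E)%E} ->
  (Lp_integral p u <= C%:E * dyadic_norm p y)%E.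
Proof.
move=> p1; have [C C0 HC] := hardy_dyadic_scaled p p1.
have pi2 : 0 < (pi : R) *+ 2 by rewrite mulrn_wgt0// pi_gt0.
have k0 : 0 < 34 `^ p * C by rewrite mulr_gt0 ?powR_gt0.
exists (pi *+ 2 * (34 `^ p * C)); first by rewrite mulr_gt0.
move=> u y mu_ y0 uy.
have := dyadic_norm_ge0 p y; rewrite le_eqVlt => /orP; have [yoo|] := ltP (dyadic_norm p y) +oo%E; last first.
  by rewrite leye_eq => /eqP -> _; rewrite gt0_muley ?leey// lte_fin mulr_gt0.
move=> _.
have ky0 i m : (0 <= (dyadic_kernel m i * y m)%:E)%E by rewrite lee_fin mulr_ge0// dyadic_kernel_ge0.
pose z i := fine (\sum_(m <oo) (dyadic_kernel m i * y m)%:E)%E.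
have zE i : (z i)%:E = (\sum_(m <oo) (dyadic_kernel m i * y m)%:E)%E.
  rewrite fineK// ge0_fin_numE; last exact: nneseries_ge0.
  exact: dyadic_norm_fin p p1 y i y0 yoo.
have z0 i : 0 <= z i by apply: fine_ge0; apply: nneseries_ge0.
apply: (@le_trans _ _ ((pi *+ 2)%:E * dyadic_norm p (fun i => (34 * z i)%R))%E).
  apply: Lp_integral_annulus_le => // [i|]; first by rewrite mulr_ge0.
  apply: ae_circleS uy => x H i Ax; have := H i Ax.
  by rewrite -zE -EFinM lee_fin => /le_trans; apply; rewrite mulrCA mulrA.
rewrite EFinM -muleA; apply: lee_wpmul2l; first by rewrite lee_fin ltW.
by apply: HC => // [i|j]; [rewrite mulr_ge0|rewrite EFinM zE].
Qed.

End upper_bound.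

(** * The upper bound: differences of partial sums, and the remainder *)

Section upper_theorem.
Context {R : realType}.
Implicit Types (u f : R -> R) (a b g y v : nat -> R) (p h t : R).

Definition diff_multiplier h (k : nat) : R := 2 * sin (k%:R * h / 2).

Lemma central_diff_trig_sum h a b th J K :
  central_diff h (trig_sum a b th J K) =
  trig_sum (fun k => diff_multiplier h k * a k) (fun k => diff_multiplier h k * b k)
    (th + pi / 2) J K.
Proof.
apply/funext => x; rewrite /central_diff /trig_sum -sumrB; apply: eq_bigr => k _.
rewrite /diff_multiplier; set B := k%:R * h / 2; set A := th + k%:R * x.
have -> : th + k%:R * (x + h / 2) = A + B by rewrite /A /B; ring.
have -> : th + k%:R * (x - h / 2) = A - B by rewrite /A /B; ring.
have -> : th + pi / 2 + k%:R * x = A + pi / 2 by rewrite /A; ring.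
move: A B => A B; rewrite !cosD !sinD cosN sinN.
by rewrite cos_pihalf sin_pihalf; ring.
Qed.

Lemma iter_central_diff_trig_sum h l a b th J K :
  iter l (central_diff h) (trig_sum a b th J K) =
  trig_sum (fun k => diff_multiplier h k ^+ l * a k)
    (fun k => diff_multiplier h k ^+ l * b k) (th + l%:R * (pi / 2)) J K.
Proof.
elim: l => [|l IH].
  rewrite mul0r addr0/=; congr trig_sum; apply/funext => k; by rewrite expr0 mul1r.
rewrite iterS IH central_diff_trig_sum; congr trig_sum.
- by apply/funext => k; rewrite exprS mulrA.
- by apply/funext => k; rewrite exprS mulrA.
- by rewrite -[X in _ = _ + X * _]natr1; ring.
Qed.

Lemma iter_central_diffB h l u f :
  iter l (central_diff h) (fun x => u x - f x) =
  (fun x => iter l (central_diff h) u x - iter l (central_diff h) f x).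
Proof.
elim: l => //= l ->; move: (iter l _ u) (iter l _ f) => {}u {}f.
by apply/funext => x; rewrite /central_diff; ring.
Qed.

Lemma norm_diff_multiplier_le h k : `|diff_multiplier h k| <= k%:R * `|h|.
Proof.
rewrite /diff_multiplier normrM ger0_norm//.
apply: (le_trans (ler_wpM2l _ (norm_sin_le _))) => //.
rewrite !normrM (ger0_norm (ler0n _ k)) [`|2^-1|]ger0_norm//.
by rewrite mulrC divfK.
Qed.

Lemma norm_diff_multiplierB_le h k :
  `|diff_multiplier h k - diff_multiplier h k.+1| <= `|h|.
Proof.
rewrite /diff_multiplier -mulrBr; set A := (k%:R + 2^-1) * h / 2; pose B := h / 4.
have -> : k%:R * h / 2 = A - B by rewrite /A /B; field.
have -> : k.+1%:R * h / 2 = A + B by rewrite /A /B -natr1; field.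
rewrite sinB sinD.
have -> : 2 * (sin A * cos B - cos A * sin B - (sin A * cos B + cos A * sin B)) =
  - (4 * (cos A * sin B)) by ring.
rewrite normrN normrM ger0_norm// normrM.
apply: (@le_trans _ _ (4 * (1 * `|B|))).
  by rewrite ler_wpM2l// ler_pM// ?cos_max// norm_sin_le.
by rewrite mul1r /B normrM [X in _ * (_ * X)]ger0_norm// mulrCA divff// mulr1.
Qed.

(** The factor M on the left avoids the exponent l - 1, so that l = 0 needs no separate
    treatment. *)
Lemma norm_subrX_le (x z M : R) l : `|x| <= M -> `|z| <= M ->
  M * `|x ^+ l - z ^+ l| <= l%:R * M ^+ l * `|x - z|.
Proof.
move=> xM zM; have M0 : 0 <= M by apply: le_trans xM.
elim: l => [|l IH]; first by rewrite !expr0 subrr normr0 mulr0 !mul0r.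
have -> : x ^+ l.+1 - z ^+ l.+1 = x * (x ^+ l - z ^+ l) + (x - z) * z ^+ l.
  by rewrite !exprS; ring.
apply: (le_trans (ler_wpM2l M0 (ler_normD _ _))); rewrite !normrM mulrDr.
have H1 : M * (`|x| * `|x ^+ l - z ^+ l|) <= M * (l%:R * M ^+ l * `|x - z|).
  rewrite mulrCA; apply: (le_trans (ler_wpM2r _ xM)); first by rewrite mulr_ge0.
  by rewrite ler_wpM2l.
have H2 : M * (`|x - z| * `|z ^+ l|) <= M * (`|x - z| * M ^+ l).
  by rewrite ler_wpM2l// ler_wpM2l// normrX lerXn2r ?nnegrE.
apply: (le_trans (lerD H1 H2)); rewrite le_eqVlt; apply/orP; left; apply/eqP.
by rewrite exprS -natr1; ring.
Qed.

(** On block m the multiplier is at most M = 2 * 2^m t and changes by at most t per step. By the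
    product rule the variation is at most M^l v_m from that of a, plus l M^l v_m from the 2^m
    changes of the multiplier; below J, M^l is 2^l times the weight. *)
Lemma block_bounded_multiplier h t l J a v : 0 < t -> `|h| <= t ->
  (forall m, (m < J)%N -> 2 ^+ m * t <= 1) ->
  (forall j, 0 <= v j) -> (forall k, (0 < k)%N -> 0 <= a k) ->
  (forall j k, (2 ^ j <= k)%N -> a k <= v j) ->
  (forall j, \sum_(2 ^ j <= k < 2 ^ j.+1) `|a k - a k.+1| <= v j) ->
  block_bounded 0 (2 ^ J) (fun k => diff_multiplier h k ^+ l * a k)
    (fun j => l.+1%:R * 2 ^+ l * (dyadic_weight l t j * v j)).
Proof.
move=> t0 ht Jt v0 a0 av Va m _; rewrite ltn_exp2l// => mJ.
set M := 2 * (2 ^+ m * t).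
have m0 : 0 < 2 ^+ m :> R by rewrite exprn_gt0.
have M0 : 0 < M by rewrite !mulr_gt0.
have -> : l.+1%:R * 2 ^+ l * (dyadic_weight l t m * v m) = M ^+ l * v m + l%:R * M ^+ l * v m.
  by rewrite /dyadic_weight (min_idPr (Jt m mJ)) /M !exprMn -(natr1 l); ring.
have sM k : (k <= 2 ^ m.+1)%N -> `|diff_multiplier h k| <= M.
  move=> km; apply: (le_trans (norm_diff_multiplier_le h k)).
  rewrite /M mulrA -exprS; apply: ler_pM => //.
  by rewrite -natrX ler_nat.
have bd k : (2 ^ m <= k <= 2 ^ m.+1)%N -> `|diff_multiplier h k ^+ l * a k| <= M ^+ l * v m.
  move=> /andP[mk km]; have k0 : (0 < k)%N by rewrite (leq_trans _ mk)// expn_gt0.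
  rewrite normrM normrX [`|a k|]ger0_norm ?a0//; apply: ler_pM; rewrite ?exprn_ge0 ?a0 ?av//.
  by rewrite lerXn2r ?nnegrE ?(ltW M0)// sM.
split=> [k kk|].
  by rewrite (le_trans (bd k kk))// lerDl !mulr_ge0 ?exprn_ge0// ltW.
pose V k := M ^+ l * `|a k - a k.+1| + l%:R * M ^+ l * v m / 2 ^+ m.
apply: (@le_trans _ _ (\sum_(2 ^ m <= k < 2 ^ m.+1) V k)); last first.
  rewrite big_split/= -mulr_sumr lerD//.
    by rewrite ler_wpM2l ?exprn_ge0// ltW.
  rewrite sumr_const_nat expnS mul2n -addnn addnK -[leLHS]mulr_natr natrX.
  by rewrite mulfVK// gt_eqF.
rewrite big_nat [leRHS]big_nat; apply: ler_sum => k /andP[mk km].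
set s := diff_multiplier h.
have k0 : (0 < k)%N by rewrite (leq_trans _ mk)// expn_gt0.
have -> : s k ^+ l * a k - s k.+1 ^+ l * a k.+1 =
    s k ^+ l * (a k - a k.+1) + (s k ^+ l - s k.+1 ^+ l) * a k.+1 by ring.
apply: (le_trans (ler_normD _ _)); rewrite /V lerD// normrM.
  by rewrite ler_wpM2r// normrX lerXn2r ?nnegrE ?(ltW M0)// sM// ltnW.
have H := norm_subrX_le (s k) (s k.+1) M l (sM k (ltnW km)) (sM k.+1 km).
have d1 : `|s k - s k.+1| <= t by apply: le_trans ht; exact: norm_diff_multiplierB_le.
have lM0 : 0 <= l%:R * M ^+ l by rewrite mulr_ge0// exprn_ge0// ltW.
have H2 : `|s k ^+ l - s k.+1 ^+ l| <= l%:R * M ^+ l / 2 ^+ m.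
  rewrite -(ler_pM2l M0); apply: (le_trans H); apply: (le_trans (ler_wpM2l lM0 d1)).
  have -> : M * (l%:R * M ^+ l / 2 ^+ m) = l%:R * M ^+ l * (2 * t).
    by rewrite /M; field; rewrite gt_eqF.
  by rewrite ler_wpM2l// ler_peMl ?ler1n// ltW.
rewrite [leRHS]mulrAC [`|a k.+1|]ger0_norm ?a0//.
apply: ler_pM; rewrite ?a0//; apply: av; exact: leqW.
Qed.

Lemma measurable_trig_sum a b th J K : measurable_fun setT (trig_sum a b th J K).
Proof.
rewrite /trig_sum.
have -> : (fun x : R => \sum_(2 ^ J <= k < K) (a k * cos (th + k%:R * x) + b k * sin (th + k%:R * x))) =
   (fun x => \sum_(2 ^ J <= k < K)
      (a k * cos (th + k%:R * x) + b k * cos ((th - pi / 2) + k%:R * x))).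
  apply/funext => x; apply: eq_bigr => k _; congr (_ + _ * _).
  by rewrite -cosBpihalf; congr cos; ring.
apply: measurable_sum => k.
by apply: measurable_funD; apply: measurable_funM => //; exact: measurable_cos_affine.
Qed.

Lemma periodic_trig_sum a b th J K : periodic (trig_sum a b th J K) (pi *+ 2).
Proof.
move=> x; apply: eq_bigr => k _; rewrite periodic_cos_affine; congr (_ + _ * _).
rewrite -!cosBpihalf.
have E (z : R) : th + k%:R * z - pi / 2 = (th - pi / 2) + k%:R * z by ring.
by rewrite !E periodic_cos_affine.
Qed.

Lemma fourier_partial_sumE f a b K x : fourier_coeffs f a b ->
  fourier_partial_sum f K x = \sum_(1 <= k < K) (a k * cos (0 + k%:R * x) + b k * sin (0 + k%:R * x)).
Proof.
move=> fc; rewrite /fourier_partial_sum big_nat [RHS]big_nat.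
apply: eq_bigr => k /andP[k0 _]; have [<- <-] := fc k k0.
have pi0 : pi != 0 :> R by rewrite gt_eqF// pi_gt0.
by rewrite !add0r !(mulrA pi^-1) mulVf// !mul1r.
Qed.

(* f is split at frequency [2 ^ J ~ 1 / t]. The difference of the partial sum S is
   estimated through its multiplier; the remainder is bounded pointwise a.e. by
   the sup of the partial sums of its Fourier series. *)
Lemma upper_bound_core p l : 1 < p ->
  exists2 C : R, 0 < C & forall f a b v s C0 t h,
  circle_Lp p f -> \int[circle_measure R]_x f x = 0 -> fourier_coeffs f a b ->
  (forall k, (0 < k)%N -> 0 <= a k) -> (forall k, (0 < k)%N -> 0 <= b k) ->
  dyadic_variation s C0 a b v -> 0 < t -> `|h| <= t ->
  (Lp_integral p (iter l (central_diff h) f) <=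
   C%:E * dyadic_norm p (fun j => (dyadic_weight l t j * v j)%R))%E.
Proof.
move=> p1; have p0 : 0 < p by exact: lt_trans p1.
have [C C0 HC] := Lp_integral_block_le p p1.
pose c : R := l.+1%:R * 2 ^+ l.
have c0 : 0 < c by rewrite mulr_gt0 ?exprn_gt0.
pose Q : R := (2 `^ p * 2) ^+ l.
have Q0 : 0 < Q by rewrite exprn_gt0// mulr_gt0 ?powR_gt0.
exists (2 `^ p * (C * c `^ p + Q * C)).
  by rewrite !(mulr_gt0, addr_gt0) ?powR_gt0.
move=> f a b v s C0' t h fp f0 fc a0 b0 [v0 V1 V2 _] t0 ht.
have [mf pf ff] := fp.
set W := dyadic_norm p _.
have [Woo|] := ltP W +oo%E; last first.
  by rewrite leye_eq => /eqP ->; rewrite gt0_muley ?leey// lte_fin !(mulr_gt0, addr_gt0) ?powR_gt0.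
have exJ : exists J, 1 <= 2 ^+ J * t.
  exists (Num.bound t^-1); rewrite -ler_pdivrMr// div1r.
  apply: le_trans (ltW (archi_boundP _)) _; first by rewrite invr_ge0 ltW.
  by rewrite -natrX ler_nat ltnW// ltn_expl.
(* Minimality of J makes the weight exactly (2^m t)^l below J and 1 from J on. *)
case: (ex_minnP exJ) => J J1 Jmin.
have Jt m : (m < J)%N -> 2 ^+ m * t <= 1.
  by move=> mJ; rewrite leNgt; apply/negP => /ltW /Jmin; rewrite leqNgt mJ.
have wJ m : (J <= m)%N -> dyadic_weight l t m = 1.
  move=> Jm; rewrite /dyadic_weight min_l ?expr1n//; apply: (le_trans J1).
  by rewrite ler_wpM2r ?(ltW t0)// ler_weXn2l// ler1n.
have aV j k : (2 ^ j <= k)%N -> a k <= v j.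
  move=> jk; have k0 : (0 < k)%N by rewrite (leq_trans _ jk)// expn_gt0.
  by apply: le_trans (V2 j k jk); rewrite lerDl b0.
have bV j k : (2 ^ j <= k)%N -> b k <= v j.
  move=> jk; have k0 : (0 < k)%N by rewrite (leq_trans _ jk)// expn_gt0.
  by apply: le_trans (V2 j k jk); rewrite lerDr a0.
have aV1 j : \sum_(2 ^ j <= k < 2 ^ j.+1) `|a k - a k.+1| <= v j.
  by apply: le_trans (V1 j (2 ^ j.+1)%N); apply: ler_sum => k _; rewrite lerDl.
have bV1 j : \sum_(2 ^ j <= k < 2 ^ j.+1) `|b k - b k.+1| <= v j.
  by apply: le_trans (V1 j (2 ^ j.+1)%N); apply: ler_sum => k _; rewrite lerDr.
have w0 j : 0 <= dyadic_weight l t j by exact: dyadic_weight_ge0.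
have wv0 j : 0 <= dyadic_weight l t j * v j by rewrite mulr_ge0.
pose S := trig_sum a b 0 0 (2 ^ J).
have mS : measurable_fun setT S by exact: measurable_trig_sum.
have A1 : (Lp_integral p (iter l (central_diff h) S) <= (C * c `^ p)%:E * W)%E.
  rewrite iter_central_diff_trig_sum EFinM -muleA -dyadic_normZ ?(ltW c0)//.
  have cw m : 0 <= c * (dyadic_weight l t m * v m) by rewrite mulr_ge0// ltW.
  apply: HC => //; first exact: measurable_trig_sum.
  apply: aeW => x i Ax; apply: trig_sum_annulus_le => //.
    exact: block_bounded_multiplier.
  exact: block_bounded_multiplier.
(* The remainder involves only blocks from J on, where the weight is 1, so y is dominated by the
   weighted variation. *)
pose y j := if (J <= j)%N then v j else 0.
have y0 j : 0 <= y j by rewrite /y; case: ifP.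
have tail K x : (2 ^ J <= K)%N -> fourier_partial_sum f K x - S x = trig_sum a b 0 J K x.
  move=> JK; rewrite (fourier_partial_sumE f a b K x fc) /S /trig_sum expn0.
  by rewrite (big_cat_nat (n := 2 ^ J)) ?expn_gt0//= addrAC subrr add0r.
have A2 : (Lp_integral p (fun x => (S x - f x)%R) <= C%:E * W)%E.
  apply: (@le_trans _ _ (C%:E * dyadic_norm p y)%E); last first.
    apply: lee_wpmul2l; first by rewrite lee_fin ltW.
    apply: le_dyadic_norm => // j; rewrite /y; case: ifP => // Jj.
    by rewrite wJ// mul1r.
  have yW : (dyadic_norm p y < +oo)%E.
    apply: le_lt_trans Woo; apply: le_dyadic_norm => // j; rewrite /y; case: ifP => // Jj.
    by rewrite wJ// mul1r.
  apply: HC => //; first exact: measurable_funB.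
  apply: ae_circleS (ae_annulus_lebesgue_pt p f p1 fp) => x lx i Ax.
  have bl g K : (forall j k, (2 ^ j <= k)%N -> `|g k| <= v j) ->
      (forall j, \sum_(2 ^ j <= k < 2 ^ j.+1) `|g k - g k.+1| <= v j) ->
      block_bounded J K g y.
    move=> g1 g2 m Jm _; rewrite /y Jm; split=> // k /andP[mk _]; exact: g1.
  have pk j k : (2 ^ j <= k)%N -> (0 < k)%N.
    by move=> jk; rewrite (leq_trans _ jk)// expn_gt0.
  have ba K : block_bounded J K a y.
    by apply: bl => // j k jk; rewrite ger0_norm ?aV// a0// (pk j).
  have bb K : block_bounded J K b y.
    by apply: bl => // j k jk; rewrite ger0_norm ?bV// b0// (pk j).
  have TB K := trig_sum_annulus_le a b y 0 x i J K y0 (ba K) (bb K) Ax.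
  move: TB; set Z := (_ * _)%E => TB.
  have Zfin : Z \is a fin_num.
    rewrite fin_numM//; rewrite ge0_fin_numE; first exact: dyadic_norm_fin p p1 y i y0 yW.
    by apply: nneseries_ge0 => m _ _; rewrite lee_fin mulr_ge0// dyadic_kernel_ge0.
  rewrite -(fineK Zfin) lee_fin distrC.
  apply: (fourier_partial_sum_bound p f x (S x) _ (2 ^ J) p1 fp f0 lx) => K JK.
  by rewrite tail// -lee_fin (fineK Zfin).
have Sf : circle_Lp p (fun x => S x - f x).
  split; first exact: measurable_funB.
    by move=> x; rewrite pf /S periodic_trig_sum.
  by apply: (le_lt_trans A2); rewrite lte_mul_pinfty// ?lee_fin ltW.
have A3 := Lp_integral_iter_central_diff p h l _ (ltW p0) Sf.
(* f is written as S - (S - f): the first part gains from its multipliers, the second pays the crude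
   factor Q for its differences. *)
have -> : iter l (central_diff h) f =
    fun x => iter l (central_diff h) S x - iter l (central_diff h) (fun x => S x - f x) x.
  rewrite -iter_central_diffB; congr (iter _ _ _).
  by apply/funext => x; rewrite subKr.
apply: (le_trans (Lp_integralB_le p _ _ (ltW p0) _ _)).
- by rewrite iter_central_diff_trig_sum; exact: measurable_trig_sum.
- by have [] := circle_Lp_iter_central_diff p h l _ (ltW p0) Sf.
rewrite EFinM -muleA; apply: lee_wpmul2l; first by rewrite lee_fin powR_ge0.
rewrite EFinD ge0_muleDl ?lee_fin ?mulr_ge0 ?powR_ge0 ?(ltW C0) ?(ltW Q0)//.
apply: leeD => //; apply: (le_trans A3); rewrite EFinM -muleA.
by apply: lee_wpmul2l => //; rewrite lee_fin ltW.
Qed.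

End upper_theorem.

(** * Assembling the two-sided estimate *)

Section final.
Context {R : realType}.
Implicit Types (u f : R -> R) (a b v : nat -> R) (p h t : R).

(** General monotonicity bounds v_j by block means from j - s on. Going back s blocks lowers the
    weight by at most 2^(s l), so the weight passes inside the tail and Hardy's inequality applies
    to the weighted means. *)
Lemma dyadic_variation_norm_le p (l s : nat) (C0 : R) : 1 < p -> 0 <= C0 ->
  exists2 C : R, 0 < C & forall a b v t,
  (forall k, (0 < k)%N -> 0 <= a k) -> (forall k, (0 < k)%N -> 0 <= b k) ->
  dyadic_variation s C0 a b v -> 0 < t ->
  (dyadic_norm p (fun j => (dyadic_weight l t j * v j)%R) <=
   C%:E * dyadic_norm p
     (fun j => (dyadic_weight l t j * dyadic_avg (fun k => (a k + b k)%R) j)%R))%E.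
Proof.
move=> p1 C00; have [C Cpos HC] := hardy_dyadic_scaled p p1.
pose c := C0 * ((2 ^+ s) ^+ l * 2 ^+ s).
have c0 : 0 <= c by rewrite !mulr_ge0 ?exprn_ge0.
exists (c `^ p * C + 1); first by rewrite ltr_wpDl// mulr_ge0 ?powR_ge0// ltW.
move=> a b v t a0 b0 [v0 _ _ V3] t0.
pose al := dyadic_avg (fun k => (a k + b k)%R).
have al0 i : 0 <= al i by apply: dyadic_avg_ge0 => k k0; rewrite addr_ge0 ?a0 ?b0.
have w0 j : 0 <= dyadic_weight l t j by exact: dyadic_weight_ge0.
have wal0 i : 0 <= dyadic_weight l t i * al i by rewrite mulr_ge0.
apply: (@le_trans _ _ ((c `^ p * C)%:E * dyadic_norm p (fun j => (dyadic_weight l t j * al j)%R))%E); last first.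
  by apply: lee_wpmul2r; [exact: dyadic_norm_ge0|rewrite lee_fin lerDl].
apply: HC => // [j|j]; first by rewrite mulr_ge0.
have E0 : (0 <= (2 ^+ s) ^+ l :> R) by rewrite !exprn_ge0.
rewrite EFinM; apply: (@le_trans _ _ (C0%:E * ((dyadic_weight l t j)%:E *
    \sum_((j - s)%N <= i <oo) (al i)%:E))%E).
  rewrite muleCA; apply: lee_wpmul2l; [by rewrite lee_fin|exact: V3].
rewrite /c EFinM -[leRHS]muleA; apply: lee_wpmul2l; first by rewrite lee_fin.
rewrite -nneseriesZl; last by move=> i _; rewrite lee_fin.
apply: (@le_trans _ _ (((2 ^+ s) ^+ l)%:E *
    \sum_((j - s)%N <= i <oo) (dyadic_weight l t i * al i)%:E)%E).
  rewrite -nneseriesZl; last by move=> i _; rewrite lee_fin.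
  rewrite eseries_cond [leRHS]eseries_cond.
  apply: lee_nneseries => [i _ _|i /andP[_ ji]]; first by rewrite -EFinM lee_fin mulr_ge0.
  rewrite -!EFinM lee_fin [leRHS]mulrA.
  by apply: ler_wpM2r => //; exact: dyadic_weight_shift.
rewrite EFinM -muleA; apply: lee_wpmul2l; first by rewrite lee_fin.
exact: tail_dyadic_kernel.
Qed.

Lemma poweR_Lnorm_circle p u : p != 0 ->
  (Lnorm (circle_measure R) p%:E (EFin \o u) `^ p)%E = Lp_integral p u.
Proof. by move=> p0; rewrite poweR_Lnorm. Qed.

Lemma Lnorm_circleE p u : p != 0 ->
  Lnorm (circle_measure R) p%:E (EFin \o u) = (Lp_integral p u `^ p^-1)%E.
Proof.
move=> p0; rewrite -poweR_Lnorm_circle// -poweRrM mulfV// poweRe1//.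
exact: Lnorm_ge0.
Qed.

Lemma le_poweR_inv p (C : R) (x z : \bar R) : 0 < p -> 0 <= C ->
  (0 <= x)%E -> (0 <= z)%E -> (x <= C%:E * z)%E ->
  (x `^ p^-1 <= (C `^ p^-1)%:E * z `^ p^-1)%E.
Proof.
move=> p0 C0 x0 z0 xz; rewrite -poweR_EFin -poweRM//.
have Cz0 : (0 <= C%:E * z)%E by rewrite mule_ge0.
apply: gt0_ler_poweR => //; first by rewrite invr_ge0 ltW.
- by rewrite in_itv/= x0 leey.
- by rewrite in_itv/= Cz0 leey.
Qed.

Lemma in_Lp_circle_circle_Lp p f : 0 < p -> in_Lp_circle p f -> circle_Lp p f.
Proof.
move=> p0 [pf]; rewrite inE => /andP[/= mf ff]; split => //.
  by move: mf; rewrite inE.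
rewrite -poweR_Lnorm_circle ?gt_eqF//; apply: poweR_lty.
by move: ff; rewrite inE.
Qed.

(** Frequencies start at 1, so the weights saturate at t = 1; this brings all t > 0 under the lower
    bound, which assumes t <= 1. *)
Lemma dyadic_weight_min1 l t j : dyadic_weight l (Num.min t 1) j = dyadic_weight l t j.
Proof.
rewrite /dyadic_weight; case: (leP t 1) => // t1; rewrite mulr1.
have j1 : 1 <= 2 ^+ j :> R by rewrite exprn_ege1// ler1n.
by rewrite !min_l//; apply: (le_trans j1); rewrite ler_peMr ?ltW// exprn_gt0.
Qed.

End final.

Theorem theorem6p1 (R : realType) (l : nat) (p ca Ca cb Cb : R) :
  (0 < l)%N -> 1 < p ->
  exists2 K : R, 0 < K &
    forall (f : R -> R) (a b : nat -> R),
      in_Lp_circle p f ->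
      has_fourier_series f a b ->
      (forall n, (0 < n)%N -> 0 <= a n) ->
      (forall n, (0 < n)%N -> 0 <= b n) ->
      @general_monotone R R^o ca Ca a ->
      @general_monotone R R^o cb Cb b ->
      forall t : R, 0 < t ->
        ((K^-1)%:E * smoothness_sum l p a b t <= modulus_of_smoothness l p f t
         /\ modulus_of_smoothness l p f t <= K%:E * smoothness_sum l p a b t)%E.
Proof.
move=> _ p1; have p0 : 0 < p by exact: lt_trans p1.
have pn0 : p != 0 by rewrite gt_eqF.
(* Both s and C0 must be fixed before the sequences are given; absolute values stand in for the
   positivity that only the general monotone hypotheses supply. *)
pose s := Num.bound (`|ca| + `|cb|).
pose C0 := `|Ca| + `|Cb|.
have C00 : 0 <= C0 by rewrite addr_ge0.
have [c1 c10 H1] := lower_bound_core p l s C0 p1 C00.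
have [c2 c20 H2] := upper_bound_core p l p1.
have [c3 c30 H3] := dyadic_variation_norm_le p l s C0 p1 C00.
have [c4 c40 H4] := dyadic_norm_avg_le p p1 l.
have [c5 c50 H5] := smoothness_series_le p p1 l.
(* K1 follows the chain from the series through the weighted variation and the weighted means to the
   p-th power of the modulus; K2 follows the chain from the modulus back to the series. *)
pose K1 := (c5 * (c3 * c1)) `^ p^-1; pose K2 := (c2 * (c3 * c4)) `^ p^-1.
have K10 : 0 < K1 by rewrite powR_gt0// !mulr_gt0.
have K20 : 0 < K2 by rewrite powR_gt0// !mulr_gt0.
exists (K1 + K2); first by rewrite addr_gt0.
move=> f a b fp [f0 fa fb] a0 b0 ga gb t t0.
have cp := in_Lp_circle_circle_Lp p f p0 fp.
have pi0 : pi != 0 :> R by rewrite gt_eqF// pi_gt0.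
have fc : fourier_coeffs f a b.
  move=> n n0; rewrite fa// fb// !mulrA divff// !mul1r; split=> //.
have s2 : `|ca| + `|cb| <= 2 ^+ s.
  apply: le_trans (ltW (archi_boundP _)) _; first by rewrite addr_ge0.
  by rewrite -natrX ler_nat ltnW// ltn_expl.
have cas : ca <= 2 ^+ s.
  by apply: le_trans s2; apply: le_trans (ler_norm _) _; rewrite lerDl.
have cbs : cb <= 2 ^+ s.
  by apply: le_trans s2; apply: le_trans (ler_norm _) _; rewrite lerDr.
have [v] := gm_dyadic_variation p a b ca Ca cb Cb s p1 ga gb a0 b0 cas cbs
  (dyadic_norm_avg_fin p f a b p1 cp fc a0 b0).
have -> : Ca + Cb = C0.
  by have [_ Ca0 _ _] := ga; have [_ Cb0 _ _] := gb; rewrite /C0 !gtr0_norm.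
move=> vv.
have Si0 : (0 <= smoothness_series p l a b t)%E.
  apply: nneseries_ge0 => k k0 _; rewrite lee_fin /smoothness_term.
  by rewrite mulr_ge0 ?addr_ge0 ?mulr_ge0 ?powR_ge0.
have M0 : (0 <= modulus_of_smoothness l p f t)%E.
  apply: (@le_trans _ _ (Lnorm (circle_measure R) p%:E (EFin \o iter l (fwd_diff 0) f))).
    exact: Lnorm_ge0.
  by apply: ereal_sup_ubound; exists 0; rewrite //= normr0 ltW.
(* The steps |h| <= t1 are among those of the supremum at t, and the weights at t and t1 agree. *)
pose t1 := Num.min t 1.
have t1t : t1 <= t by rewrite ge_min lexx.
have t101 : 0 < t1 <= 1 by rewrite lt_min t0 ltr01 ge_min lexx orbT.
have low : (smoothness_series p l a b t <=
    (c5 * (c3 * c1))%:E * modulus_of_smoothness l p f t `^ p)%E.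
  apply: (le_trans (H5 a b v s C0 t a0 b0 t0 vv)).
  rewrite EFinM -muleA; apply: lee_wpmul2l; first by rewrite lee_fin ltW.
  apply: (le_trans (H3 a b v t a0 b0 vv t0)).
  rewrite EFinM -muleA; apply: lee_wpmul2l; first by rewrite lee_fin ltW.
  under eq_fun do rewrite -dyadic_weight_min1.
  apply: (H1 f a b v t1 _ cp fc a0 b0 vv t101) => h ht.
  rewrite -(Lp_integral_iter_fwd_diff p h l f (ltW p0) cp) -poweR_Lnorm_circle//.
  apply: gt0_ler_poweR; first exact: ltW.
  - by rewrite in_itv/= leey Lnorm_ge0.
  - by rewrite in_itv/= leey M0.
  by apply: ereal_sup_ubound; exists h => //=; apply: le_trans t1t.
have smE : smoothness_sum l p a b t = (smoothness_series p l a b t `^ p^-1)%E by [].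
have sm0 : (0 <= smoothness_sum l p a b t)%E by exact: poweR_ge0.
split.
  rewrite lee_pdivrMl ?addr_gt0// smE.
  have Mp0 : (0 <= modulus_of_smoothness l p f t `^ p)%E by exact: poweR_ge0.
  have cc : 0 <= c5 * (c3 * c1) by rewrite !mulr_ge0 ?ltW.
  apply: (le_trans (le_poweR_inv p _ _ _ p0 cc Si0 Mp0 low)).
  rewrite -poweRrM mulfV// poweRe1//; apply: lee_wpmul2r => //.
  by rewrite lee_fin lerDl ltW.
apply: (@le_trans _ _ (K2%:E * smoothness_sum l p a b t)%E); last first.
  by apply: lee_wpmul2r => //; rewrite lee_fin lerDr ltW.
apply: ge_ereal_sup => _ [h /= ht <-].
rewrite Lnorm_circleE// Lp_integral_iter_fwd_diff ?(ltW p0)// smE.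
apply: le_poweR_inv => //; first by rewrite !mulr_ge0 ?ltW.
  by apply: integral_ge0 => x _; rewrite lee_fin powR_ge0.
apply: (le_trans (H2 f a b v s C0 t h cp f0 fc a0 b0 vv t0 ht)).
rewrite EFinM -muleA; apply: lee_wpmul2l; first by rewrite lee_fin ltW.
apply: (le_trans (H3 a b v t a0 b0 vv t0)).
rewrite EFinM -muleA; apply: lee_wpmul2l; first by rewrite lee_fin ltW.
exact: H4.
Qed.
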